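(* Let $\alpha,\beta>0$, $\gamma,\delta\ge0$, $0\le q<1$ be fixed, with associated $A,B,C,D$, and for each $n\ge1$ let $(\tau_1,\dots,\tau_n)$ be distributed according to the stationary measure $\mu_n$ of the $n$-site open ASEP with parameters $(q,\alpha,\beta,\gamma,\delta)$. Define, for $x\in[0,1]$, $$h_n^{\mathrm H}(x)=\sum_{i=1}^{\lfloor nx\rfloor}\Big(\tau_i-\frac{A}{1+A}\Big),\qquad h_n^{\mathrm L}(x)=\sum_{i=1}^{\lfloor nx\rfloor}\Big(\tau_i-\frac1{1+C}\Big).$$ (1) (High density phase) If $A>C$ and $A>1$, then as $n\to\infty$, in the sense of convergence of finite-dimensional distributions, $$\frac1{\sqrt n}\{h_n^{\mathrm H}(x)\}_{x\in[0,1]}\Longrightarrow\frac{\sqrt A}{1+A}\{\mathbb B(x)\}_{x\in[0,1]}.$$ (2) (Low density phase) If $C>A$ and $C>1$, then as $n\to\infty$, in the sense of convergence of finite-dimensional distributions, $$\frac1{\sqrt n}\{h_n^{\mathrm L}(x)\}_{x\in[0,1]}\Longrightarrow\frac{\sqrt C}{1+C}\{\mathbb B(x)\}_{x\in[0,1]}.$$ Here $\mathbb B$ is a standard Brownian motion.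
   Context: Open ASEP. Parameters $\alpha,\beta>0$, $\gamma,\delta\ge 0$, $0\le q<1$. It is the continuous-time irreducible Markov process on $\{0,1\}^n$ (with $\tau_i\in\{0,1\}$ the occupation variable of site $i\in\{1,\dots,n\}$) in which each particle jumps to its right neighbour at rate $1$ and to its left neighbour at rate $q$, jumps to occupied sites being forbidden; at site $1$ a particle is created at rate $\alpha$ if the site is empty and removed at rate $\gamma$ if it is occupied; at site $n$ a particle is created at rate $\delta$ if the site is empty and removed at rate $\beta$ if it is occupied. $\mu_n$ is its unique stationary probability measure. With $$\kappa_\pm(x,y)=\frac1{2x}\Big(1-q-x+y\pm\sqrt{(1-q-x+y)^2+4xy}\Big)$$ put $A=\kappa_+(\beta,\delta)$, $B=\kappa_-(\beta,\delta)$, $C=\kappa_+(\alpha,\gamma)$, $D=\kappa_-(\alpha,\gamma)$; then $A,C\ge0$ and $-1<B,D\le0$. *)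

(* Defs.v *)
From HB Require Import structures.
From mathcomp Require Import all_boot all_order all_algebra perm.
From mathcomp Require Import all_classical all_reals all_analysis.

Set Implicit Arguments.
Unset Strict Implicit.
Unset Printing Implicit Defensive.

Import Order.TTheory GRing.Theory Num.Theory.
Import numFieldTopology.Exports numFieldNormedType.Exports.

Local Open Scope classical_set_scope.
Local Open Scope ring_scope.

Section markov_process.
Context {R : realType} {S : finType}.
Implicit Types (L : (S -> R) -> S -> R) (m f : S -> R).

(* The transition semigroup exp(tL) of the continuous-time Markov process with
   generator L.  The entrywise series always converges when L is linear. *)
Definition semigroup L (t : R) f (s : S) : R :=
  limn (series (fun k => t ^+ k / k`!%:R * iter k L f s)).

Definition prob_weight m : Prop :=
  (forall s, 0 <= m s) /\ \sum_s m s = 1.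

Definition stationary_measure L m : Prop :=
  prob_weight m /\
  forall t f, 0 <= t -> \sum_s m s * semigroup L t f s = \sum_s m s * f s.

End markov_process.

(* The site i of {1, ..., n} is the element i - 1 of 'I_n. *)
Definition config (n : nat) : finType := {ffun 'I_n -> bool}.

Definition exchange n (tau : config n) (i j : 'I_n) : config n :=
  [ffun k => tau (tperm i j k)].

Definition flip n (tau : config n) (i : 'I_n) : config n :=
  [ffun k => if k == i then ~~ tau k else tau k].

Section open_asep.
Context {R : realType}.
Implicit Types (q alpha beta gamma delta : R).

Definition bulk_rate q n (tau : config n) (i j : 'I_n) : R :=
  if tau i && ~~ tau j then 1 else if ~~ tau i && tau j then q else 0.

(* For n = 1 both reservoirs act on the same site and their rates add up. *)
Definition asep_generator q alpha beta gamma delta n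
    (f : config n -> R) (tau : config n) : R :=
  \sum_(i < n) \sum_(j < n | val j == (val i).+1)
     bulk_rate q tau i j * (f (exchange tau i j) - f tau)
  + \sum_(i < n | val i == 0%N)
     (if tau i then gamma else alpha) * (f (flip tau i) - f tau)
  + \sum_(i < n | (val i).+1 == n)
     (if tau i then beta else delta) * (f (flip tau i) - f tau).

Definition kappa_plus q x y : R :=
  (1 - q - x + y + Num.sqrt ((1 - q - x + y) ^+ 2 + 4 * x * y)) / (2 * x).

Definition height (rho : R) n (tau : config n) (x : R) : R :=
  \sum_(i < n | (i < Num.truncn (n%:R * x))%N) ((tau i)%:R - rho).

End open_asep.

Section brownian.
Context {R : realType} {d : measure_display} {T : measurableType d}.
Variable P : probability T R.

Definition mutually_independent (I : finType) (X : I -> T -> R) : Prop :=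
  forall (J : {set I}) (U : I -> set R), (forall i, measurable (U i)) ->
  P [set w | forall i, i \in J -> U i (X i w)]
  = (\prod_(i in J) P [set w | U i (X i w)])%E.

(* Only the restriction of W to the time interval [0, 1] is constrained.  The
   second argument of normal_prob is a standard deviation. *)
Definition standard_brownian_motion (W : R -> {RV P >-> R}) : Prop :=
  [/\ {ae P, forall w, W 0 w = 0},
      forall s t : R, 0 <= s -> s < t -> t <= 1 ->
        forall U : set R, measurable U ->
        P [set w | U (W t w - W s w)] = normal_prob 0 (Num.sqrt (t - s)) U,
      forall (k : nat) (t : nat -> R), nondecreasing_seq t ->
        (forall i, 0 <= t i <= 1) ->
        mutually_independent (fun (i : 'I_k) w => W (t i.+1) w - W (t i) w) &
      {ae P, forall w, {within `[0, 1], continuous (fun t : R => W t w)}}].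

(* Convergence of finite-dimensional distributions on [0, 1]: each vector of
   marginals of the process X n, defined on the finite set S n weighted by m n,
   converges weakly to the corresponding vector of marginals of Y. *)
Definition fdd_cvg (S : nat -> finType) (m : forall n, S n -> R)
    (X : forall n, R -> S n -> R) (Y : R -> T -> R) : Prop :=
  forall (k : nat) (x : 'I_k -> R), (forall i, 0 <= x i <= 1) ->
  forall f : 'rV[R]_k -> R, continuous f ->
  (exists M : R, forall y, `|f y| <= M) ->
  (\sum_(s : S n) m n s * f (\row_i X n (x i) s))%:E @[n --> \oo]
    --> 'E_P[fun w => f (\row_i Y (x i) w)]%E.

End brownian.

(* Main.v *)
Require Import Defs.
From HB Require Import structures.
From mathcomp Require Import all_boot all_order all_algebra perm.
From mathcomp Require Import all_classical all_reals all_analysis.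
From mathcomp Require Import measurable_realfun ring lra zify.

Set Implicit Arguments.
Unset Strict Implicit.
Unset Printing Implicit Defensive.

Import Order.TTheory GRing.Theory Num.Theory.
Import numFieldTopology.Exports numFieldNormedType.Exports.

Local Open Scope classical_set_scope.
Local Open Scope ring_scope.

(** By particle-hole symmetry combined with reflection it suffices to treat the
high density phase.  The matrix ansatz gives the stationary weights as
<W| X_1 ... X_n |V> with X_i equal to D = 1 + d or E = 1 + e, where
de - q ed = 1 - q.  In the coordinates <W| e^j |V>, rescaled by A^j, the
operator D + E becomes (a multiple of) a birth-death Markov operator, which is
contracting because A > 1, and D and E separately act on constants as the
scalars 1 + A and 1 + 1/A.  Hence, up to an error exponentially small in m, the
stationary measure and the product Bernoulli measure of density A / (1 + A)
give the same probability to events that do not involve the m leftmost sites;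
A > C ensures that the boundary vector grows at a geometric rate below A ^ 2,
where this contraction holds, and one checks that the limiting functional does
not vanish on it.

For the Bernoulli measure the central limit theorem follows by comparing
characteristic functions with those of the Gaussian increments, factor by
factor.  Since sites near the edge contribute O(m / sqrt n) to the height, the
limit transfers to the stationary measure for test functions cos (u . y + c).
Bounded continuous test functions are approximated, uniformly on a box, by
trigonometric polynomials obtained from Bernstein polynomials in
(1 + sin (y_j / (2a))) / 2; these keep the bound of the function, and the
complement of the box is controlled by second moments. *)

(** * The matrix ansatz *)

(** The amplitudes may be signed, and their sum over configurations can vanish for small sizes.
    Uniqueness is therefore proved for signed invariant weights, which makes each amplitude the
    total times [mu]. Divided by [lam ^+ n], the total converges to [scaled_lim g], the mean of the
    boundary vector [g] under the invariant law of the birth-death chain, so it suffices that this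
    mean is nonzero.

    The obstacle is that [g] can change sign. If its mean vanished, so would that of [d g], hence
    that of [g - C * d g], which is a boundary vector with [C] replaced by [q * C]. Repeating this
    for [C] and [D] in turn makes both parameters small; then [g] is nearly a multiple of the
    indicator of 0, whose mean is nonzero.

    On the Gaussian side only the real moment generating function enters: [cos + ch - 2] and
    [sin - sh] are small near 0, which gives the characteristic function up to a third-order error.
    That is enough for [n] comparisons at scale [1 / sqrt n]. The Gaussian variables are increments
    of the given Brownian motion itself. *)

Definition dense_regime {R : realType} (q A B : R) :=
  [/\ 0 <= q, q < 1, 1 < A, -1 < B & B <= 0].

Section operators.
Context {R : realType} (q A B : R).
Hypothesis qAB : dense_regime q A B.
Let q_ge0 : 0 <= q. Proof. by case: qAB. Qed.
Let q_lt1 : q < 1. Proof. by case: qAB. Qed.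
Let A_gt1 : 1 < A. Proof. by case: qAB. Qed.
Let B_gtN1 : -1 < B. Proof. by case: qAB. Qed.
Let B_le0 : B <= 0. Proof. by case: qAB. Qed.
Local Ltac hyps := pose proof q_ge0 as Hq0; pose proof q_lt1 as Hq1; pose proof A_gt1 as HA1;
  pose proof B_gtN1 as HB1; pose proof B_le0 as HB0.
Local Ltac slra := hyps; intros; lra.
Local Ltac snra := hyps; intros; nra.
Implicit Types (g h : nat -> R) (b : bool) (m n j : nat).

(* A row vector <W| is encoded by g_j = A^j <W| e^j |V>, where
   (d + A B e)|V> = (A + B)|V>; then E = 1 + e and D = 1 + d act as opE and opD. *)
Definition opE g j := g j + g j.+1 / A.
(** Moving [d] to the right through [e ^ j] gives [q ^ j e ^ j d + (1 - q ^ j) e ^ (j - 1)], and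
    [d |V>] is then eliminated by the boundary relation. At [j = 0] the entry [j.-1] has coefficient
    zero. *)
Definition opD g j :=
  (1 + (A + B) * q ^+ j) * g j - B * q ^+ j * g j.+1
  + A * (1 - q ^+ j) * g j.-1.
Definition op b := if b then opD else opE.
Definition opP g j := opD g j + opE g j.
(** The common row sum of [opP], which makes [opP / lam] a Markov operator. *)
Definition lam := 2 + A + A^-1.

Let A_gt0 : 0 < A. Proof. by slra. Qed.
Let A_neq0 : A != 0. Proof. by rewrite gt_eqF. Qed.

Lemma expq_le1 j : 0 <= q ^+ j <= 1.
Proof. by apply/andP; split; [exact: exprn_ge0|apply: exprn_ile1 => //; exact: ltW]. Qed.

Lemma lam_gt0 : 0 < lam.
Proof. rewrite /lam; have H : 0 < A^-1. by rewrite invr_gt0. hyps. intros. lra. Qed.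

Lemma op_linear b (a : R) g h j :
  op b (fun j => a * g j + h j) j = a * op b g j + op b h j.
Proof. by case: b; rewrite /op /opD /opE; ring. Qed.

Lemma opP_linear (a : R) g h j :
  opP (fun j => a * g j + h j) j = a * opP g j + opP h j.
Proof. by rewrite /opP /opD /opE; ring. Qed.

(** The relation [D E - q E D = (1 - q) (D + E)]. The operators act on row vectors, so the leftmost
    letter is applied first and the order of composition is reversed. *)
Lemma opED g j : opE (opD g) j - q * opD (opE g) j = (1 - q) * opP g j.
Proof.
rewrite /opP /opE /opD; case: j => [|j] /=; rewrite ?expr0 ?exprS; field; rewrite ?A_neq0 ?t0 ?andbT //.
Qed.

(** All coefficients are nonnegative: [A + B > 0] takes care of the diagonal of [opD], and [B <= 0]
    of its coefficient of [g j.+1]. *)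
Lemma op_le b g h : (forall j, g j <= h j) -> forall j, op b g j <= op b h j.
Proof.
move=> gh j; case: b; rewrite /op /opD /opE.
  have /andP[qj0 qj1] := expq_le1 j.
  apply: lerD; first apply: lerD.
  - apply: ler_wpM2l (gh _); snra.
  - rewrite -!mulNr; apply: ler_wpM2l (gh _); snra.
  - apply: ler_wpM2l (gh _); snra.
by apply: lerD (gh _) _; apply: ler_wpM2r (gh _); rewrite invr_ge0 ltW.
Qed.

Lemma opP_le g h : (forall j, g j <= h j) -> forall j, opP g j <= opP h j.
Proof.
by move=> gh j; apply: lerD; [exact: (op_le true)|exact: (op_le false)].
Qed.

Lemma iter_opP_linear (a : R) g h n j :
  iter n opP (fun j => a * g j + h j) j = a * iter n opP g j + iter n opP h j.
Proof.
elim: n j => // n IH j; rewrite !iterS -opP_linear.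
by congr opP; apply/funext.
Qed.

Lemma iter_opP_le g h n : (forall j, g j <= h j) ->
  forall j, iter n opP g j <= iter n opP h j.
Proof. by move=> gh; elim: n => // n IH j; rewrite !iterS opP_le. Qed.

Lemma opP_cst (c : R) j : opP (cst c) j = lam * c.
Proof. by rewrite /opP /opD /opE /lam/=; field. Qed.

Lemma iter_opP_cst (c : R) n j : iter n opP (cst c) j = lam ^+ n * c.
Proof.
elim: n j => [|n IH] j; first by rewrite expr0 mul1r.
rewrite iterS (_ : iter n opP _ = cst (lam ^+ n * c)); last exact/funext.
by rewrite opP_cst mulrA -exprS.
Qed.

Definition fdiff g j := g j.+1 - g j.
(** The operator induced by [opP] on increments, which exists because constants are eigenvectors.
    Its coefficients are again nonnegative, but its row sums fall short of [lam] only by a multiple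
    of [q ^+ j]; a contraction therefore needs weighted norms. *)
Definition opQ (u : nat -> R) j :=
  (2 + B * q ^+ j + A * q ^+ j.+1) * u j
  + (A^-1 - B * q ^+ j.+1) * u j.+1 + A * (1 - q ^+ j) * u j.-1.

Lemma diff_opP g j : fdiff (opP g) j = opQ (fdiff g) j.
Proof.
rewrite /fdiff /opQ /opP /opD /opE; case: j => [|j] /=; rewrite ?expr0 ?exprS; field; rewrite ?A_neq0 ?t0 ?andbT //.
Qed.

Context (s : R).
Hypotheses (s_gt1 : 1 < s) (s_ltA2 : s < A ^+ 2).
Local Ltac hyps2 := hyps; pose proof s_gt1 as Hs1; pose proof s_ltA2 as HsA.
Local Ltac tlra := hyps2; intros; lra.
Local Ltac tnra := hyps2; intros; nra.
(** Far from 0, [opP] and [opQ] multiply [t ^ j] by nearly [2 + t / A + A / t], which is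
    [lam - gap t]. *)
Definition gap (t : R) := (t - 1) * (A / t - A^-1).

Lemma gap_gt0 (t : R) : 1 < t -> t < A ^+ 2 -> 0 < gap t.
Proof.
move=> t1 tA; rewrite mulr_gt0 ?subr_gt0//.
by rewrite ltr_pdivlMr ?(lt_trans _ t1)// mulrC ltr_pdivrMr// -expr2.
Qed.

Lemma gap_lt_lam (t : R) : 1 < t -> t < A ^+ 2 -> gap t < lam.
Proof.
move=> t1 tA; rewrite -subr_gt0 (_ : _ - _ = 2 + t / A + A / t); last first.
  by rewrite /lam /gap; field; rewrite A_neq0/= gt_eqF// (lt_trans _ t1).
have : 0 < t / A by rewrite divr_gt0//; tlra.
have : 0 < A / t by rewrite divr_gt0//; tlra.
tlra.
Qed.

Lemma opQ_geom (t : R) j : 1 < t ->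
  opQ (fun i => t ^+ i) j
  = (lam - gap t + q ^+ j * ((t * q - 1) * (A / t - B))) * t ^+ j.
Proof.
move=> t1; have t0 : t != 0 by rewrite gt_eqF//; tlra.
rewrite /opQ /lam /gap; case: j => [|j] /=; rewrite ?expr0 ?exprS; field; rewrite ?A_neq0 ?t0 ?andbT //.
Qed.

Lemma opP_geom (t : R) j : 1 < t ->
  opP (fun i => t ^+ i) j
  = (lam - gap t + q ^+ j * ((t - 1) * (A / t - B))) * t ^+ j.
Proof.
move=> t1; have t0 : t != 0 by rewrite gt_eqF//; tlra.
rewrite /opP /opD /opE /lam /gap; case: j => [|j] /=; rewrite ?expr0 ?exprS; field; rewrite ?A_neq0 ?t0 ?andbT //.
Qed.

Lemma expq_small (e : R) : 0 < e -> exists N, forall j, (N <= j)%N -> q ^+ j <= e.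
Proof.
move=> e0; have q1 : `|q| < 1 by rewrite ger0_norm.
have /cvgrPdist_lt /(_ e e0) [N _ HN] := cvg_expr q1.
exists N => j Nj; have := HN j Nj; rewrite sub0r normrN ger0_norm ?exprn_ge0//.
exact: ltW.
Qed.

(** A Foster-Lyapunov argument with [s ^ j] as Lyapunov function: one step multiplies it by some
    [a < lam] up to an additive constant, and the accumulated constants are of order [lam ^+ n]. *)
Lemma iter_opP_geom_le :
  exists K : R, 0 < K /\ forall n, iter n opP (fun i => s ^+ i) 0%N <= K * lam ^+ n.
Proof.
have c0 := gap_gt0 s_gt1 s_ltA2; set c := gap s in c0.
set E := (s - 1) * (A / s - B).
have E0 : 0 <= E.
  rewrite mulr_ge0//; first tlra.
  have : 0 < A / s by rewrite divr_gt0//; tlra.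
  by tlra. 
have [N HN] : exists N, forall j, (N <= j)%N -> q ^+ j <= (c / 2) / (E + 1).
  by apply: expq_small; rewrite divr_gt0//; tlra.
have [s0 sN0] : 0 < s /\ 0 < s ^+ N by rewrite exprn_gt0; tlra.
set K0 := E * s ^+ N; have K00 : 0 <= K0 by rewrite mulr_ge0// ltW.
set a := lam - c / 2.
(* Half of the gap absorbs the term in [q ^+ j] from [N] on; the finitely many earlier entries go
   into [K0]. *)
have step j : opP (fun i => s ^+ i) j <= a * s ^+ j + K0.
  rewrite opP_geom// -/c -/E.
  have sj0 : 0 < s ^+ j by rewrite exprn_gt0.
  have [Nj|jN] := leqP N j.
    suff : q ^+ j * E <= c / 2 by rewrite /a; tnra.
    have := HN j Nj; rewrite ler_pdivlMr; last tlra.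
    have /andP[] := expq_le1 j; tnra.
  have : q ^+ j * E * s ^+ j <= K0.
    rewrite /K0; apply: ler_pM => //; try exact: ltW.
      by rewrite mulr_ge0//; have /andP[] := expq_le1 j.
    by rewrite ler_piMl//; have /andP[] := expq_le1 j.
    by rewrite ler_eXn2l// ltnW.
  have : c / 2 * s ^+ j >= 0 by rewrite mulr_ge0//; tlra.
  rewrite /a; tnra.
have a0 : 0 <= a by have := gap_lt_lam s_gt1 s_ltA2; rewrite -/c /a; tlra.
have alam : a <= lam by rewrite /a; tlra.
(* Solves [Y * (lam - a) = K0], so that the bound [main] reproduces itself. *)
set Y := K0 / (c / 2).
have Y0 : 0 <= Y by rewrite divr_ge0//; tlra.
have YK : Y * (c / 2) = K0 by rewrite /Y divfK//; apply: lt0r_neq0; tlra.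
have main n j : iter n opP (fun i => s ^+ i) j
    <= a ^+ n * s ^+ j + Y * (lam ^+ n - a ^+ n).
  elim: n j => [|n IH] j; first by rewrite !expr0 subrr mulr0 addr0 mul1r.
  rewrite iterS; apply: le_trans (opP_le IH j) _.
  have -> : (fun j => a ^+ n * s ^+ j + Y * (lam ^+ n - a ^+ n))
     = (fun j => a ^+ n * (fun i => s ^+ i) j + cst (Y * (lam ^+ n - a ^+ n)) j).
    by apply/funext.
  rewrite opP_linear opP_cst !exprS.
  apply: le_trans (lerD (ler_wpM2l (exprn_ge0 n a0) (step j)) (lexx _)) _.
  by rewrite -YK /a; tlra.
exists (1 + Y); split; first tlra.
move=> n; apply: le_trans (main n 0%N) _; rewrite expr0 mulr1.
have : a ^+ n <= lam ^+ n by rewrite lerXn2r// nnegrE ltW// lam_gt0.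
have : 0 <= a ^+ n by rewrite exprn_ge0.
tnra.
Qed.

Lemma opQ_le_norm (u v : nat -> R) j :
  (forall j, `|u j| <= v j) -> `|opQ u j| <= opQ v j.
Proof.
move=> uv; have /andP[qj0 qj1] := expq_le1 j; have /andP[qS0 qS1] := expq_le1 j.+1.
have iA : 0 < A^-1 by rewrite invr_gt0.
rewrite /opQ; apply: le_trans (ler_normD _ _) (lerD _ _).
  apply: le_trans (ler_normD _ _) (lerD _ _); rewrite normrM.
    by rewrite ger0_norm ?ler_wpM2l//; tnra.
  by rewrite ger0_norm ?ler_wpM2l//; tnra.
by rewrite normrM ger0_norm ?ler_wpM2l//; tnra.
Qed.

(** The correction to the factor of [t ^ j] has the sign of [t * q - 1]. For [t <= 1 / q] the
    function [t ^ j] is thus contracted at every [j], and a large multiple [M] of it pays for the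
    excess that [s ^ j] may have at small [j]. Since [t <= s], the weight stays comparable to
    [s ^ j]. *)
Lemma opQ_contraction : exists v : nat -> R, exists M th : R,
  [/\ 0 < th, th < 1, 0 < M, forall j, s ^+ j <= v j <= M * s ^+ j &
      forall j, opQ v j <= lam * th * v j].
Proof.
have [t [t1 ts tq]] : exists t : R, [/\ 1 < t, t <= s & t * q <= 1].
  have [sq|sq] := leP (s * q) 1; first by exists s.
  have q0 : 0 < q by rewrite lt_neqAle q_ge0 andbT; apply: contraTneq sq => <-; rewrite mulr0 -leNgt ler01.
  exists q^-1; split; first by rewrite invf_gt1.
    by rewrite -[_^-1]mul1r ler_pdivrMr// ltW.
  by rewrite mulVf// gt_eqF.
have tA : t < A ^+ 2 by apply: le_lt_trans ts _.
have c0 := gap_gt0 s_gt1 s_ltA2; set c := gap s in c0.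
have d0 := gap_gt0 t1 tA; set d := gap t in d0.
set E := `|(s * q - 1) * (A / s - B)|.
have E0 : 0 <= E by rewrite normr_ge0.
have [N HN] : exists N, forall j, (N <= j)%N -> q ^+ j <= (c / 2) / (E + 1).
  by apply: expq_small; rewrite divr_gt0//; tlra.
have [s0 sN0] : 0 < s /\ 0 < s ^+ N by rewrite exprn_gt0; tlra.
set M := E * s ^+ N / (d / 2).
have M0 : 0 <= M.
  by apply: divr_ge0; [apply: mulr_ge0 => //; exact: ltW|tlra].
have MN : M * (d / 2) = E * s ^+ N by rewrite /M divfK//; apply: lt0r_neq0; tlra.
set k := Num.min (c / 2) (d / 2).
have [k0 kc kd] : [/\ 0 < k, k <= c / 2 & k <= d / 2].
  by rewrite /k lt_min !ge_min !lexx/= orbT; split => //; tlra.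
have klam : k < lam.
  by apply: le_lt_trans (gap_lt_lam s_gt1 s_ltA2); rewrite -/c; clearbody k c; lra.
have l0 := lam_gt0.
exists (fun j => s ^+ j + M * t ^+ j), (1 + M), ((lam - k) / lam); split.
- by rewrite divr_gt0//; tlra.
- by rewrite ltr_pdivrMr//; tlra.
- by tlra.
- move=> j; have tj : 0 <= t ^+ j by rewrite exprn_ge0//; tlra.
  have : t ^+ j <= s ^+ j by rewrite lerXn2r// nnegrE; tlra.
  move=> ts'; apply/andP; split; first by rewrite lerDl mulr_ge0.
  by rewrite mulrDl mul1r lerD2l ler_wpM2l.
move=> j; rewrite [lam * _]mulrC divfK ?gt_eqF//.
have -> : opQ (fun j => s ^+ j + M * t ^+ j) j
    = opQ (fun j => s ^+ j) j + M * opQ (fun j => t ^+ j) j.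
  by rewrite /opQ; ring.
rewrite !opQ_geom// -/c -/d.
have sj0 : 0 < s ^+ j by rewrite exprn_gt0.
have tj1 : 1 <= t ^+ j by rewrite exprn_ege1// ltW.
have /andP[qj0 qj1] := expq_le1 j.
have At0 : 0 <= A / t - B.
  have : 0 < A / t by rewrite divr_gt0//; tlra.
  by tlra.
have H1 : M * ((lam - d + q ^+ j * ((t * q - 1) * (A / t - B))) * t ^+ j)
          <= M * ((lam - d) * t ^+ j).
  apply: ler_wpM2l => //; apply: ler_wpM2r; first tlra.
  by rewrite gerDl; apply: mulr_ge0_le0 => //; apply: mulr_le0_ge0 => //; tlra.
have H2 : (s * q - 1) * (A / s - B) <= E by exact: ler_norm.
suff H3 : q ^+ j * E * s ^+ j <= c / 2 * s ^+ j + M * (d / 2) * t ^+ j.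
  have H4 : q ^+ j * ((s * q - 1) * (A / s - B)) * s ^+ j <= q ^+ j * E * s ^+ j.
    by apply: ler_wpM2r; [exact: ltW|apply: ler_wpM2l].
  have H5 : k * s ^+ j <= c / 2 * s ^+ j by rewrite ler_wpM2r// ltW.
  have H6 : M * (k * t ^+ j) <= M * (d / 2 * t ^+ j).
    by apply: ler_wpM2l => //; apply: ler_wpM2r => //; tlra.
  tlra.
have [Nj|jN] := leqP N j.
  have : q ^+ j * E <= c / 2 by have := HN j Nj; rewrite ler_pdivlMr; tnra.
  move=> H; apply: ler_wpDr; last by rewrite ler_wpM2r// ltW.
  by apply: mulr_ge0; [apply: mulr_ge0 => //; lra|lra].
apply: ler_wpDl; first by apply: mulr_ge0; [lra|exact: ltW].
rewrite MN; apply: (@le_trans _ _ (E * s ^+ N)); last first.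
  by rewrite ler_peMr// mulr_ge0// ltW.
apply: ler_pM; rewrite ?mulr_ge0//; try exact: ltW.
  by rewrite ler_piMl.
by rewrite ler_eXn2l// ltnW.
Qed.

End operators.

(** * Convergence of the birth-death chain and its invariant functional *)

Section growth.
Context {R : realType} (q A B s : R).
Hypotheses (qAB : dense_regime q A B) (s_gt1 : 1 < s) (s_ltA2 : s < A ^+ 2).
Implicit Types (g h : nat -> R) (m n j : nat).
Local Notation opE := (opE A).
Local Notation opD := (opD q A B).
Local Notation opP := (opP q A B).
Local Notation lam := (lam A).

Let q_ge0 : 0 <= q. Proof. by case: qAB. Qed.
Let q_lt1 : q < 1. Proof. by case: qAB. Qed.
Let A_gt1 : 1 < A. Proof. by case: qAB. Qed.
Let B_gtN1 : -1 < B. Proof. by case: qAB. Qed.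
Let B_le0 : B <= 0. Proof. by case: qAB. Qed.
Let A_gt0 : 0 < A. Proof. exact: lt_trans A_gt1. Qed.
Let s_gt0 : 0 < s. Proof. exact: lt_trans s_gt1. Qed.
Let lam0 := lam_gt0 qAB.
Let q01 := expq_le1 qAB.

Definition geom_bounded g := exists K : R, forall j, `|g j| <= K * s ^+ j.

Lemma geom_boundedW g : geom_bounded g ->
  exists2 K : R, 0 < K & forall j, `|g j| <= K * s ^+ j.
Proof.
move=> [K HK]; exists (`|K| + 1); first by rewrite ltr_wpDl.
move=> j; apply: le_trans (HK j) _; apply: ler_wpM2r; first by rewrite exprn_ge0// ltW.
by rewrite (le_trans (ler_norm _))// lerDl.
Qed.

Lemma geom_bounded_linear (a : R) g h : geom_bounded g -> geom_bounded h ->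
  geom_bounded (fun j => a * g j + h j).
Proof.
move=> [K HK] [L HL]; exists (`|a| * K + L) => j; rewrite mulrDl.
by apply: le_trans (ler_normD _ _) (lerD _ (HL j)); rewrite normrM -mulrA ler_wpM2l.
Qed.

Lemma geom_bounded_cst (c : R) : geom_bounded (cst c).
Proof. by exists `|c| => j; rewrite ler_peMr// exprn_ege1// ltW. Qed.

Lemma geom_boundedS g : geom_bounded g -> geom_bounded (fun j => g j.+1).
Proof. by move=> [K HK]; exists (K * s) => j; rewrite -mulrA -exprS. Qed.

Lemma geom_bounded_predn g : geom_bounded g -> geom_bounded (fun j => g j.-1).
Proof.
move=> /geom_boundedW [K K0 HK]; exists K => j; apply: le_trans (HK _) _.
by apply: ler_wpM2l; [exact: ltW|rewrite ler_eXn2l// leq_pred].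
Qed.

Lemma geom_bounded_mul (a : nat -> R) (M : R) g : (forall j, `|a j| <= M) ->
  geom_bounded g -> geom_bounded (fun j => a j * g j).
Proof.
move=> aM [K HK]; exists (M * K) => j; rewrite normrM -mulrA.
by apply: ler_pM.
Qed.

Lemma geom_boundedD g h : geom_bounded g -> geom_bounded h ->
  geom_bounded (fun j => g j + h j).
Proof.
move=> gb hb; have := @geom_bounded_linear 1 g h gb hb; congr geom_bounded.
by apply/funext => j; rewrite mul1r.
Qed.

Lemma geom_bounded_opE g : geom_bounded g -> geom_bounded (opE g).
Proof.
move=> gb; apply: geom_boundedD => //.
have := @geom_bounded_linear A^-1 _ (cst 0) (geom_boundedS gb) (geom_bounded_cst 0).
by congr geom_bounded; apply/funext => j /=; rewrite addr0 mulrC.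
Qed.

Lemma geom_bounded_opD g : geom_bounded g -> geom_bounded (opD g).
Proof.
move=> gb; rewrite /opD.
apply: geom_boundedD; first apply: geom_boundedD.
- apply: (@geom_bounded_mul _ (1 + (A + 1))) => // j; have := q01 j; move: A_gt1 B_gtN1 B_le0.
  by rewrite ler_norml => ? ? ? /andP[? ?]; apply/andP; split; nra.
- rewrite (_ : (fun _ => _) = (fun j => (- (B * q ^+ j)) * g j.+1)); last first.
    by apply/funext => j; rewrite mulNr.
  apply: (@geom_bounded_mul _ 1) (geom_boundedS gb) => j; have := q01 j; move: A_gt1 B_gtN1 B_le0.
  by rewrite ler_norml => ? ? ? /andP[? ?]; apply/andP; split; nra.
- apply: (@geom_bounded_mul _ A) (geom_bounded_predn gb) => j; have := q01 j; move: A_gt1 B_gtN1 B_le0.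
  by rewrite ler_norml => ? ? ? /andP[? ?]; apply/andP; split; nra.
Qed.

Lemma geom_bounded_opP g : geom_bounded g -> geom_bounded (opP g).
Proof.
by move=> gb; apply: geom_boundedD; [exact: geom_bounded_opD|exact: geom_bounded_opE].
Qed.

(** Increments contract in the norm weighted by [v]; summing the increments from 0 to [j] costs the
    factor [1 / (s - 1)] of a geometric sum. *)
Lemma iter_opP_oscillation g : geom_bounded g -> exists K th : R,
  [/\ 0 < K, 0 < th, th < 1 & forall m j,
    `|iter m opP g j - iter m opP g 0%N| <= K * (lam * th) ^+ m * s ^+ j].
Proof.
move=> /geom_boundedW [K K0 HK].
have [v [M [th [th0 th1 M0 vs vQ]]]] := opQ_contraction qAB s_gt1 s_ltA2.
set L := K * (s + 1); have L0 : 0 < L by rewrite mulr_gt0//; move: s_gt0; lra.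
have lt0 : 0 <= lam * th by rewrite mulr_ge0// ltW.
have step m j : `|fdiff (iter m opP g) j| <= L * (lam * th) ^+ m * v j.
  elim: m j => [|m IH] j.
    rewrite expr0 mulr1 /fdiff /=; apply: le_trans (ler_normB _ _) _.
    have := HK j; have := HK j.+1; have /andP[+ _] := vs j.
    rewrite /L exprS => H1 H2 H3.
    apply: (@le_trans _ _ (K * (s + 1) * s ^+ j)); first lra.
    by rewrite ler_wpM2l// ltW.
  rewrite iterS (diff_opP qAB).
  apply: le_trans (opQ_le_norm qAB s_gt1 s_ltA2 _ IH) _.
  rewrite (_ : opQ _ _ _ _ _ = L * (lam * th) ^+ m * opQ q A B v j); last first.
    by rewrite /opQ; ring.
  rewrite exprS [X in _ <= X](_ : _ = L * (lam * th) ^+ m * (lam * th * v j)); last by ring.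
  by rewrite ler_wpM2l// mulr_ge0// ?exprn_ge0// ltW.
have K'0 : 0 < L * M / (s - 1).
  by apply: divr_gt0; [exact: mulr_gt0|rewrite subr_gt0].
exists (L * M / (s - 1)), th; split => // m j; elim: j => [|j IH].
  by rewrite subrr normr0 expr0 mulr1 mulr_ge0 ?exprn_ge0// ltW.
rewrite (_ : _ - _ = fdiff (iter m opP g) j + (iter m opP g j - iter m opP g 0%N)); last first.
  by rewrite /fdiff; ring.
apply: le_trans (ler_normD _ _) _; apply: le_trans (lerD (step m j) IH) _.
have /andP[_ vj] := vs j.
set Y := (lam * th) ^+ m; have Y0 : 0 <= Y by rewrite exprn_ge0.
have E : L * M / (s - 1) * Y * s ^+ j.+1
  = L * Y * (M * s ^+ j) + L * M / (s - 1) * Y * s ^+ j.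
  by rewrite exprS; field; rewrite subr_eq0 gt_eqF.
rewrite E lerD2r ler_wpM2l//; first by rewrite mulr_ge0// ltW.
Qed.

(** The mean of [g] after [n] steps of the chain [opP / lam] started at 0. *)
Definition scaled_iter g n := iter n opP g 0%N / lam ^+ n.

Lemma scaled_iter_bound : exists2 K : R, 0 < K &
  forall (C : R) g, (forall j, `|g j| <= C * s ^+ j) ->
  forall n, `|scaled_iter g n| <= C * K.
Proof.
have [K [K0 HK]] := iter_opP_geom_le qAB s_gt1 s_ltA2.
exists K => // C g gC n; rewrite /scaled_iter normrM [ `|_^-1|]gtr0_norm; last first.
  by rewrite invr_gt0 exprn_gt0.
rewrite ler_pdivrMr ?exprn_gt0// -mulrA.
have C0 : 0 <= C by have := gC 0%N; rewrite expr0 mulr1; apply: le_trans.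
apply: le_trans (ler_wpM2l C0 (HK n)).
have H1 j : g j <= C * (fun i => s ^+ i) j + cst 0 j.
  by rewrite /= addr0; apply: le_trans (ler_norm _) (gC j).
have H2 j : - C * (fun i => s ^+ i) j + cst 0 j <= g j.
  by rewrite /= addr0 mulNr; have := gC j; rewrite ler_norml => /andP[].
have := iter_opP_le qAB n H1 0%N; have := iter_opP_le qAB n H2 0%N.
by rewrite !iter_opP_linear !(iter_opP_cst qAB) !mulr0 !addr0 mulNr ler_norml => -> ->.
Qed.

Lemma scaled_iter_linear (a : R) g h n :
  scaled_iter (fun j => a * g j + h j) n = a * scaled_iter g n + scaled_iter h n.
Proof. by rewrite /scaled_iter iter_opP_linear mulrDl mulrA. Qed.

(** After [m] steps the function is within the oscillation bound of a constant, and a constant is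
    unchanged by the remaining [n] steps. *)
Lemma scaled_iter_cauchy g : geom_bounded g -> exists K th : R,
  [/\ 0 < K, 0 < th, th < 1 &
  forall m n, `|scaled_iter g (n + m) - scaled_iter g m| <= K * th ^+ m].
Proof.
move=> /iter_opP_oscillation [K [th [K0 th0 th1 HK]]].
have [L L0 HL] := scaled_iter_bound.
exists (K * L), th; split; rewrite ?mulr_gt0// => m n.
set c := iter m opP g 0%N.
have := HL (K * (lam * th) ^+ m) (fun j => iter m opP g j - c) (HK m) n.
have -> : scaled_iter (fun j => iter m opP g j - c) n
  = (scaled_iter g (n + m) - scaled_iter g m) * lam ^+ m.
  rewrite (_ : (fun j => _) = fun j => 1 * iter m opP g j + cst (- c) j); last first.
    by apply/funext => j /=; rewrite mul1r.
  rewrite scaled_iter_linear mul1r /scaled_iter (iter_opP_cst qAB) -iterD exprD -/c.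
  by field; rewrite !expf_neq0 ?gt_eqF.
rewrite normrM [ `|lam ^+ m|]gtr0_norm ?exprn_gt0// exprMn.
rewrite [X in _ <= X](_ : _ = (K * L * th ^+ m) * lam ^+ m); last by ring.
by rewrite ler_pM2r// exprn_gt0.
Qed.

Lemma scaled_iter_cvg g : geom_bounded g -> cvgn (scaled_iter g).
Proof.
move=> /scaled_iter_cauchy [K [th [K0 th0 th1 HK]]].
apply: cauchy_cvg; apply: cauchy_exP => e e0.
have th1' : `|th| < 1 by rewrite gtr0_norm.
have /cvgrPdist_lt /(_ (e / K)) [|N _ HN] := cvg_expr th1'; first exact: divr_gt0.
exists (scaled_iter g N); exists N => // n Nn.
have := HN N (leqnn N); rewrite sub0r normrN gtr0_norm ?exprn_gt0// => H.
rewrite /ball/= distrC -(subnK Nn); apply: le_lt_trans (HK _ _) _.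
by rewrite mulrC -ltr_pdivlMr.
Qed.

(** The mean of [g] under the invariant law of the chain. *)
Definition scaled_lim g := limn (scaled_iter g).

Lemma scaled_lim_linear (a : R) g h : geom_bounded g -> geom_bounded h ->
  scaled_lim (fun j => a * g j + h j) = a * scaled_lim g + scaled_lim h.
Proof.
move=> gb hb; apply/cvg_lim => //.
rewrite (_ : scaled_iter _ = fun n => a * scaled_iter g n + scaled_iter h n); last first.
  by apply/funext => n; rewrite scaled_iter_linear.
by apply: cvgD; [apply: cvgMr; exact: scaled_iter_cvg|exact: scaled_iter_cvg].
Qed.

Lemma scaled_lim_cst (c : R) : scaled_lim (cst c) = c.
Proof.
apply/cvg_lim => //; rewrite (_ : scaled_iter _ = cst c); first exact: cvg_cst.
by apply/funext => n; rewrite /scaled_iter (iter_opP_cst qAB) mulrAC mulfV ?mul1r// expf_neq0// gt_eqF.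
Qed.

Lemma scaled_lim_opP g : geom_bounded g -> scaled_lim (opP g) = lam * scaled_lim g.
Proof.
move=> gb; apply/cvg_lim => //.
rewrite (_ : scaled_iter _ = fun n => lam * scaled_iter g n.+1); last first.
  apply/funext => n; rewrite /scaled_iter -iterSr exprS; field.
  by rewrite expf_neq0 gt_eqF.
apply: cvgMr; have := scaled_iter_cvg gb; rewrite -(cvg_shiftS (scaled_iter g)).
exact.
Qed.

Lemma scaled_lim_bound : exists2 K : R, 0 < K &
  forall (C : R) g, (forall j, `|g j| <= C * s ^+ j) -> `|scaled_lim g| <= C * K.
Proof.
have [K K0 HK] := scaled_iter_bound; exists K => // C g gC.
have gcvg : cvgn (scaled_iter g) by apply: scaled_iter_cvg; exists C.
rewrite ler_norml; apply/andP; split.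
  by apply: limr_ge => //; near=> n; have := HK C g gC n; rewrite ler_norml => /andP[].
by apply: limr_le => //; near=> n; have := HK C g gC n; rewrite ler_norml => /andP[].
Unshelve. all: by end_near. Qed.

Lemma scaled_lim_le g h : geom_bounded g -> geom_bounded h ->
  (forall j, g j <= h j) -> scaled_lim g <= scaled_lim h.
Proof.
move=> gb hb gh; apply: ler_lim; [exact: scaled_iter_cvg|exact: scaled_iter_cvg|].
near=> n; rewrite /scaled_iter ler_pM2r ?invr_gt0 ?exprn_gt0//.
exact: (iter_opP_le qAB).
Unshelve. all: by end_near. Qed.

Definition delta0 j : R := (j == 0%N)%:R.

Lemma geom_bounded_delta0 : geom_bounded delta0.
Proof.
exists 1 => j; rewrite mul1r; apply: (@le_trans _ _ 1).
  by rewrite /delta0; case: (j == _); rewrite ?normr1 ?normr0.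
by rewrite exprn_ege1// ltW.
Qed.

(* Testing invariance on the indicator of [0, n] gives the flux balance across
   the edge (n, n+1) of the birth-death chain. *)
Lemma scaled_lim_delta0 : scaled_lim delta0 != 0.
Proof.
have [K K0 HK] := scaled_lim_bound.
apply/eqP => d0.
pose ind n j : R := (j <= n)%N%:R.
have indb n : geom_bounded (ind n).
  exists 1 => j; rewrite mul1r; apply: (@le_trans _ _ 1).
    by rewrite /ind; case: (_ <= _)%N; rewrite ?normr1 ?normr0.
  by rewrite exprn_ege1// ltW.
have ind0 n : scaled_lim (ind n) = 0.
  elim: n => [|n IH].
    by rewrite -d0; congr scaled_lim; apply/funext => j; rewrite /ind /delta0 leqn0.
  set a := A * (1 - q ^+ n.+1); have a0 : 0 < a.
    rewrite mulr_gt0// subr_gt0 exprn_ilt1//.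
  set b := A^-1 - B * q ^+ n; have b0 : 0 <= b.
    rewrite subr_ge0; apply: (@le_trans _ _ 0); last by rewrite invr_ge0 ltW.
    by rewrite mulr_le0_ge0// exprn_ge0.
  have H j : a * ind n.+1 j + cst 0 j <= 1 * opP (ind n) j + (a * ind n j + cst 0 j).
    rewrite mul1r !addr0.
    have P0 : 0 <= opP (ind n) j.
      rewrite -[leLHS](mulr0 lam) -(opP_cst qAB _ j); apply: (opP_le qAB) => i.
      by rewrite /ind /=.
    have [jn|nj] := leqP j n.
      by rewrite /ind jn (leq_trans jn)// lerDr.
    have [->|jn] := eqVneq j n.+1; last first.
      rewrite /ind (leqNgt _ n.+1) ltn_neqAle eq_sym jn nj/= (leqNgt j n) nj/=.
      by rewrite !mulr0 addr0.
    by rewrite /opP /opD /opE /ind /= !leqnn !ltnn (leqNgt n.+2) ltnW//= !mulr0 mulr1 mul0r !addr0 subr0 add0r.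
  have := scaled_lim_le _ _ H.
  have c0 : geom_bounded (cst 0) by exact: geom_bounded_cst.
  have aib : geom_bounded (fun j => a * ind n j + cst 0 j).
    exact: geom_bounded_linear.
  have Pb : geom_bounded (opP (ind n)) by exact: geom_bounded_opP.
  rewrite !scaled_lim_linear// !scaled_lim_cst scaled_lim_opP// IH !mulr0 !addr0.
  move=> /(_ _ _) H1.
  have {}H1 : a * scaled_lim (ind n.+1) <= 0 by apply: H1; exact: geom_bounded_linear.
  apply/eqP; rewrite eq_le; apply/andP; split; first by rewrite -(pmulr_rle0 _ a0).
  have := scaled_lim_le c0 (indb n.+1); rewrite scaled_lim_cst; apply => j.
  by rewrite /ind /=.
have sb : geom_bounded (fun j => s ^+ j).
  by exists 1 => j; rewrite mul1r ger0_norm// exprn_ge0// ltW.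
have sK : scaled_lim (fun j => s ^+ j) <= K.
  have := HK 1 (fun j => s ^+ j); rewrite mul1r => /(_ _)/(le_trans (ler_norm _)); apply => j.
  by rewrite mul1r ger0_norm// exprn_ge0// ltW.
(* If every initial segment has mass zero, Markov's inequality for [s ^ j] bounds the total mass 1
   by a quantity tending to 0. *)
have H n : 1 <= (s^-1) ^+ n * K.
  apply: (@le_trans _ _ (scaled_lim (fun j => (s^-1) ^+ n * s ^+ j + ind n j))).
    rewrite -{1}(scaled_lim_cst 1); apply: scaled_lim_le => [||j].
    - exact: geom_bounded_cst.
    - exact: geom_bounded_linear.
    rewrite /ind /=; have [jn|nj] := leqP j n.
      by rewrite lerDr mulr_ge0// exprn_ge0// ?invr_ge0// ltW.
    by rewrite addr0 exprVn ler_pdivlMl ?exprn_gt0// mulr1 ler_eXn2l// ltnW.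
  rewrite scaled_lim_linear// ind0 addr0 ler_wpM2l// exprn_ge0// invr_ge0 ltW//.
have s1 : `|s^-1| < 1 by rewrite gtr0_norm ?invr_gt0// invf_lt1.
have /cvgrPdist_lt /(_ (K^-1)) [|N _ HN] := cvg_expr s1; first by rewrite invr_gt0.
have := HN N (leqnn N); rewrite sub0r normrN gtr0_norm ?exprn_gt0 ?invr_gt0//.
by rewrite -[ltRHS]mul1r ltr_pdivlMr// ltNge H.
Qed.

End growth.

(** * Nonvanishing of the invariant functional on the left boundary vector *)

Section boundary_functional.
Context {R : realType} (q A B s : R).
Hypotheses (qAB : dense_regime q A B) (s_gt1 : 1 < s) (s_ltA2 : s < A ^+ 2).
Implicit Types (g h : nat -> R) (m n j : nat) (C D : R).
Local Notation opE := (opE A).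
Local Notation opD := (opD q A B).
Local Notation opP := (opP q A B).
Local Notation lam := (lam A).
Local Notation geom_bounded := (geom_bounded s).
Local Notation scaled_lim := (scaled_lim q A B).

Let q_ge0 : 0 <= q. Proof. by case: qAB. Qed.
Let q_lt1 : q < 1. Proof. by case: qAB. Qed.
Let A_gt1 : 1 < A. Proof. by case: qAB. Qed.
Let B_gtN1 : -1 < B. Proof. by case: qAB. Qed.
Let B_le0 : B <= 0. Proof. by case: qAB. Qed.
Let A_gt0 : 0 < A. Proof. exact: lt_trans A_gt1. Qed.
Let s_gt0 : 0 < s. Proof. exact: lt_trans s_gt1. Qed.
Let lam0 := lam_gt0 qAB.
Let q01 := expq_le1 qAB.

Definition ope g j := g j.+1 / A.
Definition opd g j :=
  (A + B) * q ^+ j * g j - B * q ^+ j * g j.+1 + A * (1 - q ^+ j) * g j.-1.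

(* Written for g_j = A^j w_j, this is <W|(e + CD d) = (C + D)<W|. *)
Definition left_boundary C D g :=
  forall j, ope g j + C * D * opd g j = (C + D) * g j.

Lemma opd_linear (a : R) g h j :
  opd (fun j => a * g j + h j) j = a * opd g j + opd h j.
Proof. by rewrite /opd; ring. Qed.

Lemma ope_linear (a : R) g h j :
  ope (fun j => a * g j + h j) j = a * ope g j + ope h j.
Proof. by rewrite /ope; ring. Qed.

Lemma opeD g j : ope (opd g) j = q * opd (ope g) j + (1 - q) * g j.
Proof.
have A0 : A != 0 by rewrite gt_eqF.
by rewrite /ope /opd; case: j => [|j] /=; rewrite ?expr0 ?exprS; field.
Qed.

Lemma opDd g j : opD g j = g j + opd g j.
Proof. by rewrite /opD /opd; ring. Qed.

Lemma opEe g j : opE g j = g j + ope g j.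
Proof. by []. Qed.

Lemma geom_bounded_opd g : geom_bounded g -> geom_bounded (opd g).
Proof.
move=> gb; have db : geom_bounded (opD g) by exact: geom_bounded_opD.
have := geom_bounded_linear (-1) gb db.
by congr (geom_bounded _); apply/funext => j; rewrite opDd; ring.
Qed.

Lemma geom_bounded_ope g : geom_bounded g -> geom_bounded (ope g).
Proof.
move=> gb; have eb : geom_bounded (opE g) by exact: geom_bounded_opE.
have := geom_bounded_linear (-1) gb eb.
by congr (geom_bounded _); apply/funext => j; rewrite opEe; ring.
Qed.

Lemma left_boundaryC C D g : left_boundary C D g -> left_boundary D C g.
Proof. by move=> H j; rewrite [D * C]mulrC [D + C]addrC. Qed.

(* <W| (1 - C d) is the boundary vector for the parameters (q C, D). *)
Lemma left_boundary_shift C D g : left_boundary C D g ->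
  left_boundary (q * C) D (fun j => - C * opd g j + g j).
Proof.
move=> H j.
have E : ope g = (fun i => (- (C * D)) * opd g i + ((C + D) * g i + cst 0 i)).
  by apply/funext => i /=; rewrite addr0 -H; ring.
have Ee : ope (opd g) j = q * ((C + D) * opd g j - C * D * opd (opd g) j) + (1 - q) * g j.
  have z : opd (cst 0) j = 0 by rewrite /opd /=; ring.
  by rewrite opeD E !opd_linear z; ring.
have {}E : ope g j = (C + D) * g j - C * D * opd g j by rewrite -H; ring.
by rewrite ope_linear opd_linear Ee E; ring.
Qed.

(** Invariance and the boundary equation are two linear relations between the means of [ope g] and
    [opd g], with determinant [1 - C * D >= 1] up to sign. *)
Lemma scaled_lim_opd C D g : geom_bounded g -> left_boundary C D g -> C * D <= 0 ->
  scaled_lim g = 0 -> scaled_lim (opd g) = 0.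
Proof.
move=> gb H CD0 g0.
have db := geom_bounded_opd gb; have eb := geom_bounded_ope gb.
have L a h k hb kb := @scaled_lim_linear R q A B s qAB s_gt1 s_ltA2 a h k hb kb.
have H1 : scaled_lim (ope g) + scaled_lim (opd g) = 0.
  have := scaled_lim_opP qAB s_gt1 s_ltA2 gb; rewrite g0 mulr0.
  have -> : opP g = (fun j => 2 * g j + (1 * ope g j + opd g j)).
    by apply/funext => j; rewrite /opP opDd opEe; ring.
  rewrite L//; last exact: geom_bounded_linear.
  by rewrite L// g0 mulr0 add0r mul1r.
have H2 : C * D * scaled_lim (opd g) + scaled_lim (ope g) = 0.
  rewrite -L//.
  have -> : (fun j => C * D * opd g j + ope g j) = (fun j => (C + D) * g j + cst 0 j).
    by apply/funext => j /=; rewrite -H; ring.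
  rewrite L// ?g0 ?mulr0 ?add0r ?(scaled_lim_cst qAB)//.
  exact: geom_bounded_cst.
have : (1 - C * D) * scaled_lim (opd g) = 0.
  by rewrite mulrBl mul1r; apply/eqP; rewrite subr_eq0; apply/eqP; move: H1 H2; lra.
move/eqP; rewrite mulf_eq0 => /orP[/eqP ?|/eqP //]; exfalso; lra.
Qed.

Definition nondegenerate C D := forall g, geom_bounded g -> left_boundary C D g ->
  (exists j, g j != 0) -> scaled_lim g != 0.

Lemma nondegenerateC C D : nondegenerate C D -> nondegenerate D C.
Proof. by move=> H g gb /left_boundaryC; exact: H. Qed.

(** If the mean of [g] is zero, so is that of [g - C * opd g], which must then vanish by the
    hypothesis for [q * C]. In this case [g = C * opd g], the boundary equation makes [g] geometric
    of ratio [A * C], and entry 0 gives [(1 - A * C) * (1 - B * C) = 0]. As [B * C < 1], the vector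
    [g] is a nonzero constant, which is its own mean. *)
Lemma nondegenerate_shift C D : C * D <= 0 -> B * C < 1 ->
  nondegenerate (q * C) D -> nondegenerate C D.
Proof.
move=> CD0 BC1 nd g gb H g0; apply/eqP => Lg0.
have db := geom_bounded_opd gb.
have Ld0 := scaled_lim_opd gb H CD0 Lg0.
have gb' : geom_bounded (fun j => - C * opd g j + g j) by exact: geom_bounded_linear.
have Lg' : scaled_lim (fun j => - C * opd g j + g j) = 0.
  by rewrite (scaled_lim_linear qAB s_gt1 s_ltA2)// Ld0 Lg0 mulr0 addr0.
have [g'0|g'0] := pselect (exists j, - C * opd g j + g j != 0).
  by have := nd _ gb' (left_boundary_shift H) g'0; rewrite Lg' eqxx.
have gd j : g j = C * opd g j.
  apply/eqP; rewrite -subr_eq0; apply/negPn/negP => H'; apply: g'0; exists j.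
  by rewrite mulNr addrC.
have gS j : g j.+1 = A * C * g j.
  have : ope g j = C * g j.
    have := H j; have -> : C * D * opd g j = D * g j by rewrite [in RHS]gd; ring.
    lra.
  by rewrite /ope -mulrA => <-; rewrite mulrC divfK// gt_eqF.
have g00 : g 0%N != 0.
  apply/eqP => g00; have [j /eqP] := g0; apply.
  by elim: j => // j IH; rewrite gS IH mulr0.
have : g 0%N * ((1 - A * C) * (1 - B * C)) = 0.
  have E : g 0%N - C * ((A + B) * 1 * g 0%N - B * 1 * (A * C * g 0%N)
      + A * (1 - 1) * g 0%N) = 0.
    by apply/eqP; rewrite subr_eq0; apply/eqP; have := gd 0%N; rewrite /opd gS /= expr0.
  by rewrite -[RHS]E; ring.
move=> /eqP; rewrite !mulf_eq0 (negPf g00)/= => /orP[|]; rewrite subr_eq0 => /eqP AC; last lra.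
have gc : g = cst (g 0%N).
  by apply/funext => j /=; elim: j => // j IH; rewrite gS -AC mul1r.
by move: Lg0 => /eqP; rewrite gc (scaled_lim_cst qAB) (negPf g00).
Qed.

Lemma left_boundary_rec C D g j : left_boundary C D g ->
  g j.+1 * (1 - A * B * C * D * q ^+ j) =
  A * ((C + D) - C * D * (A + B) * q ^+ j) * g j
  - C * D * A ^+ 2 * (1 - q ^+ j) * g j.-1.
Proof.
move=> /(_ j); rewrite /ope /opd => H; have A0 : A != 0 by rewrite gt_eqF.
have E : g j.+1 - A * ((C + D) * g j - C * D * ((A + B) * q ^+ j * g j
  - B * q ^+ j * g j.+1 + A * (1 - q ^+ j) * g j.-1)) = 0.
  apply/eqP; rewrite subr_eq0 -[X in X == _](divfK A0) mulrC; apply/eqP.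
  by congr (_ * _); rewrite -H; ring.
by apply: subr0_eq; rewrite -[RHS]E; ring.
Qed.

(** The recursion bounds every entry after the first by [t * e] times the first, so [g] is close to
    [g 0] times [delta0], whose mean is nonzero. *)
Lemma nondegenerate_small : exists2 e : R, 0 < e &
  forall C D, `|C| <= e -> `|D| <= e -> nondegenerate C D.
Proof.
have [K K0 HK] := scaled_lim_bound qAB s_gt1 s_ltA2.
have d0 := scaled_lim_delta0 qAB s_gt1 s_ltA2.
(* The coefficients of the recursion sum to at most [A * e * (3 + 2 * A)]; the factor 2 is the cost
   of dividing by [1 - A * B * C * D * q ^+ j >= 1 / 2]. *)
pose t := 2 * A * (3 + 2 * A).
have t0 : 0 < t by rewrite /t mulr_gt0// ?mulr_gt0//; move: A_gt1; lra.
have d0' : 0 < `|scaled_lim (@delta0 R)| by rewrite normr_gt0.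
(* The first two bounds keep that divisor above [1 / 2], the third gives [t * e <= 1] so that
   entries do not grow, and the last makes the error at most half the mean of [delta0]. *)
pose e := Num.min (Num.min (1/2) (1 / (2 * A))) (Num.min (1 / t)
   (`|scaled_lim (@delta0 R)| / (2 * t * K))).
have e0 : 0 < e.
  rewrite !lt_min; apply/andP; split; apply/andP; split; apply: divr_gt0 => //.
    exact: mulr_gt0.
  by apply: mulr_gt0 => //; exact: mulr_gt0.
have /andP[/andP[e1 eA] /andP[et eK]] :
    (e <= 1/2) && (e <= 1 / (2 * A)) && ((e <= 1 / t) &&
    (e <= `|scaled_lim (@delta0 R)| / (2 * t * K))).
  by rewrite -!le_min lexx.
clearbody e.
exists e => // C D Ce De g gb H gn0.
have te1 : t * e <= 1 by move: et; rewrite ler_pdivlMr// mulrC.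
have Ae : A * e <= 1 / 2 by move: eA; rewrite ler_pdivlMr ?mulr_gt0//; lra.
have CDe : `|C * D| <= e * e by rewrite normrM ler_pM.
have step j (m : R) : `|g j| <= m -> `|g j.-1| <= m -> `|g j.+1| <= t * e * m.
  move=> gm gm'; have /andP[qj0 qj1] := q01 j.
  have m0 : 0 <= m by apply: le_trans gm.
  have ee : e * e <= e by rewrite ler_piMl ?(ltW e0)//; lra.
  have B1 : `|B| <= 1 by rewrite ler_norml; move: B_gtN1 B_le0; lra.
  have H1 : `|A * B * C * D * q ^+ j| <= 1 / 2.
    rewrite (_ : _ * q ^+ j = (A * (B * (q ^+ j * (C * D))))); last by ring.
    rewrite normrM gtr0_norm//; apply: le_trans Ae; rewrite ler_pM2l//.
    rewrite normrM; apply: le_trans (ler_pM _ _ B1 (lexx _)) _ => //.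
    rewrite mul1r normrM ger0_norm//; apply: le_trans (ler_pM _ _ qj1 CDe) _ => //.
    by rewrite mul1r.
  have H2 : 1 / 2 <= `|1 - A * B * C * D * q ^+ j|.
    apply: le_trans (ler_norm _); move: H1; rewrite ler_norml; lra.
  have /(congr1 Num.norm) := left_boundary_rec j H; rewrite normrM => H3.
  have H4 : `|A * ((C + D) - C * D * (A + B) * q ^+ j) * g j
     - C * D * A ^+ 2 * (1 - q ^+ j) * g j.-1| <= A * e * (3 + 2 * A) * m.
    apply: le_trans (ler_normB _ _) _.
    have X1 : `|A * ((C + D) - C * D * (A + B) * q ^+ j) * g j| <= A * e * (3 + A) * m.
      rewrite normrM; apply: ler_pM => //.
      rewrite normrM gtr0_norm// -[leRHS]mulrA ler_pM2l//.
      apply: le_trans (ler_normB _ _) _.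
      have : `|C + D| <= e + e by apply: le_trans (ler_normD _ _) (lerD _ _).
      have : `|C * D * (A + B) * q ^+ j| <= e * (A + 1).
        rewrite -mulrA normrM; apply: ler_pM => //; first exact: le_trans ee.
        rewrite ger0_norm; last by apply: mulr_ge0 => //; move: A_gt1 B_gtN1; lra.
        move: A_gt1 B_gtN1 B_le0; nra.
      by lra.
    have X2 : `|C * D * A ^+ 2 * (1 - q ^+ j) * g j.-1| <= A * e * A * m.
      rewrite normrM; apply: ler_pM => //.
      rewrite normrM [X in _ * X]ger0_norm ?subr_ge0//.
      rewrite -[leRHS]mulr1; apply: ler_pM => //; rewrite ?subr_ge0//; last lra.
      rewrite normrM [X in _ * X]ger0_norm ?exprn_ge0 ?(ltW A_gt0)//.
      rewrite [leRHS](_ : _ = e * A ^+ 2); last by ring.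
      apply: ler_pM => //; last exact: le_trans ee.
      by rewrite exprn_ge0// ltW.
    by lra.
  rewrite -H3 in H4.
  have : `|g j.+1| * (1 / 2) <= `|g j.+1| * `|1 - A * B * C * D * q ^+ j|.
    by rewrite ler_wpM2l.
  rewrite /t; lra.
clearbody t.
have main j : `|g j| <= `|g 0%N| /\ `|g j.+1| <= t * e * `|g 0%N|.
  elim: j => [|j [IH1 IH2]]; first by split => //; apply: step.
  have H1 : `|g j.+1| <= `|g 0%N|.
    by apply: le_trans IH2 _; rewrite ler_piMl.
  by split => //; apply: step.
have g0 : g 0%N != 0.
  apply/eqP => g0; have [j /eqP] := gn0; apply; apply/eqP; rewrite -normr_le0.
  by have [+ _] := main j; rewrite g0 normr0.
apply/eqP => Lg.
have := HK (t * e * `|g 0%N|) (fun j => - g 0%N * @delta0 R j + g j).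
rewrite (scaled_lim_linear qAB s_gt1 s_ltA2)//; last exact: geom_bounded_delta0.
rewrite Lg addr0 normrM normrN => HK'.
have {}HK' : `|g 0%N| * `|scaled_lim (@delta0 R)| <= t * e * `|g 0%N| * K.
  apply: HK'; case => [|j]; rewrite /delta0 /= ?mulr1 ?mulr0 ?add0r.
    by rewrite addNr normr0; do !apply: mulr_ge0 => //; apply: ltW.
  have [_ /le_trans] := main j; apply.
  by rewrite ler_peMr ?exprn_ege1 ?(ltW s_gt1)// !mulr_ge0// ltW.
move: HK'; rewrite mulrC [X in _ <= X](_ : _ = t * e * K * `|g 0%N|); last by ring.
rewrite ler_pM2r ?normr_gt0// leNgt; apply/negP/negPn.
have : e * (2 * t * K) <= `|scaled_lim (@delta0 R)| by rewrite -ler_pdivlMr// !mulr_gt0.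
have : 0 < t * e * K by rewrite !mulr_gt0.
by lra.
Qed.

(** For large [N] the parameters [q ^+ N * C] and [q ^+ N * D] are small; then one factor [q] at a
    time is removed, alternately from each of them. For [D] the condition of the shift is
    [B * D < 1], which holds because both lie in []-1, 0]]. *)
Lemma left_boundary_nondegenerate C D : 0 <= C -> -1 < D -> D <= 0 -> nondegenerate C D.
Proof.
move=> C0 D1 D0; have [e e0 He] := nondegenerate_small.
have [N HN] : exists N, forall j, (N <= j)%N -> q ^+ j <= e / (C + 1).
  by apply: (expq_small qAB); rewrite divr_gt0//; lra.
have qN : q ^+ N * (C + 1) <= e by rewrite -ler_pdivlMr ?HN//; lra.
have /andP[qN0 qN1] := q01 N.
have : nondegenerate (q ^+ N * C) (q ^+ N * D).
  apply: He; rewrite normrM ger0_norm//.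
    rewrite ger0_norm//; nra.
  by rewrite ler0_norm//; nra.
elim: N {HN qN qN0 qN1} => [|n IH]; first by rewrite expr0 !mul1r.
have /andP[qn0 qn1] := q01 n; have /andP[qS0 qS1] := q01 n.+1.
have C'0 : 0 <= q ^+ n * C by exact: mulr_ge0.
have D'0 : q ^+ n * D <= 0 by exact: mulr_ge0_le0.
have D'1 : -1 < q ^+ n * D by nra.
rewrite !exprS -!mulrA; move: (q ^+ n * C) (q ^+ n * D) IH C'0 D'0 D'1 => C' D' IH C'0 D'0 D'1 H.
apply: IH; apply: nondegenerate_shift; first exact: mulr_ge0_le0.
  by apply: le_lt_trans ltr01; exact: mulr_le0_ge0.
apply: nondegenerateC; apply: nondegenerate_shift.
- by apply: mulr_le0_ge0 => //; exact: mulr_ge0.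
- by move: B_gtN1 B_le0; nra.
exact: nondegenerateC.
Qed.

End boundary_functional.

(** * Existence and growth of the left boundary vector *)

Section boundary_solution.
Context {R : realType} (q A B : R).
Hypothesis qAB : dense_regime q A B.
Implicit Types (g : nat -> R) (j : nat) (C D : R).

Let q_ge0 : 0 <= q. Proof. by case: qAB. Qed.
Let q_lt1 : q < 1. Proof. by case: qAB. Qed.
Let A_gt1 : 1 < A. Proof. by case: qAB. Qed.
Let B_gtN1 : -1 < B. Proof. by case: qAB. Qed.
Let B_le0 : B <= 0. Proof. by case: qAB. Qed.
Let A_gt0 : 0 < A. Proof. exact: lt_trans A_gt1. Qed.
Let q01 := expq_le1 qAB.

Lemma geom_bounded_eventually (s : R) (N : nat -> R) n0 : 1 <= s -> (forall j, 0 <= N j) ->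
  (forall j, (n0 <= j)%N -> N j.+1 <= s * N j) -> exists K, forall j, N j <= K * s ^+ j.
Proof.
move=> s1 N0 HN; exists (\sum_(i < n0.+1) N i).
have init j : (j <= n0)%N -> N j <= \sum_(i < n0.+1) N i.
  move=> jn; have jn' : (j < n0.+1)%N by [].
  by rewrite (bigD1 (Ordinal jn'))//= lerDl sumr_ge0.
have S0 : 0 <= \sum_(i < n0.+1) N i by rewrite sumr_ge0.
elim=> [|j IH]; first by rewrite expr0 mulr1 init.
have [jn|nj] := leqP j.+1 n0.
  by apply: le_trans (init _ jn) _; rewrite ler_peMr// exprn_ege1.
apply: le_trans (HN j nj) _; rewrite exprS mulrCA ler_wpM2l//.
by apply: le_trans s1.
Qed.

(** As [q ^+ j] tends to 0 the recursion tends to one with characteristic roots [A * C] and [A * D],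
    both below [s] in modulus. Passing to [u] splits off the root [A * D], leaving a perturbed
    first-order recursion of ratio [A * C]. *)
Lemma geom_bounded_left_boundary C D (s : R) g : 0 <= C -> -1 < D -> D <= 0 ->
  A * C < s -> A < s -> left_boundary q A B C D g -> geom_bounded s g.
Proof.
move=> C0 D1 D0 ACs As H.
pose u j := g j.+1 - A * D * g j.
pose k1 := A * B * C * D; pose k2 := - (A * C * D * (A + B)); pose k3 := A ^+ 2 * C * D.
pose k := `|k1| + `|k2 + k1 * (A * D)| + `|(k2 + k1 * (A * D)) * (A * D) + k3|.
have k0 : 0 <= k by rewrite !addr_ge0.
have rec j (x := q ^+ j.+1) : (1 - x * k1) * u j.+1 =
    (A * C + x * (k2 + k1 * (A * D))) * u j + x * ((k2 + k1 * (A * D)) * (A * D) + k3) * g j.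
  have := left_boundary_rec qAB j.+1 H; rewrite /= -/x /u.
  move: (g j.+2) (g j.+1) (g j) => a b c E.
  apply: subr0_eq.
  have {}E := congr1 (fun z => z - (A * (C + D - C * D * (A + B) * x) * b - C * D * A ^+ 2 * (1 - x) * c)) E.
  rewrite /= subrr in E; rewrite -[RHS]E /k1 /k2 /k3; ring.
(* In the norm [|u j| + eta * |g j|], half of the room between [A * C] and [s] pays for the
   contribution of [u j] to [g j.+1], the other half for the perturbation [ep]. *)
pose eta := (s - A * C) / 2.
have eta0 : 0 < eta by rewrite divr_gt0// subr_gt0.
have AC0 : 0 <= A * C by rewrite mulr_ge0// ltW.
pose ep := Num.min eta (eta * (s - A)).
have [ep0 ep1 ep2] : [/\ 0 < ep, ep <= eta & ep <= eta * (s - A)].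
  by rewrite /ep lt_min !ge_min !lexx orbT eta0 mulr_gt0// subr_gt0.
clearbody ep.
(* Bounds the coefficients in [x]; for [dl <= 1 / 2], dividing by [1 - dl] costs at most the factor
   [1 + 2 * dl], and the second bound fits the result under [ep]. *)
pose dl := Num.min (1 / 2) (ep / (2 * (A * C + 1))).
have [dl0 dl1 dl2] : [/\ 0 < dl, dl <= 1 / 2 & dl * (2 * (A * C + 1)) <= ep].
  rewrite /dl lt_min; split; rewrite ?ge_min ?lexx//.
    by rewrite !divr_gt0//; lra.
  by rewrite -ler_pdivlMr ?ge_min ?lexx ?orbT//; lra.
clearbody dl.
have [n0 Hn0] : exists n, forall j, (n <= j)%N -> q ^+ j <= dl / (k + 1).
  by apply: (expq_small qAB); rewrite divr_gt0//; lra.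
have [K HK] : exists K, forall j, `|u j| + eta * `|g j| <= K * s ^+ j.
  apply: (@geom_bounded_eventually s _ n0); first by move: A_gt1; lra.
    by move=> j; rewrite addr_ge0// mulr_ge0// ltW.
  move=> j n0j; set x := q ^+ j.+1.
  have /andP[x0 x1] := q01 j.+1; rewrite -/x in x0 x1.
  have xk : x * k <= dl.
    have := Hn0 j.+1 (leqW n0j); rewrite -/x ler_pdivlMr; last lra.
    nra.
  have H1 : (1 - dl) * `|u j.+1| <= (A * C + dl) * `|u j| + dl * `|g j|.
    have E := rec j; rewrite -/x in E.
    have : `|u j.+1| <= x * k * `|u j.+1| + (A * C + x * k) * `|u j| + x * k * `|g j|.
      have E' : u j.+1 = x * k1 * u j.+1 + (1 - x * k1) * u j.+1 by ring.
      rewrite {1}E' E addrA mulrDl.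
      have nx (p y : R) : `|p| <= k -> `|x * p * y| <= x * k * `|y|.
        move=> pk; rewrite !normrM (ger0_norm x0); apply: ler_wpM2r => //.
        exact: ler_wpM2l.
      have [H1 H2 H3] : [/\ `|k1| <= k, `|k2 + k1 * (A * D)| <= k
          & `|(k2 + k1 * (A * D)) * (A * D) + k3| <= k].
        by rewrite /k; split; rewrite -?addrA ?lerDl ?addr_ge0// addrCA ?lerDl ?addr_ge0// addrA lerDr addr_ge0.
      apply: le_trans (ler_normD _ _) (lerD _ (nx _ _ H3)).
      apply: le_trans (ler_normD _ _) (lerD (nx _ _ H1) _).
      rewrite mulrDl; apply: le_trans (ler_normD _ _) (lerD _ (nx _ _ H2)).
      by rewrite normrM ger0_norm.
    have [V0 G0 U0] : [/\ 0 <= `|u j|, 0 <= `|g j| & 0 <= `|u j.+1|] by [].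
    have : x * k * `|u j.+1| <= dl * `|u j.+1| by exact: ler_wpM2r.
    have : x * k * `|u j| <= dl * `|u j| by exact: ler_wpM2r.
    have : x * k * `|g j| <= dl * `|g j| by exact: ler_wpM2r.
    lra.
  have H2 : `|u j.+1| <= (A * C + ep) * `|u j| + ep * `|g j|.
    have [V0 G0 U0] : [/\ 0 <= `|u j|, 0 <= `|g j| & 0 <= `|u j.+1|] by [].
    have H3 : `|u j.+1| <= (1 + 2 * dl) * ((1 - dl) * `|u j.+1|).
      by rewrite mulrA ler_peMl//; nra.
    apply: le_trans H3 _.
    apply: le_trans (ler_wpM2l _ H1) _; first lra.
    have : (1 + 2 * dl) * (A * C + dl) <= A * C + ep by nra.
    have : (1 + 2 * dl) * dl <= ep by nra.
    move=> ? ?; rewrite mulrDr !mulrA; apply: lerD; exact: ler_wpM2r.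
  have H3 : `|g j.+1| <= `|u j| + A * `|g j|.
    have -> : g j.+1 = u j + A * D * g j by rewrite /u; ring.
    apply: le_trans (ler_normD _ _) _; rewrite lerD2l normrM; apply: ler_wpM2r => //.
    rewrite normrM gtr0_norm// ler_piMr ?(ltW A_gt0)// ler_norml; lra.
  have [V0 G0] : 0 <= `|u j| /\ 0 <= `|g j| by [].
  have H4 : eta * `|g j.+1| <= eta * (`|u j| + A * `|g j|) by rewrite ler_pM2l.
  have H5 : (A * C + ep + eta) * `|u j| <= s * `|u j|.
    by apply: ler_wpM2r => //; move: ep1; rewrite /eta; lra.
  have H6 : (ep + eta * A) * `|g j| <= s * eta * `|g j|.
    by apply: ler_wpM2r => //; lra.
  lra.
exists (K / eta) => j.
rewrite mulrAC ler_pdivlMr// mulrC; apply: le_trans (HK j).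
by rewrite lerDr.
Qed.

Lemma left_boundary_exists C D : exists2 g, left_boundary q A B C D g & exists j, g j != 0.
Proof.
pose X := A * B * C * D.
pose a j : R := 1 - X * q ^+ j.
(* When some a_J vanishes the recursion is started at J + 1 instead of 0. *)
have [J aJ prevJ] : exists2 J, forall j, (J <= j)%N -> a j != 0 & forall j, j.+1 = J -> a j = 0.
  have [[J aJ]|na] := pselect (exists J, a J = 0); last first.
    by exists 0%N => // j _; apply/eqP => aj; apply: na; exists j.
  exists J.+1 => [j Jj|j [->]//].
  have XJ : X * q ^+ J = 1 by move: aJ => /eqP; rewrite subr_eq0 => /eqP.
  rewrite /a -(subnK (ltnW Jj)) exprD mulrCA XJ mulr1 subr_eq0 eq_sym lt_eqF//.
  by rewrite exprn_ilt1// -lt0n subn_gt0.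
(* The pair holds the entries at [J + i] and [J + i - 1]; the initial 0 stands for the entry before
   [J]. *)
pose f := fix f i : R * R := if i is i'.+1 then
  ((A * ((C + D) - C * D * (A + B) * q ^+ (J + i')) * (f i').1
  - C * D * A ^+ 2 * (1 - q ^+ (J + i')) * (f i').2) / a (J + i')%N, (f i').1) else (1, 0).
pose g j := if (j < J)%N then 0 else (f (j - J)%N).1.
have g1 i : g (J + i)%N = (f i).1 by rewrite /g ltnNge leq_addr/= addKn.
have g2 i : (1 - q ^+ (J + i)) * g (J + i).-1 = (1 - q ^+ (J + i)) * (f i).2.
  case: i => [|i]; last by rewrite addnS/= g1.
  rewrite addn0/= mulr0; case: (posnP J) => [->|J0]; first by rewrite expr0 subrr mul0r.
  by rewrite /g prednK// leqnn mulr0.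
have rec j : g j.+1 * a j = A * ((C + D) - C * D * (A + B) * q ^+ j) * g j
  - C * D * A ^+ 2 * (1 - q ^+ j) * g j.-1.
  have [Jj|jJ] := leqP J j.
    rewrite -(subnKC Jj); set i := (j - J)%N.
    by rewrite -addnS g1/= divfK ?aJ ?leq_addr// -g1 -!mulrA g2.
  have -> : g j = 0 by rewrite /g jJ.
  have -> : g j.-1 = 0 by rewrite /g (leq_ltn_trans (leq_pred _) jJ).
  rewrite !mulr0 subr0; move: jJ; rewrite leq_eqVlt => /orP[/eqP jJ|jJ].
    by rewrite prevJ// mulr0.
  by rewrite /g jJ mul0r.
exists g; last by exists J; rewrite -[J]addn0 g1/= oner_eq0.
move=> j; have A0 : A != 0 by rewrite gt_eqF.
apply: (mulfI A0).
apply: subr0_eq; have := rec j => /(congr1 (fun z => z - (A * ((C + D) - C * D * (A + B) * q ^+ j) * g j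
  - C * D * A ^+ 2 * (1 - q ^+ j) * g j.-1))); rewrite subrr => <-.
by rewrite /ope /opd /a /X; field.
Qed.

End boundary_solution.

(** * Uniqueness of the stationary measure *)

Section finite_generator.
Context {R : realType} {S : finType} (L : (S -> R) -> S -> R).
Implicit Types (m f : S -> R) (Q : S -> S -> R).

(** Differentiation at [t = 0]: stationarity cancels the term of order 0 in the exponential series,
    and the terms from order 2 on are at most [2 * K * (t * M) ^+ 2]. Dividing by [t] and letting it
    be small leaves nothing of order 1. *)
Lemma stationary_generator Q m : (forall f s, L f s = \sum_s' Q s s' * f s') ->
  stationary_measure L m -> forall f, \sum_s m s * L f s = 0.
Proof.
move=> LE [[m0 m1] mL] f.
pose M := 1 + \sum_s \sum_s' `|Q s s'|.
have M0 : 0 < M by rewrite ltr_pwDl// sumr_ge0// => s _; rewrite sumr_ge0.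
pose K := \sum_s `|f s|.
have K0 : 0 <= K by rewrite sumr_ge0.
have Lk k s : `|iter k L f s| <= K * M ^+ k.
  elim: k s => [|k IH] s; first by rewrite expr0 mulr1 /K (bigD1 s)//= lerDl sumr_ge0.
  rewrite iterS LE; apply: le_trans (ler_norm_sum _ _ _) _.
  apply: (@le_trans _ _ (\sum_s' `|Q s s'| * (K * M ^+ k))).
    by apply: ler_sum => s' _; rewrite normrM ler_wpM2l.
  rewrite -mulr_suml exprSr [leRHS]mulrA [leRHS]mulrC ler_wpM2r ?mulr_ge0 ?exprn_ge0 ?(ltW M0)//.
  rewrite /M [X in 1 + X](bigD1 s)//= addrCA lerDl addr_ge0// sumr_ge0// => s' _.
  exact: sumr_ge0.
pose u (t : R) s k : R := t ^+ k / k`!%:R * iter k L f s.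
have ub (t : R) s k : 0 <= t -> `|u t s k| <= K * (t * M) ^+ k.
  move=> t0; rewrite /u normrM exprMn mulrCA; apply: ler_pM => //.
  rewrite ger0_norm ?divr_ge0 ?exprn_ge0//.
  by rewrite ler_pdivrMr ?ltr0n ?fact_gt0// ler_peMr ?exprn_ge0// ler1n fact_gt0.
have ucvg (t : R) s : 0 <= t -> t * M <= 1 / 2 -> cvgn (series (u t s)).
  move=> t0 tM; apply: normed_cvg.
  apply: (@series_le_cvg _ _ (geometric K (t * M))) => [k|k|k|].
  - exact: normr_ge0.
  - by rewrite /= mulr_ge0// exprn_ge0// mulr_ge0// ltW.
  - exact: ub.
  apply: is_cvg_geometric_series; rewrite ger0_norm ?mulr_ge0 ?(ltW M0)//; lra.
have geo n : \sum_(0 <= k < n) (1 / 2 : R) ^+ k = 2 - 2 * (1 / 2) ^+ n.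
  elim: n => [|n IH]; first by rewrite big_nil expr0; lra.
  by rewrite big_nat_recr//= IH exprS; lra.
pose a k := \sum_s m s * iter k L f s.
have main (t : R) : 0 < t -> t * M <= 1 / 2 -> t * `|a 1%N| <= 2 * K * (t * M) ^+ 2.
  move=> t0 tM; have t0' := ltW t0.
  have := mL t f t0'; rewrite -/(a 0%N) => E.
  have cv : (fun n => \sum_s m s * series (u t s) n) @ \oo --> a 0%N.
    rewrite -E; apply: cvg_big => [|s _]; first exact: add_continuous.
    by apply: cvgMr; exact: ucvg.
  have {}cv : (fun n => `|\sum_s m s * series (u t s) n.+2 - a 0%N|) @ \oo --> (0 : R).
    have : (fun n => `|\sum_s m s * series (u t s) n.+2 - a 0%N|) @ \oo --> `|a 0%N - a 0%N|.
      apply: cvg_norm; apply: cvgB; last exact: cvg_cst.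
      by move: cv; rewrite -(cvg_shiftn 2); under eq_fun do rewrite addn2.
    by rewrite subrr normr0.
  have bd n : t * `|a 1%N| - `|\sum_s m s * series (u t s) n.+2 - a 0%N| <= 2 * K * (t * M) ^+ 2.
    have -> : \sum_s m s * series (u t s) n.+2 - a 0%N
        = t * a 1%N + \sum_s m s * \sum_(0 <= k < n) u t s k.+2.
      rewrite /a mulr_sumr -sumrB -big_split/=; apply: eq_bigr => s _.
      rewrite /series /= big_nat_recl// big_nat_recl// /u /= expr0 expr1 fact0 divr1 invr1.
      by rewrite !mulr1 mul1r; ring.
    set X := \sum_s m s * _.
    have XB : `|X| <= 2 * K * (t * M) ^+ 2.
      apply: le_trans (ler_norm_sum _ _ _) _.
      have g0 : 0 <= t * M by rewrite mulr_ge0// ltW.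
      apply: (@le_trans _ _ (\sum_s m s * (2 * K * (t * M) ^+ 2))); last first.
        by rewrite -mulr_suml m1 mul1r.
      apply: ler_sum => s _; rewrite normrM ger0_norm// ler_wpM2l//.
      apply: le_trans (ler_norm_sum _ _ _) _.
      apply: (@le_trans _ _ (\sum_(0 <= k < n) K * (t * M) ^+ 2 * (1 / 2) ^+ k)).
        apply: ler_sum => k _; apply: le_trans (ub _ _ _ t0') _.
        rewrite (_ : (t * M) ^+ k.+2 = (t * M) ^+ 2 * (t * M) ^+ k); last by rewrite -exprD.
        rewrite [leLHS]mulrA; apply: ler_wpM2l; first by rewrite mulr_ge0 ?exprn_ge0.
        by rewrite lerXn2r// nnegrE; lra.
      rewrite -mulr_sumr [leRHS](_ : _ = K * (t * M) ^+ 2 * 2); last by ring.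
      apply: ler_wpM2l; first by rewrite mulr_ge0 ?exprn_ge0.
      rewrite geo.
      by rewrite gerBl mulr_ge0// exprn_ge0//; lra.
    have := ler_normB (t * a 1%N + X) X; rewrite addrK normrM gtr0_norm//.
    lra.
  have {}cv : (fun n => t * `|a 1%N| - `|\sum_s m s * series (u t s) n.+2 - a 0%N|)
      @ \oo --> t * `|a 1%N|.
    by have H := cvgB (cvg_cst (t * `|a 1%N|)) cv; rewrite subr0 in H; exact: H.
  rewrite -(cvg_lim _ cv)//; apply: limr_le; first by apply/cvg_ex; eexists; exact: cv.
  by near=> n; exact: bd.
apply/eqP; rewrite -normr_eq0; apply/eqP/le_anti/andP; split=> //.
apply/ler_addgt0Pl => e e0; rewrite addr0.
pose t := Num.min (1 / (2 * M)) (e / (2 * K * M ^+ 2 + 1)).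
have d0 : 0 < 2 * K * M ^+ 2 + 1 by apply: ltr_wpDl => //; apply: mulr_ge0; [exact: mulr_ge0|exact/exprn_ge0/ltW].
have [t0 t1 t2] : [/\ 0 < t, t <= 1 / (2 * M) & t <= e / (2 * K * M ^+ 2 + 1)].
  by rewrite /t lt_min !ge_min !lexx orbT !divr_gt0// mulr_gt0.
have tM : t * M <= 1 / 2 by move: t1; rewrite ler_pdivlMr ?mulr_gt0//; lra.
move: t2; rewrite ler_pdivlMr// => t2.
rewrite -(ler_pM2l t0); apply: le_trans (main _ t0 tM) _.
rewrite (_ : 2 * K * (t * M) ^+ 2 = t * (t * (2 * K * M ^+ 2))); last by ring.
by rewrite ler_pM2l//; apply: le_trans t2; rewrite ler_pM2l// lerDl.
Unshelve. all: by end_near. Qed.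

Lemma generator_matrixE : (forall (a : R) f g s, L (fun s => a * f s + g s) s = a * L f s + L g s) ->
  forall f s, L f s = \sum_s' L (fun x => (x == s')%:R) s * f s'.
Proof.
move=> Llin f s.
have L0 : L (fun=> 0) s = 0.
  have H := Llin (-1) (fun=> 0) (fun=> 0) s.
  rewrite (_ : (fun=> _) = (fun=> 0)) in H; last by apply/funext => x; rewrite mulr0 addr0.
  by lra.
have {1}-> : f = (fun x => \sum_(s' <- enum S) f s' * (x == s')%:R).
  apply/funext => x; rewrite big_enum (bigD1 x)//= eqxx mulr1 big1 ?addr0// => i ix.
  by rewrite eq_sym (negPf ix) mulr0.
rewrite -big_enum; elim: (enum S) => [|s' r IH].
  by rewrite big_nil -[RHS]L0; congr (L _ s); apply/funext => x; rewrite big_nil.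
rewrite [RHS]big_cons -IH /= [L _ s * _]mulrC -Llin; congr L.
by apply/funext => x; rewrite big_cons.
Qed.

(* For an irreducible chain an invariant signed weight of total mass zero
   vanishes: its absolute value is invariant too, hence so is its positive
   part, which has a zero. *)
Lemma invariant_weight_unique Q m :
  (forall s, \sum_s' Q s s' = 0) ->
  (forall s s', s != s' -> 0 <= Q s s') ->
  (forall Z : pred S, (exists s, Z s) ->
     (forall s s', Z s' -> s != s' -> 0 < Q s s' -> Z s) -> forall s, Z s) ->
  (forall s', \sum_s m s * Q s s' = 0) -> \sum_s m s = 0 -> forall s, m s = 0.
Proof.
move=> Q0 Qge0 irr mQ m0.
have absQ_ge0 s' : 0 <= \sum_s `|m s| * Q s s'.
  have : `|\sum_(s | s != s') m s * Q s s'| <= \sum_(s | s != s') `|m s| * Q s s'.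
    apply: le_trans (ler_norm_sum _ _ _) _; apply: ler_sum => s ss'.
    by rewrite normrM [ `|Q _ _|]ger0_norm ?Qge0.
  have := mQ s'; rewrite (bigD1 s')//= addrC => /eqP; rewrite addr_eq0 => /eqP ->.
  have Qd : Q s' s' <= 0.
    have := Q0 s'; rewrite (bigD1 s')//= => /eqP; rewrite addr_eq0 => /eqP ->.
    by rewrite oppr_le0 sumr_ge0// => i ?; rewrite Qge0// eq_sym.
  rewrite normrN normrM (ler0_norm Qd) mulrN [in X in _ -> 0 <= X](bigD1 s')//=.
  by rewrite -[X in X <= _]sub0r lerBlDl.
have absQ s' : \sum_s `|m s| * Q s s' = 0.
  have : \sum_s' \sum_s `|m s| * Q s s' = 0.
    rewrite exchange_big/= big1// => s _; by rewrite -mulr_sumr Q0 mulr0.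
  by move=> /eqP; rewrite psumr_eq0// => /allP/(_ s'); rewrite mem_index_enum => /(_ isT)/eqP.
pose p s := `|m s| + m s.
have p0 s : 0 <= p s by rewrite /p -lerBlDr sub0r -normrN ler_norm.
have pQ s' : \sum_s p s * Q s s' = 0.
  by under eq_bigr do rewrite mulrDl; rewrite big_split/= absQ mQ addr0.
have [[s0 ps0]|pn0] := pselect (exists s, p s == 0).
  have pz : forall s, p s == 0.
    apply: (irr (fun s => p s == 0)); first by exists s0.
    move=> s s' /eqP ps' ss' Qs; have := pQ s'; rewrite (bigD1 s')//= ps' mul0r add0r.
    move=> /eqP; rewrite psumr_eq0; last by move=> i ?; rewrite mulr_ge0// Qge0.
    move=> /allP/(_ s); rewrite mem_index_enum ss'/= mulf_eq0 (gt_eqF Qs) orbF.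
    exact.
  have mE s : - m s = `|m s| by have := pz s; rewrite /p addr_eq0 => /eqP ->.
  move=> s; apply/eqP; rewrite -oppr_eq0 mE.
  have : \sum_s `|m s| == 0.
    by under eq_bigr do rewrite -mE; rewrite sumrN m0 oppr0.
  by rewrite psumr_eq0// => /allP/(_ s); rewrite mem_index_enum => /(_ isT).
move=> s; have mp x : 0 < m x.
  rewrite ltNge; apply/negP => mx; apply: pn0; exists x.
  by rewrite /p ler0_norm// addNr.
move: m0 => /eqP; rewrite psumr_eq0; last by move=> i _; exact: ltW.
by move=> /allP/(_ s); rewrite mem_index_enum => /(_ isT)/eqP.
Qed.

End finite_generator.

(** * Irreducibility and adjoint of the open ASEP generator *)

Section asep_chain.
Context {R : realType} (q alpha beta gamma delta : R) (n : nat).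
Hypotheses (q_ge0 : 0 <= q) (alpha_gt0 : 0 < alpha) (beta_gt0 : 0 < beta)
  (gamma_ge0 : 0 <= gamma) (delta_ge0 : 0 <= delta).
Implicit Types (tau s : config n) (f m : config n -> R).
Local Notation L := (asep_generator q alpha beta gamma delta (n := n)).
Definition jump s s' := L (fun x => (x == s')%:R) s.

Lemma asep_generator_linear (a : R) f g s : L (fun s => a * f s + g s) s = a * L f s + L g s.
Proof.
have E (x y z u v w : R) : a * (x + y + z) + (u + v + w) = (a * x + u) + (a * y + v) + (a * z + w).
  by ring.
rewrite /asep_generator E; congr (_ + _ + _); rewrite mulr_sumr -big_split; apply: eq_bigr => i _ /=.
- by rewrite mulr_sumr -big_split/=; apply: eq_bigr => j _; ring.
- by ring.
- by ring.
Qed.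

Lemma jumpE f s : L f s = \sum_s' jump s s' * f s'.
Proof. exact/generator_matrixE/asep_generator_linear. Qed.

Lemma jump_row_sum s : \sum_s' jump s s' = 0.
Proof.
transitivity (L (fun=> 1) s); first by rewrite jumpE; apply: eq_bigr => ? _; rewrite mulr1.
rewrite /asep_generator [X in X + _ + _]big1 => [|i _]; last first.
  by rewrite big1// => j _; rewrite subrr mulr0.
by rewrite !big1 ?addr0// => i _; rewrite subrr mulr0.
Qed.

Lemma bulk_rate_ge0 s i j : 0 <= bulk_rate q s i j.
Proof. by rewrite /bulk_rate; case: ifP => // _; case: ifP. Qed.

Lemma jump_offE s s' : s != s' -> jump s s' =
  \sum_(i < n) \sum_(j < n | val j == (val i).+1)
     bulk_rate q s i j * (exchange s i j == s')%:R
  + \sum_(i < n | val i == 0%N)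
     (if s i then gamma else alpha) * (flip s i == s')%:R
  + \sum_(i < n | (val i).+1 == n)
     (if s i then beta else delta) * (flip s i == s')%:R.
Proof. by move=> /negPf ss'; rewrite /jump /asep_generator ss' /=; under eq_bigr do under eq_bigr do rewrite subr0; congr (_ + _ + _); apply: eq_bigr => i _; rewrite subr0. Qed.

Let bulk_ge0 s s' i j : 0 <= bulk_rate q s i j * (exchange s i j == s')%:R.
Proof. by rewrite mulr_ge0 ?bulk_rate_ge0. Qed.
Let left_ge0 s s' i : 0 <= (if s i then gamma else alpha) * (flip s i == s')%:R.
Proof. by rewrite mulr_ge0//; case: ifP => // _; exact: ltW. Qed.
Let right_ge0 s s' i : 0 <= (if s i then beta else delta) * (flip s i == s')%:R.
Proof. by rewrite mulr_ge0//; case: ifP => // _; exact: ltW. Qed.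

Lemma jump_ge0 s s' : s != s' -> 0 <= jump s s'.
Proof.
move=> ss'; rewrite jump_offE// !addr_ge0// sumr_ge0// => i _.
by rewrite sumr_ge0.
Qed.

Lemma jump_gt0_bulk s (i j : 'I_n) : val j = (val i).+1 -> s i -> ~~ s j ->
  0 < jump s (exchange s i j).
Proof.
move=> ij si sj; rewrite jump_offE; last first.
  by apply/eqP => /ffunP/(_ i); rewrite ffunE tpermL si (negPf sj).
rewrite -addrA ltr_wpDr// ?addr_ge0 ?sumr_ge0//.
rewrite (bigD1 i)//= ltr_wpDr//; first by rewrite sumr_ge0// => k _; rewrite sumr_ge0.
rewrite (bigD1 j)/=; last by rewrite ij.
by rewrite ltr_wpDr ?sumr_ge0// eqxx mulr1 /bulk_rate si sj.
Qed.

Lemma flip_neq s i : s != flip s i.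
Proof. by apply/eqP => /ffunP/(_ i); rewrite ffunE eqxx; case: (s i). Qed.

Lemma jump_gt0_left s (i : 'I_n) : val i = 0%N -> ~~ s i -> 0 < jump s (flip s i).
Proof.
move=> i0 si; rewrite jump_offE ?flip_neq// addrAC ltr_wpDl//.
  by rewrite addr_ge0// sumr_ge0// => k _; rewrite sumr_ge0.
rewrite (bigD1 i)/= ?i0// ltr_wpDr ?sumr_ge0//.
by rewrite (negPf si) eqxx mulr1.
Qed.

Lemma jump_gt0_right s (i : 'I_n) : (val i).+1 = n -> s i -> 0 < jump s (flip s i).
Proof.
move=> i0 si; rewrite jump_offE ?flip_neq// ltr_wpDl//.
  by rewrite addr_ge0// sumr_ge0// => k _; rewrite sumr_ge0.
rewrite (bigD1 i)/= ?i0// ltr_wpDr ?sumr_ge0//.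
by rewrite si eqxx mulr1.
Qed.

(** A counter for the induction below: with suitable site weights [c], it decreases when a particle
    moves towards the chosen end or disappears. *)
Definition potential (c : 'I_n -> nat) s : nat := \sum_i (if s i then c i else 0%N).

Lemma potential_flip c s (i : 'I_n) : s i -> (0 < c i)%N ->
  (potential c (flip s i) < potential c s)%N.
Proof.
move=> si ci; rewrite /potential (bigD1 i)//= [X in (_ < X)%N](bigD1 i)//=.
rewrite !ffunE eqxx si/= add0n.
rewrite (eq_bigr (fun k => if s k then c k else 0%N)); last by move=> k /negPf ki; rewrite ffunE ki.
by rewrite -[X in (X < _)%N]add0n ltn_add2r.
Qed.

Lemma potential_exchange c s (i j : 'I_n) : i != j -> s i -> ~~ s j -> (c j < c i)%N ->
  (potential c (exchange s i j) < potential c s)%N.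
Proof.
move=> ij si sj cij; have ji : j != i by rewrite eq_sym.
rewrite /potential (bigD1 i)//= (bigD1 j)//= [X in (_ < X)%N](bigD1 i)//= [X in (_ < _ + X)%N](bigD1 j)//=.
rewrite !ffunE tpermL tpermR si (negPf sj) !add0n.
rewrite (eq_bigr (fun k => if s k then c k else 0%N)); first by rewrite ltn_add2r.
by move=> k /andP[ki kj]; rewrite ffunE tpermD// eq_sym.
Qed.

Lemma exchangeK s i j : exchange (exchange s i j) i j = s.
Proof. by apply/ffunP => k; rewrite !ffunE tpermK. Qed.

Lemma exchangeC s i j : exchange s i j = exchange s j i.
Proof. by apply/ffunP => k; rewrite !ffunE tpermC. Qed.

Lemma flipK s i : flip (flip s i) i = s.
Proof. by apply/ffunP => k; rewrite !ffunE; case: eqP => // _; rewrite negbK. Qed.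

Lemma config_no_particle s : ~~ [exists i, s i] -> s = [ffun=> false].
Proof. by rewrite negb_exists => /forallP H; apply/ffunP => i; rewrite ffunE; exact/negbTE. Qed.

(** As [q], [gamma] and [delta] may be zero, the paths consist of injections at the left, jumps to
    the right and removals at the right. The empty configuration leads to every configuration and is
    reached from every one. *)
Lemma jump_irreducible (Z : pred (config n)) : (exists s, Z s) ->
  (forall s s', Z s' -> s != s' -> 0 < jump s s' -> Z s) -> forall s, Z s.
Proof.
move=> [s0 Zs0] H.
(* Backwards in time: the leftmost particle is pulled back to the left end, and then its injection
   is undone. *)
have Zempty : Z [ffun=> false].
  have [k] := ubnP (potential (fun i => i.+1) s0).
  elim: k s0 Zs0 => // k IH s Zs; rewrite ltnS => sk.
  have [/existsP[i0 si0]|/config_no_particle <-//] := boolP [exists i, s i].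
  have [i si imin] := @arg_minnP _ i0 (fun i => s i) (fun i => val i) si0.
  have [i0'|ipos] := posnP (nat_of_ord i).
    apply: (IH (flip s i)); last by apply: leq_trans sk; exact: potential_flip.
    apply: (H _ s Zs); first by rewrite eq_sym flip_neq.
    rewrite -{2}(flipK s i); apply: jump_gt0_left => //.
    by rewrite ffunE eqxx si.
  have ltj : ((nat_of_ord i).-1 < n)%N by exact: leq_ltn_trans (leq_pred _) (ltn_ord i).
  pose j := Ordinal ltj.
  have sj : ~~ s j.
    apply/negP => /imin; rewrite /= leqNgt prednK//.
    by rewrite leqnn.
  have ij : i != j by rewrite -val_eqE /= neq_ltn prednK// leqnn orbT.
  apply: (IH (exchange s i j)); last first.
    by apply: leq_trans sk; apply: potential_exchange; rewrite //= prednK.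
  have neq : exchange s i j != s.
    by apply/eqP => /ffunP/(_ i); rewrite ffunE tpermL si (negPf sj).
  apply: (H _ s Zs) => //; rewrite -{2}(exchangeK s i j) [exchange (exchange _ _ _) _ _]exchangeC.
  apply: jump_gt0_bulk; rewrite ?ffunE ?tpermL ?tpermR//=.
  by rewrite prednK.
(* Forwards in time: the rightmost particle is driven to the right end and leaves. *)
move=> s.
have [k] := ubnP (potential (fun i => (n - i)%N) s).
elim: k s => // k IH s; rewrite ltnS => sk.
have [/existsP[i0 si0]|/config_no_particle ->//] := boolP [exists i, s i].
have [i si imax] := @arg_maxnP _ i0 (fun i => s i) (fun i => val i) si0.
have iltn := ltn_ord i.
have [in1|in1] := eqVneq (nat_of_ord i).+1 n.
  apply: (H _ (flip s i)); rewrite ?flip_neq//; last exact: jump_gt0_right.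
  by apply: IH; apply: leq_trans sk; apply: potential_flip; rewrite // subn_gt0.
have ltj : ((nat_of_ord i).+1 < n)%N by rewrite ltn_neqAle in1.
pose j := Ordinal ltj.
have sj : ~~ s j by apply/negP => /imax /=; rewrite ltnn.
have ij : i != j by rewrite -val_eqE /= neq_ltn ltnSn.
apply: (H _ (exchange s i j)).
- by apply: IH; apply: leq_trans sk; apply: potential_exchange; rewrite //= ltn_sub2l.
- by apply/eqP => /ffunP/(_ i); rewrite ffunE tpermL si (negPf sj).
- exact: jump_gt0_bulk.
Qed.

Lemma asep_invariant_unique (m : config n -> R) mu :
  \sum_s mu s = 1 -> (forall f, \sum_s mu s * L f s = 0) ->
  (forall f, \sum_s m s * L f s = 0) -> forall s, m s = (\sum_s m s) * mu s.
Proof.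
move=> mu1 muL mL s; apply/subr0_eq.
apply: (@invariant_weight_unique _ _ jump (fun s => m s - (\sum_s m s) * mu s)).
- exact: jump_row_sum.
- exact: jump_ge0.
- exact: jump_irreducible.
- move=> s'; have := mL (fun x => (x == s')%:R); have := muL (fun x => (x == s')%:R).
  rewrite -/jump => H1 H2.
  under eq_bigr do rewrite mulrBl -mulrA.
  by rewrite sumrB -mulr_sumr H1 mulr0 subr0.
- by rewrite sumrB -mulr_sumr mu1 mulr1 subrr.
Qed.

(** Each elementary move is an involution of the configurations, so reindexing by it transposes the
    gain term. *)
Lemma asep_adjointE (m f : config n -> R) : \sum_s m s * L f s = \sum_s f s *
  (\sum_(i < n) \sum_(j < n | val j == (val i).+1)
     (bulk_rate q (exchange s i j) i j * m (exchange s i j) - bulk_rate q s i j * m s)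
  + \sum_(i < n | val i == 0%N)
     ((if flip s i i then gamma else alpha) * m (flip s i) - (if s i then gamma else alpha) * m s)
  + \sum_(i < n | (val i).+1 == n)
     ((if flip s i i then beta else delta) * m (flip s i) - (if s i then beta else delta) * m s)).
Proof.
have inv (phi : config n -> config n) (r : config n -> R) : (forall s, phi (phi s) = s) ->
    \sum_s m s * (r s * (f (phi s) - f s)) = \sum_s f s * (r (phi s) * m (phi s) - r s * m s).
  move=> phiK; under eq_bigr do rewrite !mulrBr.
  rewrite sumrB [X in X - _](reindex_inj (can_inj phiK))/=.
  under [in RHS]eq_bigr do rewrite mulrBr.
  rewrite sumrB; congr (_ - _); apply: eq_bigr => s _; rewrite ?phiK; ring.
rewrite /asep_generator.
under eq_bigr do rewrite !mulrDr.
under [in RHS]eq_bigr do rewrite !mulrDr.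
rewrite !big_split/=; congr (_ + _ + _).
- under eq_bigr do rewrite mulr_sumr.
  under [in RHS]eq_bigr do rewrite mulr_sumr.
  rewrite exchange_big [RHS]exchange_big; apply: eq_bigr => i _.
  under eq_bigr do rewrite mulr_sumr.
  under [in RHS]eq_bigr do rewrite mulr_sumr.
  rewrite exchange_big [RHS]exchange_big; apply: eq_bigr => j _.
  by apply: (inv (fun s => exchange s i j) (fun s => bulk_rate q s i j)) => s; rewrite exchangeK.
- under eq_bigr do rewrite mulr_sumr.
  under [in RHS]eq_bigr do rewrite mulr_sumr.
  rewrite exchange_big [RHS]exchange_big; apply: eq_bigr => i _.
  by apply: (inv (fun s => flip s i) (fun s => if s i then gamma else alpha)) => s; rewrite flipK.
- under eq_bigr do rewrite mulr_sumr.
  under [in RHS]eq_bigr do rewrite mulr_sumr.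
  rewrite exchange_big [RHS]exchange_big; apply: eq_bigr => i _.
  by apply: (inv (fun s => flip s i) (fun s => if s i then beta else delta)) => s; rewrite flipK.
Qed.

End asep_chain.

(** * Stationary weights and comparison with the Bernoulli measure *)

Section matrix_product.
Context {R : realType} (q A B : R).
Hypothesis qAB : dense_regime q A B.
Implicit Types (g h : nat -> R) (t : nat -> bool) (b : bool).
Local Notation op := (op q A B).
Local Notation opE := (opE A).
Local Notation opD := (opD q A B).
Local Notation opP := (opP q A B).
Local Notation lam := (lam A).

Let A_gt1 : 1 < A. Proof. by case: qAB. Qed.
Let A_gt0 : 0 < A. Proof. exact: lt_trans A_gt1. Qed.
Let lam0 := lam_gt0 qAB.

(** The letters [t m], ..., [t (m + k - 1)] are applied in this order, as a row vector is multiplied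
    by a word from the left. *)
Fixpoint word_op t m k g :=
  if k is k'.+1 then word_op t m.+1 k' (op (t m) g) else g.

Lemma word_op_cat t m k1 k2 g :
  word_op t m (k1 + k2) g = word_op t (m + k1) k2 (word_op t m k1 g).
Proof.
elim: k1 m g => [|k IH] m g; first by rewrite addn0.
by rewrite addSn /= IH addSnnS.
Qed.

Lemma eq_word_op t t' m k g :
  (forall i, (m <= i < m + k)%N -> t i = t' i) -> word_op t m k g = word_op t' m k g.
Proof.
elim: k m g => //= k IH m g tt'; rewrite tt' ?leqnn ?addnS ?ltnS ?leq_addr//.
by apply: IH => i /andP[mi ik]; apply: tt'; rewrite (ltnW mi) addnS -addSn.
Qed.

Lemma word_op_linear (a : R) t m k g h :
  word_op t m k (fun j => a * g j + h j)
  = fun j => a * word_op t m k g j + word_op t m k h j.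
Proof.
elim: k m g h => //= k IH m g h; rewrite -IH; congr word_op.
by apply/funext => j; rewrite op_linear.
Qed.

Lemma word_op_cst0 t m k : word_op t m k (cst 0) = cst 0.
Proof.
have := word_op_linear (-1) t m k (cst 0) (cst 0).
rewrite (_ : (fun=> _) = cst 0); last by apply/funext => j; rewrite /= mulr0 addr0.
by move=> ->; apply/funext => j /=; rewrite mulN1r addNr.
Qed.

Lemma word_opZ (a : R) t m k g j :
  word_op t m k (fun j => a * g j) j = a * word_op t m k g j.
Proof.
rewrite (_ : (fun j => a * g j) = (fun j => a * g j + cst 0 j)).
  by rewrite word_op_linear word_op_cst0 addr0.
by apply/funext => i; rewrite addr0.
Qed.

Lemma word_opD t m k g h j :
  word_op t m k (fun j => g j + h j) j = word_op t m k g j + word_op t m k h j.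
Proof.
rewrite (_ : (fun j => g j + h j) = (fun j => 1 * g j + h j)).
  by rewrite word_op_linear mul1r.
by apply/funext => i; rewrite mul1r.
Qed.

Lemma word_op_linear2 (a b : R) t m k g h j :
  word_op t m k (fun j => a * g j + b * h j) j = a * word_op t m k g j + b * word_op t m k h j.
Proof. by rewrite word_op_linear word_opZ. Qed.

Lemma word_op_le t m k g h : (forall j, g j <= h j) ->
  forall j, word_op t m k g j <= word_op t m k h j.
Proof.
by elim: k m g h => //= k IH m g h gh j; apply: IH => i; exact: (op_le qAB).
Qed.

Lemma word_op_norm t m k g j :
  `|word_op t m k g j| <= word_op t m k (fun j => `|g j|) j.
Proof.
rewrite ler_norml; apply/andP; split.
  rewrite -mulN1r -word_opZ; apply: word_op_le => i.
  by rewrite mulN1r lerNl -normrN ler_norm.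
by apply: word_op_le => i; exact: ler_norm.
Qed.

Section stationarity.
Context (alpha beta gamma delta C D : R).
Hypotheses (rightD : beta * (1 + A + B) - delta = 1 - q)
  (rightM : beta * (A * B) = - delta)
  (leftD : alpha * (1 + C + D) - gamma = 1 - q)
  (leftM : alpha * (C * D) = - gamma).
Context (g : nat -> R).
Hypothesis gCD : left_boundary q A B C D g.

(** This is [(beta D - delta E) |V> = (1 - q) |V>]. The last letter stands next to [|V>], so entry 0
    is what is needed. *)
Lemma right_boundaryE h : beta * opD h 0%N - delta * opE h 0%N = (1 - q) * h 0%N.
Proof.
have A0 : A != 0 by rewrite gt_eqF.
rewrite /opD /opE expr0 -rightD (_ : delta = - (beta * (A * B))); last by rewrite rightM opprK.
by field.
Qed.

(** This is [<W| (alpha E - gamma D) = (1 - q) <W|], needed at every entry since further letters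
    follow. *)
Lemma left_boundaryE j : alpha * opE g j - gamma * opD g j = (1 - q) * g j.
Proof.
rewrite opEe opDd -leftD (_ : gamma = - (alpha * (C * D))); last by rewrite leftM opprK.
rewrite (_ : ope A g j = (C + D) * g j - C * D * opd q A B g j); first by ring.
by rewrite -gCD; ring.
Qed.

Definition hat b : R := (1 - q) * (if b then - 1 else 1).
Definition swap_rate (a b : bool) : R :=
  if a && ~~ b then 1 else if ~~ a && b then q else 0.

(* The weight of the word with its i-th letter removed. *)
Definition reduced t n i := word_op t i.+1 (n - i.+1) (word_op t 0 i g) 0%N.

Lemma word_op_site t n i h : (i < n)%N ->
  word_op t 0 n h = word_op t i.+1 (n - i.+1) (op (t i) (word_op t 0 i h)).
Proof.
move=> lin; have {1}-> : n = (i + (n - i.+1).+1)%N by rewrite addnS -addSn subnKC.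
by rewrite word_op_cat add0n.
Qed.

(** The net flow across a bond is a difference of two words with one letter less, so that bonds will
    telescope. For different letters this is the relation between [D] and [E]; for equal ones both
    rates vanish and the two reduced words coincide. *)
Lemma bond_balance t t' n i : (i.+1 < n)%N ->
  (forall k, k != i -> k != i.+1 -> t' k = t k) -> t' i = t i.+1 -> t' i.+1 = t i ->
  swap_rate (t' i) (t' i.+1) * word_op t' 0 n g 0%N
    - swap_rate (t i) (t i.+1) * word_op t 0 n g 0%N
  = hat (t i) * reduced t n i - hat (t i.+1) * reduced t n i.+1.
Proof.
move=> lin tt' ti tSi; have lin' := ltnW lin.
set r := (n - i.+2)%N; have rE : (n - i.+1 = r.+1)%N by rewrite /r subnSK.
set G := word_op t 0 i g.
have G' : word_op t' 0 i g = G.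
  by apply: eq_word_op => k /andP[_ ki]; apply: tt'; lia.
rewrite /reduced !(word_op_site _ _ lin') rE -/G G' [word_op t 0 i.+1 g](_ : _ = op (t i) G); last first.
  by rewrite -addn1 word_op_cat.
rewrite -/r /= ti tSi.
have -> h : word_op t' i.+2 r h = word_op t i.+2 r h.
  by apply: eq_word_op => k /andP[ik _]; apply: tt'; lia.
set w := word_op t i.+2 r.
have key : w (opD (opE G)) 0%N * q - w (opE (opD G)) 0%N = - (1 - q) * (w (opE G) 0%N + w (opD G) 0%N).
  have -> : opE (opD G) = (fun j => q * opD (opE G) j + (1 - q) * opP G j).
    by apply/funext => j; rewrite -(opED qAB); ring.
  rewrite /w word_op_linear2 (_ : opP G = fun j => opD G j + opE G j)// (word_opD _ _ _ (opD G) (opE G)); ring.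
by case: (t i); case: (t i.+1); rewrite /swap_rate /hat /op /=; move: key; lra.
Qed.

Lemma left_balance t t' n : (0 < n)%N ->
  (forall k, k != 0%N -> t' k = t k) -> t' 0%N = ~~ t 0%N ->
  (if t' 0%N then gamma else alpha) * word_op t' 0 n g 0%N
    - (if t 0%N then gamma else alpha) * word_op t 0 n g 0%N
  = - (hat (t 0%N) * reduced t n 0).
Proof.
move=> n0 tt' t0; rewrite /reduced !(word_op_site _ _ n0)/=.
have -> h : word_op t' 1 (n - 1) h = word_op t 1 (n - 1) h.
  by apply: eq_word_op => k /andP[ik _]; apply: tt'; lia.
set w := word_op t 1 (n - 1).
have key : alpha * w (opE g) 0%N - gamma * w (opD g) 0%N = (1 - q) * w g 0%N.
  rewrite /w -[RHS]word_opZ (_ : (fun j => (1 - q) * g j) = (fun j => alpha * opE g j + (- gamma) * opD g j)).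
    by rewrite word_op_linear2; ring.
  by apply/funext => j; rewrite -left_boundaryE; ring.
by rewrite t0; case: (t 0%N); rewrite /hat /op /=; move: key; lra.
Qed.

Lemma right_balance t t' n :
  (forall k, k != n -> t' k = t k) -> t' n = ~~ t n ->
  (if t' n then beta else delta) * word_op t' 0 n.+1 g 0%N
    - (if t n then beta else delta) * word_op t 0 n.+1 g 0%N
  = hat (t n) * reduced t n.+1 n.
Proof.
move=> tt' tn; rewrite /reduced !(word_op_site _ _ (ltnSn n)) subnn /= -/(op _).
have -> : word_op t' 0 n g = word_op t 0 n g.
  by apply: eq_word_op => k /andP[_ kn]; apply: tt'; lia.
have := right_boundaryE (word_op t 0 n g).
by rewrite tn; case: (t n); rewrite /hat /op /=; lra.
Qed.

(** Indexing letters by [nat] makes words easy to cut and shift. *)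
Definition occ n (tau : config n) (k : nat) : bool :=
  if insub k is Some i then tau i else false.

Lemma occ_ord n (tau : config n) (i : 'I_n) : occ tau i = tau i.
Proof. by rewrite /occ valK. Qed.

Lemma occ_eq n (tau tau' : config n) (P : pred nat) :
  (forall i : 'I_n, P i -> tau' i = tau i) -> forall k, P k -> occ tau' k = occ tau k.
Proof. by move=> H k Pk; rewrite /occ; case: insubP => // i _ ik; rewrite H// ik. Qed.

Definition amplitude n (h : nat -> R) (tau : config n) : R := word_op (occ tau) 0 n h 0%N.

Lemma amplitudeE n (h : nat -> R) (tau : config n) : amplitude h tau = word_op (occ tau) 0 n h 0%N.
Proof. by []. Qed.

(** The bonds telescope to [H 0 - H n], which the reservoirs compensate by [- H 0] on the left and
    [H n] on the right. *)
Lemma amplitude_balance n (tau : config n.+1) :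
  \sum_(i < n.+1) \sum_(j < n.+1 | val j == (val i).+1)
     (bulk_rate q (exchange tau i j) i j * amplitude g (exchange tau i j)
      - bulk_rate q tau i j * amplitude g tau)
  + \sum_(i < n.+1 | val i == 0%N)
     ((if flip tau i i then gamma else alpha) * amplitude g (flip tau i)
      - (if tau i then gamma else alpha) * amplitude g tau)
  + \sum_(i < n.+1 | (val i).+1 == n.+1)
     ((if flip tau i i then beta else delta) * amplitude g (flip tau i)
      - (if tau i then beta else delta) * amplitude g tau) = 0.
Proof.
set t := occ tau; pose H i := hat (t i) * reduced t n.+1 i.
have flipE (i : 'I_n.+1) k : k != val i -> occ (flip tau i) k = t k.
  move: k; apply: occ_eq => j ji; rewrite ffunE -val_eqE; by rewrite (negPf ji).
rewrite [X in X + _ + _](_ : _ = H 0%N - H n); last first.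
  rewrite big_ord_recr/= [X in _ + X]big_pred0 ?addr0; last first.
    by move=> j; exact: ltn_eqF (ltn_ord j).
  transitivity (\sum_(i < n) (H i - H i.+1)); last first.
    rewrite -(big_mkord xpredT (fun i => H i - H i.+1)).
    rewrite (eq_bigr (fun i => - (H i.+1 - H i))); last by move=> *; rewrite opprB.
    by rewrite sumrN telescope_sumr//; exact: opprB.
  apply: eq_bigr => i _; have ltj : (i.+1 < n.+1)%N by exact: ltn_ord i.
  pose i' := widen_ord (leqnSn n) i; pose j := Ordinal ltj.
  rewrite (big_pred1 j) => [|k]; last by rewrite /= -val_eqE.
  rewrite /H -(@bond_balance t (occ (exchange tau i' j)) n.+1 i)//.
  - by rewrite /bulk_rate -!occ_ord.
  - move=> k ki kj; apply: (@occ_eq _ tau _ (fun k : nat => (k != i :> nat) && (k != i.+1))).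
      by move=> m /andP[mi mj]; rewrite ffunE tpermD// -val_eqE eq_sym.
    by rewrite ki kj.
  - by rewrite -[val i]/(val i') /t -[(i.+1)]/(val j) !occ_ord ffunE tpermL.
  - by rewrite -[i.+1]/(val j) /t -[val i]/(val i') !occ_ord ffunE tpermR.
rewrite (big_pred1 ord0) => [|k]; last by rewrite /= -val_eqE.
rewrite (big_pred1 ord_max) => [|k]; last by rewrite /= -val_eqE eqSS.
have t0 : t 0%N = tau ord0 := occ_ord tau ord0.
have tn : t n = tau ord_max := occ_ord tau ord_max.
have f0 : occ (flip tau ord0) 0%N = flip tau ord0 ord0 := occ_ord _ ord0.
have fn : occ (flip tau ord_max) n = flip tau ord_max ord_max := occ_ord _ ord_max.
have bl : (if flip tau ord0 ord0 then gamma else alpha) * amplitude g (flip tau ord0) -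
    (if tau ord0 then gamma else alpha) * amplitude g tau = - H 0%N.
  rewrite /H -(@left_balance t (occ (flip tau ord0)) n.+1)//.
  - by rewrite t0 f0.
  - exact: (flipE ord0).
  - by rewrite t0 f0 ffunE eqxx.
have br : (if flip tau ord_max ord_max then beta else delta) * amplitude g (flip tau ord_max) -
    (if tau ord_max then beta else delta) * amplitude g tau = H n.
  rewrite /H -(@right_balance t (occ (flip tau ord_max)) n)//.
  - by rewrite tn fn.
  - exact: (flipE ord_max).
  - by rewrite tn fn ffunE eqxx.
rewrite bl br.
by ring.
Qed.

Lemma amplitude_invariant n (f : config n.+1 -> R) :
  \sum_s amplitude g s * asep_generator q alpha beta gamma delta f s = 0.
Proof. by rewrite asep_adjointE big1// => s _; rewrite amplitude_balance mulr0. Qed.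

End stationarity.
End matrix_product.

Definition bernoulli_weight {R : realType} (rho : R) n (tau : config n) : R :=
  \prod_i (if tau i then rho else 1 - rho).

Lemma flip_inv n (tau : config n) i : flip (flip tau i) i = tau.
Proof. by apply/ffunP => k; rewrite !ffunE; case: eqP => // _; rewrite negbK. Qed.

(** * Forgetting of the left boundary *)

Section mixing.
Context {R : realType} (q A B : R).
Hypothesis qAB : dense_regime q A B.
Local Notation opP := (opP q A B).
Local Notation lam := (lam A).
Local Notation word_op := (word_op q A B).
Local Notation amplitude := (amplitude q A B).
Local Notation rho := (A / (1 + A)).

Let A_gt1 : 1 < A. Proof. by case: qAB. Qed.
Let A_gt0 : 0 < A. Proof. exact: lt_trans A_gt1. Qed.
Let lam0 := lam_gt0 qAB.

(** Constants are common eigenvectors, with eigenvalues [1 + A = lam * rho] for [opD] and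
    [1 + A^-1 = lam * (1 - rho)] for [opE]; this is the origin of the density [rho]. *)
Lemma amplitude_cst n (c : R) (tau : config n) :
  amplitude (cst c) tau = lam ^+ n * bernoulli_weight rho tau * c.
Proof.
have A0 : A != 0 by rewrite gt_eqF.
have A1 : 1 + A != 0 by rewrite gt_eqF// addr_gt0.
have cstE t m k : word_op t m k (cst c)
    = cst (lam ^+ k * (\prod_(m <= i < m + k) (if t i then rho else 1 - rho)) * c).
  elim: k m c => [|k IH] m c'; first by rewrite addn0 big_geq// expr0 !mul1r.
  rewrite /= (_ : op _ _ _ _ _ = cst (lam * (if t m then rho else 1 - rho) * c')).
    rewrite IH addnS addSn [in RHS]big_ltn ?ltnS ?leq_addr// exprS; congr cst.
    by move: (bigop _ _ _) (if _ then _ else _) => p r; ring.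
  apply/funext => j; case: (t m); rewrite /op /opD /opE /lam /=; field; by rewrite ?A0 ?A1.
rewrite amplitudeE cstE /=; congr (_ * _ * _).
rewrite add0n big_mkord; apply: eq_bigr => i _; by rewrite occ_ord.
Qed.

(** Pairing [tau] with its flip at a site that [F] ignores turns the letter there into [opP]. The
    right-hand side still sums over the occupations already averaged, whence [2 ^+ j]. *)
Lemma sum_word_op_average n k j (h : nat -> R) (F : config n -> R) : (k + j <= n)%N ->
  (forall i tau, (k <= val i < k + j)%N -> F (flip tau i) = F tau) ->
  2 ^+ j * \sum_tau word_op (occ tau) k (n - k) h 0%N * F tau
  = \sum_tau word_op (occ tau) (k + j) (n - (k + j)) (iter j opP h) 0%N * F tau.
Proof.
elim: j k h => [|j IH] k h kjn Finv; first by rewrite expr0 mul1r addn0.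
rewrite exprSr -mulrA (_ : 2 * _ = \sum_tau word_op (occ tau) k.+1 (n - k.+1) (opP h) 0%N * F tau).
  rewrite IH ?addSnnS//; last first.
    by move=> i tau /= ij; apply: Finv => /=; lia.
  by under [in RHS]eq_bigr do rewrite iterSr.
have kn : (k < n)%N by lia.
pose i := Ordinal kn.
have inj : injective (fun tau : config n => flip tau i).
  by apply: (can_inj (g := fun tau => flip tau i)) => tau; exact: flip_inv.
rewrite mulr_natl mulr2n [X in _ + X](reindex_inj inj)/=.
rewrite -big_split/=.
apply: eq_bigr => tau _; rewrite Finv; last by rewrite /=; lia.
rewrite -mulrDl; congr (_ * _); rewrite -(subnSK kn) /=.
have -> h' : word_op (occ (flip tau i)) k.+1 (n - k.+1) h' = word_op (occ tau) k.+1 (n - k.+1) h'.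
  apply: eq_word_op => l /andP[kl _]; apply: (@occ_eq _ tau _ (fun l => (k < l)%N)) => // o ko.
  by rewrite ffunE; case: eqP => // oi; move: ko; rewrite oi /= ltnn.
rewrite -word_opD; congr (word_op _ _ _ _ _); apply/funext => l.
have -> : occ tau k = tau i := occ_ord tau i.
have -> : occ (flip tau i) k = ~~ tau i by rewrite (occ_ord _ i : occ (flip tau i) k = _) ffunE eqxx.
by rewrite /opP; case: (tau i); rewrite /op//= addrC.
Qed.

Lemma sum_amplitude n (g : nat -> R) :
  \sum_(tau : config n) amplitude g tau = lam ^+ n * scaled_iter q A B g n :> R.
Proof.
have := @sum_word_op_average n 0 n g (fun=> 1); rewrite add0n => /(_ (leqnn n) (fun _ _ _ => erefl)).
rewrite subn0 subnn /= sumr_const.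
rewrite (_ : #|_| = (2 ^ n)%N); last by rewrite card_ffun card_bool card_ord.
rewrite mulr1 -[_ *+ (2 ^ _)]mulr_natl natrX => H.
have {}H : \sum_(tau : config n) amplitude g tau = iter n opP g 0%N :> R.
  by apply: (mulfI (_ : (2 : R) ^+ n != 0)); rewrite ?expf_neq0// -H; under [in RHS]eq_bigr do rewrite mulr1.
by rewrite H /scaled_iter mulrC divfK// expf_neq0// gt_eqF.
Qed.

(** Averaging over the [m] ignored sites replaces [g] by [iter m opP g], which differs from a
    constant by at most a multiple of [(lam * th) ^+ m * s ^ j]. The constant yields the Bernoulli
    weights exactly; the rest is bounded by averaging [s ^ j] over the other sites. *)
Lemma amplitude_mixing (s : R) g : 1 < s -> s < A ^+ 2 -> geom_bounded s g -> exists K th : R,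
  [/\ 0 < K, 0 < th, th < 1 & forall n m (F : config n -> R), (m <= n)%N ->
    (forall tau, `|F tau| <= 1) ->
    (forall i tau, (val i < m)%N -> F (flip tau i) = F tau) ->
    `|\sum_tau amplitude g tau * F tau
      - lam ^+ n * scaled_iter q A B g m * \sum_tau bernoulli_weight rho tau * F tau|
    <= K * th ^+ m * lam ^+ n].
Proof.
move=> s_gt1 s_ltA2 gb; have [K [th [K0 th0 th1 HK]]] := iter_opP_oscillation qAB s_gt1 s_ltA2 gb.
have [L [L0 HL]] := iter_opP_geom_le qAB s_gt1 s_ltA2.
exists (K * L), th; split; rewrite ?mulr_gt0// => n m F mn F1 Finv.
set c := scaled_iter q A B g m.
have two m' : (2 : R) ^+ m' != 0 by rewrite expf_neq0.
have ampB (tau : config n) : amplitude g tau = amplitude (fun j => g j - c) tau + lam ^+ n * bernoulli_weight rho tau * c.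
  by rewrite -amplitude_cst !amplitudeE -word_opD; congr (word_op _ _ _ _ _); apply/funext => j /=; rewrite subrK.
rewrite (_ : _ - _ = \sum_tau amplitude (fun j => g j - c) tau * F tau); last first.
  rewrite mulr_sumr -sumrB; apply: eq_bigr => tau _; rewrite ampB; ring.
have := @sum_word_op_average n 0 m (fun j => g j - c) F mn; rewrite add0n subn0 => avg.
have {avg} /(canRL (mulKf (two m))) -> := avg (fun i tau im => Finv i tau im).
rewrite normrM normfV [ `|2 ^+ m|]ger0_norm ?exprn_ge0//.
rewrite [leLHS]mulrC ler_pdivrMr ?exprn_gt0//; apply: le_trans (ler_norm_sum _ _ _) _.
set b := K * (lam * th) ^+ m.
have b0 : 0 <= b by rewrite mulr_ge0 ?exprn_ge0 ?mulr_ge0// ltW.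
apply: (@le_trans _ _ (\sum_(tau : config n) b * (word_op (occ tau) m (n - m) (fun j => s ^+ j) 0%N * 1))).
  apply: ler_sum => tau _; rewrite normrM mulrA; apply: ler_pM => //.
  apply: le_trans (word_op_norm qAB _ _ _ _ _) _; rewrite -word_opZ.
  apply: (word_op_le qAB) => j; apply: le_trans (HK m j).
  rewrite (_ : (fun j => g j - c) = fun j => 1 * g j + cst (- c) j); last by apply/funext => i; rewrite mul1r.
  rewrite iter_opP_linear (iter_opP_cst qAB) mul1r mulrN /c /scaled_iter mulrC divfK//.
  by rewrite expf_neq0// gt_eqF.
rewrite -mulr_sumr.
have := @sum_word_op_average n m (n - m) (fun j => s ^+ j) (fun=> 1).
rewrite subnKC// => /(_ (leqnn n) (fun _ _ _ => erefl)).
rewrite subnn /= sumr_const (_ : #|_| = (2 ^ n)%N); last by rewrite card_ffun card_bool card_ord.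
rewrite mulr1 -[_ *+ (2 ^ _)]mulr_natl natrX => /(canRL (mulKf (two _))) ->.
have -> : (2 : R) ^+ n = 2 ^+ (n - m) * 2 ^+ m by rewrite -exprD subnK.
rewrite -(mulrA (2 ^+ (n - m))) mulKf//.
have := HL (n - m)%N => H.
rewrite [leRHS](_ : _ = b * (2 ^+ m * (L * lam ^+ (n - m)))); last first.
  rewrite /b exprMn -[in LHS](subnK mn) exprD; ring.
by rewrite ler_wpM2l// ler_wpM2l// exprn_ge0.
Qed.

End mixing.

(** The witness [k'] is the conjugate root [kappa_-]; the two equations are Vieta's relations in the
    form that the boundary vectors require. *)
Lemma kappa_plus_roots {R : realType} (q x y : R) : q < 1 -> 0 < x -> 0 <= y ->
  let k := kappa_plus q x y in exists k' : R,
  [/\ x * (k * k') = - y, x * (1 + k + k') - y = 1 - q, 0 <= k, -1 < k' & k' <= 0].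
Proof.
move=> q1 x0 y0; rewrite /kappa_plus; set w := 1 - q - x + y.
set d := w ^+ 2 + 4 * x * y.
have xy0 : 0 <= 4 * x * y by apply: mulr_ge0 => //; apply: mulr_ge0 => //; exact: ltW.
have d0 : 0 <= d by rewrite addr_ge0 ?sqr_ge0.
set r := Num.sqrt d; have r2 : r ^+ 2 = d by rewrite sqr_sqrtr.
have x_neq0 : x != 0 by rewrite gt_eqF.
have wr : `|w| <= r.
  by rewrite -(sqrtr_sqr w) ler_wsqrtr// lerDl.
move: wr; rewrite ler_norml => /andP[wr1 wr2].
set k := (w + r) / (2 * x); exists ((w - r) / (2 * x)); set k' := (w - r) / (2 * x).
have k0 : 0 <= k by rewrite divr_ge0// ?mulr_ge0 ?(ltW x0)//; lra.
have k'0 : k' <= 0 by rewrite mulr_le0_ge0 ?invr_ge0 ?mulr_ge0 ?(ltW x0)//; lra.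
have E1 : x * (k * k') = - y.
  rewrite (_ : x * (k * k') = (w ^+ 2 - r ^+ 2) / (4 * x)); last by rewrite /k /k'; field.
  by rewrite r2 /d; field.
have E2 : x * (1 + k + k') - y = 1 - q.
  by rewrite /k /k' (_ : w = 1 - q - x + y)//; field.
split=> //.
(* Adding the two relations gives [x * ((1 + k) * (1 + k')) = 1 - q], hence [k' > -1]. *)
have : 0 < x * ((1 + k) * (1 + k')) by move: E1 E2; lra.
rewrite pmulr_rgt0// pmulr_rgt0; last lra.
lra.
Qed.

Section bernoulli.
Context {R : realType} (rho : R) (n : nat).
Hypotheses (rho_ge0 : 0 <= rho) (rho_le1 : rho <= 1).

Lemma bernoulli_weight_ge0 (tau : config n) : 0 <= bernoulli_weight rho tau.
Proof. by apply: prodr_ge0 => i _; case: ifP => // _; rewrite subr_ge0. Qed.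

Lemma sum_bernoulli_prod (phi : 'I_n -> bool -> R) :
  \sum_(tau : config n) bernoulli_weight rho tau * \prod_i phi i (tau i)
  = \prod_i (rho * phi i true + (1 - rho) * phi i false).
Proof.
transitivity (\prod_(i < n) \sum_(b : bool) (if b then rho else 1 - rho) * phi i b).
  by rewrite bigA_distr_bigA; apply: eq_bigr => tau _; rewrite -big_split.
by apply: eq_bigr => i _; rewrite big_bool.
Qed.

Lemma sum_bernoulli_weight : \sum_(tau : config n) bernoulli_weight rho tau = 1.
Proof.
transitivity (\sum_(tau : config n) bernoulli_weight rho tau * \prod_(i < n) 1).
  by apply: eq_bigr => tau _; rewrite big1 ?mulr1.
by rewrite (sum_bernoulli_prod (fun _ _ => 1)) big1// => i _; rewrite !mulr1 addrC subrK.
Qed.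

Lemma norm_sum_bernoulli_le (F : config n -> R) : (forall tau, `|F tau| <= 1) ->
  `|\sum_tau bernoulli_weight rho tau * F tau| <= 1.
Proof.
move=> F1; apply: le_trans (ler_norm_sum _ _ _) _; rewrite -sum_bernoulli_weight.
apply: ler_sum => tau _; rewrite normrM ger0_norm ?bernoulli_weight_ge0//.
by rewrite ler_piMr// bernoulli_weight_ge0.
Qed.
End bernoulli.

(* Away from an edge of [m] sites, [mu n] is within [K * th ^+ m] of the product
   Bernoulli measure in total variation, uniformly in [n]. *)
Definition bulk_bernoulli {R : realType} (edge : forall n, nat -> pred 'I_n) (rho : R)
    (mu : forall n, config n -> R) := exists (K th : R) (n0 : nat),
  [/\ 0 < th, th < 1 & forall n m (F : config n -> R), (n0 <= n)%N -> (m <= n)%N ->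
   (forall tau, `|F tau| <= 1) -> (forall i tau, edge n m i -> F (flip tau i) = F tau) ->
   `|\sum_tau mu n tau * F tau - \sum_tau bernoulli_weight rho tau * F tau| <= K * th ^+ m].

Definition left_edge n m : pred 'I_n := fun i => (i < m)%N.
Definition right_edge n m : pred 'I_n := fun i => (n <= i + m)%N.

Definition asep_invariant {R : realType} (q alpha beta gamma delta : R)
    (mu : forall n, config n -> R) := forall n, (0 < n)%N ->
  \sum_tau mu n tau = 1 /\
  forall f, \sum_tau mu n tau * asep_generator q alpha beta gamma delta f tau = 0.

Lemma high_density_bulk {R : realType} (q alpha beta gamma delta : R) mu :
  0 <= q -> q < 1 -> 0 < alpha -> 0 < beta -> 0 <= gamma -> 0 <= delta ->
  asep_invariant q alpha beta gamma delta mu ->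
  let A := kappa_plus q beta delta in let C := kappa_plus q alpha gamma in
  C < A -> 1 < A -> bulk_bernoulli left_edge (A / (1 + A)) mu.
Proof.
move=> q0 q1 a0 b0 c0 d0 muI A C CA A1.
have [B [rM rD A0 B1 B0]] := kappa_plus_roots q1 b0 d0.
have [D [lM lD C0 D1 D0]] := kappa_plus_roots q1 a0 c0.
rewrite -/A in rM rD A0; rewrite -/C in lM lD C0.
have qAB : dense_regime q A B by [].
(* With [r] strictly between [Num.max C 1] and [A], the rate [s = A * r] exceeds both [A * C] and
   [A] while staying below [A ^+ 2]. *)
pose r := (Num.max C 1 + A) / 2.
have [r1 rC rA] : [/\ 1 < r, C < r & r < A].
  have : Num.max C 1 < A by rewrite gt_max CA A1.
  have : C <= Num.max C 1 by rewrite le_max lexx.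
  have : 1 <= Num.max C 1 by rewrite le_max lexx orbT.
  rewrite /r; move: (Num.max C 1) => M ? ? ?; split; lra.
have Agt0 : 0 < A by lra.
pose s := A * r.
have [s1 sA sAC sA2] : [/\ 1 < s, A < s, A * C < s & s < A ^+ 2].
  rewrite /s expr2 !ltr_pM2l//; split=> //; nra.
have [g gCD g0] := left_boundary_exists qAB C D.
have gb := geom_bounded_left_boundary qAB C0 D1 D0 sAC sA gCD.
have x0 := left_boundary_nondegenerate qAB s1 sA2 C0 D1 D0 gb gCD g0.
have gcv := scaled_iter_cvg qAB s1 sA2 gb.
set x := scaled_lim q A B g in x0.
have [K [th [K0 th0 th1 mix]]] := amplitude_mixing qAB s1 sA2 gb.
have x2 : 0 < `|x| / 2 by rewrite divr_gt0// normr_gt0.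
have /cvgrPdist_lt /(_ _ x2) [n0 _ Hn0] := gcv.
have zn n : (n0 <= n)%N -> `|x| / 2 <= `|scaled_iter q A B g n|.
  move=> /Hn0; rewrite -/(scaled_lim q A B g) -/x => H.
  have := lerB_dist x (scaled_iter q A B g n).
  by move: H; lra.
(* The error [K] occurs twice, for [F] and for the normalisation, and is divided by a total of at
   least [lam A ^+ N] times half of [x] in absolute value. The successor in [n0.+1] excludes the
   empty lattice. *)
exists (4 * K / `|x|), th, n0.+1; split => // -[//|n] m F n0n mn F1 Finv.
set N := n.+1 in F mn F1 Finv *.
have [mu1 muL] := muI N isT.
have ampI := amplitude_invariant qAB rD rM lD lM gCD (n := n).
have muE := asep_invariant_unique q0 a0 b0 c0 d0 mu1 muL ampI.
set z := scaled_iter q A B g N; set Z := lam A ^+ N * z.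
have l0 : 0 < lam A ^+ N by rewrite exprn_gt0// (lam_gt0 qAB).
have ampZ tau : amplitude q A B g tau = Z * mu N tau by rewrite muE (sum_amplitude qAB).
have rho0 : 0 <= A / (1 + A) by rewrite divr_ge0//; lra.
have rho1 : A / (1 + A) <= 1 by rewrite ler_pdivrMr; lra.
have H1 := mix N m F mn F1 (fun i tau im => Finv i tau im).
have H2 := mix N m (fun=> 1) mn (fun _ => _) (fun _ _ _ => erefl).
have {H2} : `|Z - lam A ^+ N * scaled_iter q A B g m| <= K * th ^+ m * lam A ^+ N.
  have := H2 _; under eq_bigr do rewrite mulr1; under [X in _ * X]eq_bigr do rewrite mulr1.
  by rewrite sum_bernoulli_weight (sum_amplitude qAB) mulr1 => -> // _; rewrite normr1.
move=> H2; have H3 := norm_sum_bernoulli_le rho0 rho1 F1.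
set bF := \sum_tau bernoulli_weight _ tau * F tau in H1 H3 *.
set mF := \sum_tau mu N tau * F tau.
have EZ : \sum_tau amplitude q A B g tau * F tau = Z * mF.
  by rewrite /mF mulr_sumr; apply: eq_bigr => tau _; rewrite ampZ mulrA.
rewrite EZ in H1.
have H4 : `|Z| * `|mF - bF| <= 2 * K * th ^+ m * lam A ^+ N.
  rewrite -normrM (_ : Z * (mF - bF) = (Z * mF - lam A ^+ N * scaled_iter q A B g m * bF)
      - (Z - lam A ^+ N * scaled_iter q A B g m) * bF); last by ring.
  apply: le_trans (ler_normB _ _) _.
  have : `|(Z - lam A ^+ N * scaled_iter q A B g m) * bF| <= K * th ^+ m * lam A ^+ N * 1.
    by rewrite normrM ler_pM.
  by move: H1; lra.
have H5 : lam A ^+ N * (`|x| / 2) * `|mF - bF| <= `|Z| * `|mF - bF|.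
  apply: ler_wpM2r => //; rewrite /Z normrM gtr0_norm// ler_pM2l//.
  by apply: zn; exact: ltnW.
have H6 : `|x| / 2 * `|mF - bF| <= 2 * K * th ^+ m.
  by rewrite -(ler_pM2l l0); move: H4 H5; lra.
rewrite mulrAC ler_pdivlMr ?normr_gt0//.
by move: H6; lra.
Qed.

(** * Particle-hole symmetry combined with reflection *)

Definition mirror n (tau : config n) : config n := [ffun i => ~~ tau (rev_ord i)].

Lemma mirrorK n : involutive (@mirror n).
Proof. by move=> tau; apply/ffunP => i; rewrite !ffunE rev_ordK negbK. Qed.

Lemma flip_mirror n (tau : config n) i : flip (mirror tau) (rev_ord i) = mirror (flip tau i).
Proof.
apply/ffunP => k; rewrite !ffunE (can2_eq (@rev_ordK _) (@rev_ordK _)).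
by case: ifP.
Qed.

Lemma exchange_mirror n (tau : config n) i j :
  exchange (mirror tau) (rev_ord j) (rev_ord i) = mirror (exchange tau i j).
Proof.
apply/ffunP => k; rewrite !ffunE; congr (~~ tau _).
rewrite tpermC; case: tpermP => [->|->|/eqP ki /eqP kj].
- by rewrite !rev_ordK tpermL.
- by rewrite !rev_ordK tpermR.
- by rewrite tpermD//; apply/eqP => E; [move: ki|move: kj]; rewrite E rev_ordK eqxx.
Qed.

(** Holes move left when particles move right, and the reflection turns them around again; injection
    on the left becomes removal on the right, which exchanges [alpha] with [beta] and [gamma] with
    [delta]. *)
Lemma asep_generator_mirror {R : realType} (q alpha beta gamma delta : R) n
    (f : config n -> R) (tau : config n) :
  asep_generator q alpha beta gamma delta (fun tau => f (mirror tau)) tau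
  = asep_generator q beta alpha delta gamma f (mirror tau).
Proof.
have revi : injective (@rev_ord n) by exact: rev_ord_inj.
rewrite /asep_generator -!addrA [X in _ + X = _]addrC; congr (_ + (_ + _)).
- rewrite [RHS](reindex_inj revi)/=.
  under [RHS]eq_bigr do rewrite (reindex_inj revi)/=.
  rewrite (exchange_big_dep xpredT)//=; apply: eq_bigr => j _; apply: eq_big => [i|i _].
    have := ltn_ord i; have := ltn_ord j; rewrite -[val i]/(nat_of_ord i) -[val j]/(nat_of_ord j).
    by move=> ? ?; apply/eqP/eqP; lia.
  rewrite exchange_mirror /bulk_rate !ffunE !rev_ordK negbK.
  by case: (tau i); case: (tau j).
- rewrite [RHS](reindex_inj revi)/=; apply: eq_big => [i|i _].
    have := ltn_ord i; rewrite -[val i]/(nat_of_ord i) => ?; apply/eqP/eqP; lia.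
  by rewrite flip_mirror ffunE rev_ordK; case: (tau i).
- rewrite [RHS](reindex_inj revi)/=; apply: eq_big => [i|i _].
    have := ltn_ord i; rewrite -[val i]/(nat_of_ord i) => ?; apply/eqP/eqP; lia.
  by rewrite flip_mirror ffunE rev_ordK; case: (tau i).
Qed.

Lemma bernoulli_weight_mirror {R : realType} (rho : R) n (tau : config n) :
  bernoulli_weight rho (mirror tau) = bernoulli_weight (1 - rho) tau.
Proof.
rewrite /bernoulli_weight (reindex_inj (@rev_ord_inj n)); apply: eq_bigr => i _.
by rewrite ffunE rev_ordK subKr; case: (tau i).
Qed.

Lemma low_density_bulk {R : realType} (q alpha beta gamma delta : R) mu :
  0 <= q -> q < 1 -> 0 < alpha -> 0 < beta -> 0 <= gamma -> 0 <= delta ->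
  asep_invariant q alpha beta gamma delta mu ->
  let A := kappa_plus q beta delta in let C := kappa_plus q alpha gamma in
  A < C -> 1 < C -> bulk_bernoulli right_edge (1 / (1 + C)) mu.
Proof.
move=> q0 q1 a0 b0 c0 d0 muI A C AC C1.
pose mu' n tau := mu n (mirror tau).
have sum_mirror n (G : config n -> R) : \sum_tau G (mirror tau) = \sum_tau G tau.
  by rewrite [RHS](reindex_inj (inv_inj (@mirrorK n))).
have muI' : asep_invariant q beta alpha delta gamma mu'.
  move=> n n0; have [mu1 muL] := muI n n0; split; first by rewrite sum_mirror.
  move=> f; rewrite -[RHS](muL (fun tau => f (mirror tau))) -[LHS]sum_mirror.
  by apply: eq_bigr => tau _; rewrite /mu' asep_generator_mirror mirrorK.
have [K [th [n0 [th0 th1 H]]]] := high_density_bulk q0 q1 b0 a0 d0 c0 muI' AC C1.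
exists K, th, n0; split => // n m F n0n mn F1 Finv.
have := H n m (fun tau => F (mirror tau)) n0n mn (fun tau => F1 _).
rewrite [X in `|X - _|](_ : _ = \sum_tau mu n tau * F tau); last first.
  by rewrite -[RHS]sum_mirror.
rewrite [X in `|_ - X|](_ : _ = \sum_tau bernoulli_weight (1 / (1 + C)) tau * F tau); last first.
  rewrite -[RHS]sum_mirror; apply: eq_bigr => tau _; rewrite bernoulli_weight_mirror.
  congr (_ * _); rewrite -/C (_ : 1 - 1 / (1 + C) = C / (1 + C))//.
  by field; rewrite gt_eqF//; lra.
apply=> i tau im; rewrite -(rev_ordK i) -flip_mirror rev_ordK Finv//.
by rewrite /right_edge /=; move: im; rewrite /left_edge; have := ltn_ord i; lia.
Qed.

(** * Independence and characteristic functions *)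

Section expectation.
Context {R : realType} {d : measure_display} {T : measurableType d} (P : probability T R).
Implicit Types X Y : T -> R.

(** A class closed under sums and products on which [Ex] is linear without further integrability
    conditions. *)
Definition bmeas X := measurable_fun setT X /\ exists M : R, forall w, `|X w| <= M.
Definition Ex X : R := Rintegral P setT X.

Lemma bmeas_integrable X : bmeas X -> P.-integrable setT (EFin \o X).
Proof.
move=> [mX [M XM]]; apply: measurable_bounded_integrable => //.
  exact: le_lt_trans (probability_le1 P measurableT) (ltry 1).
exists M; split; first by rewrite num_real.
by move=> x Mx w _; apply: le_trans (XM w) _; exact: ltW.
Qed.

Lemma bmeas_cst (c : R) : bmeas (cst c).
Proof. by split; [exact: measurable_cst|exists `|c|]. Qed.

Lemma bmeasD X Y : bmeas X -> bmeas Y -> bmeas (fun w => X w + Y w).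
Proof.
move=> [mX [M XM]] [mY [N YN]]; split; first exact: measurable_funD.
by exists (M + N) => w; apply: le_trans (ler_normD _ _) (lerD _ _).
Qed.

Lemma bmeasM X Y : bmeas X -> bmeas Y -> bmeas (fun w => X w * Y w).
Proof.
move=> [mX [M XM]] [mY [N YN]]; split; first exact: measurable_funM.
by exists (M * N) => w; rewrite normrM ler_pM.
Qed.

Lemma bmeasB X Y : bmeas X -> bmeas Y -> bmeas (fun w => X w - Y w).
Proof.
move=> bX bY; have := bmeasD bX (bmeasM (bmeas_cst (-1)) bY).
by congr bmeas; apply/funext => w; rewrite mulN1r.
Qed.

Lemma bmeas_norm X : bmeas X -> bmeas (fun w => `|X w|).
Proof.
by move=> [mX [M XM]]; split; [exact: measurableT_comp|exists M => w; rewrite normr_id].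
Qed.

Lemma bmeas_prod (I : Type) (r : seq I) (F : I -> T -> R) :
  (forall i, bmeas (F i)) -> bmeas (fun w => \prod_(i <- r) F i w).
Proof.
move=> bF; elim: r => [|i r IH].
  by under eq_fun do rewrite big_nil; exact: bmeas_cst.
by under eq_fun do rewrite big_cons; exact: bmeasM.
Qed.

Lemma bmeas_sum (I : Type) (r : seq I) (F : I -> T -> R) :
  (forall i, bmeas (F i)) -> bmeas (fun w => \sum_(i <- r) F i w).
Proof.
move=> bF; elim: r => [|i r IH].
  by under eq_fun do rewrite big_nil; exact: bmeas_cst.
by under eq_fun do rewrite big_cons; exact: bmeasD.
Qed.

Lemma Ex_cst (c : R) : Ex (cst c) = c.
Proof. by rewrite /Ex Rintegral_cst// [X in fine X](probability_setT P) mulr1. Qed.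

Lemma ExD X Y : bmeas X -> bmeas Y -> Ex (fun w => X w + Y w) = Ex X + Ex Y.
Proof. by move=> bX bY; rewrite /Ex -RintegralD//; exact: bmeas_integrable. Qed.

Lemma ExB X Y : bmeas X -> bmeas Y -> Ex (fun w => X w - Y w) = Ex X - Ex Y.
Proof. by move=> bX bY; rewrite /Ex -RintegralB//; exact: bmeas_integrable. Qed.

Lemma ExZ (a : R) X : bmeas X -> Ex (fun w => a * X w) = a * Ex X.
Proof. by move=> bX; rewrite /Ex -RintegralZl//; exact: bmeas_integrable. Qed.

Lemma Ex_sum (I : Type) (r : seq I) (F : I -> T -> R) : (forall i, bmeas (F i)) ->
  Ex (fun w => \sum_(i <- r) F i w) = \sum_(i <- r) Ex (F i).
Proof.
move=> bF; elim: r => [|i r IH].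
  by under eq_fun do rewrite big_nil; rewrite big_nil; exact: Ex_cst.
under eq_fun do rewrite big_cons; rewrite big_cons ExD ?IH//; exact: bmeas_sum.
Qed.

Lemma Ex_le X Y : bmeas X -> bmeas Y -> (forall w, X w <= Y w) -> Ex X <= Ex Y.
Proof. by move=> bX bY XY; apply: le_Rintegral => //; exact: bmeas_integrable. Qed.

Lemma Ex_norm_le X (M : R) : bmeas X -> (forall w, `|X w| <= M) -> `|Ex X| <= M.
Proof.
move=> bX XM; rewrite ler_norml; apply/andP; split.
  rewrite -[leLHS](Ex_cst (- M)); apply: Ex_le => // [|w]; first exact: bmeas_cst.
  by have := XM w; rewrite ler_norml => /andP[].
rewrite -[leRHS](Ex_cst M); apply: Ex_le => // [|w]; first exact: bmeas_cst.
by have := XM w; rewrite ler_norml => /andP[].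
Qed.

Lemma Ex_dist_le X Y (M : R) : bmeas X -> bmeas Y -> (forall w, `|X w - Y w| <= M) ->
  `|Ex X - Ex Y| <= M.
Proof. by move=> bX bY XY; rewrite -ExB//; apply: Ex_norm_le => //; exact: bmeasB. Qed.

Lemma Ex_indic (A : set T) : measurable A -> Ex (\1_A) = fine (P A).
Proof. by move=> mA; rewrite /Ex /Rintegral integral_indic// setIT. Qed.

Lemma expectation_Ex X : bmeas X -> ('E_P[X] = (Ex X)%:E)%E.
Proof.
move=> bX; rewrite unlock /Ex /Rintegral fineK//.
by have /integrable_fin_num -> := bmeas_integrable bX.
Qed.

Lemma norm_prod_sub_le (I : Type) (r : seq I) (x y : I -> R) :
  (forall i, `|x i| <= 1) -> (forall i, `|y i| <= 1) ->
  `|\prod_(i <- r) x i - \prod_(i <- r) y i| <= \sum_(i <- r) `|x i - y i|.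
Proof.
move=> x1 y1; elim: r => [|i r IH]; first by rewrite !big_nil subrr normr0.
rewrite !big_cons (_ : _ - _ = (x i - y i) * \prod_(j <- r) x j
   + y i * (\prod_(j <- r) x j - \prod_(j <- r) y j)); last by ring.
apply: le_trans (ler_normD _ _) (lerD _ _).
  rewrite normrM ler_piMr// normr_prod; elim: r {IH} => [|j r IH]; first by rewrite big_nil.
  by rewrite big_cons mulr_ile1// prodr_ge0.
by rewrite normrM; apply: le_trans IH; rewrite ler_piMl.
Qed.

(* Each [f i] is approximated uniformly by a step function. *)
Lemma Ex_prod_independent n (X : 'I_n -> T -> R) (f : 'I_n -> R -> R) :
  (forall i, measurable_fun setT (X i)) -> mutually_independent P X ->
  (forall i, measurable_fun setT (f i)) -> (forall i x, `|f i x| <= 1) ->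
  Ex (fun w => \prod_i f i (X i w)) = \prod_i Ex (fun w => f i (X i w)).
Proof.
move=> mX indX mf f1; apply/eqP; rewrite -subr_eq0 -normr_le0; apply/ler_addgt0Pl => e e0.
rewrite addr0.
have bfX i : bmeas (fun w => f i (X i w)).
  by split; [exact: (measurableT_comp (mf i) (mX i))|exists 1].
pose N := (Num.Def.archi_bound (2 * n%:R / e)).+1.
have N0 : 0 < N%:R :> R by [].
have nN : 2 * n%:R / N%:R <= e.
  rewrite ler_pdivrMr// [leRHS]mulrC -ler_pdivrMr//; apply: ltW.
  have e2 : 0 <= 2 * n%:R / e by rewrite divr_ge0// ltW.
  by apply: lt_le_trans (archi_boundP e2) _; rewrite /N ler_nat.
clearbody N.
(* A grid of mesh [1 / N] from -1 to 1. It has [2 * N + 1] points because the cells are half-open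
   and the value 1 needs its own. *)
pose a (k : 'I_(N + N).+1) : R := (k%:R - N%:R) / N%:R.
have a1 k : `|a k| <= 1.
  rewrite normrM normfV (ger0_norm (ltW N0)) ler_pdivrMr// mul1r ler_norml.
  have : (k%:R : R) <= (N + N)%:R by rewrite ler_nat -ltnS.
  by rewrite natrD; have : 0 <= (k%:R : R) by []; lra.
pose V (k : 'I_(N + N).+1) := [set y : R | a k <= y < a k + N%:R^-1].
pose U i k := f i @^-1` V k.
have mU i k : measurable (U i k).
  rewrite -[U i k]setTI; apply: mf => //.
  have -> : V k = `[a k, a k + N%:R^-1[%classic.
    by apply/seteqP; split => y; rewrite /V /= in_itv.
  exact: measurable_itv.
pose g i x := \sum_k a k * \1_(U i k) x.
have gE i x : exists2 k0, g i x = a k0 & a k0 <= f i x < a k0 + N%:R^-1.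
  have y1 : 0 <= (f i x + 1) * N%:R.
    by rewrite mulr_ge0 ?(ltW N0)//; have := f1 i x; rewrite ler_norml; lra.
  have /andP[l1 l2] := truncn_itv y1; set k0 := Num.trunc _ in l1 l2.
  have k0N : (k0 < (N + N).+1)%N.
    rewrite ltnS -(ler_nat R); apply: le_trans l1 _.
    rewrite (_ : (N + N)%:R = 2 * N%:R); last by rewrite natrD; ring.
    by apply: ler_wpM2r; [exact: ltW|have := f1 i x; rewrite ler_norml; lra].
  have key (k : 'I_(N + N).+1) : (a k <= f i x < a k + N%:R^-1) = (k == Ordinal k0N).
    rewrite -val_eqE /= (_ : a k + N%:R^-1 = (k.+1%:R - N%:R) / N%:R); last first.
      by rewrite /a -natr1; field; rewrite gt_eqF.
    rewrite /a ler_pdivrMr// ltr_pdivlMr//.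
    have -> : (k%:R - N%:R <= f i x * N%:R) = (k%:R <= (f i x + 1) * N%:R) by apply/idP/idP; lra.
    have -> : (f i x * N%:R < k.+1%:R - N%:R) = ((f i x + 1) * N%:R < k.+1%:R) by apply/idP/idP; lra.
    apply/andP/eqP => [[k1 k2]|->//].
    have : (k0 < k.+1)%N by rewrite -(ltr_nat R); exact: le_lt_trans l1 k2.
    have : (k < k0.+1)%N by rewrite -(ltr_nat R); exact: le_lt_trans k1 l2.
    lia.
  exists (Ordinal k0N); last by rewrite key eqxx.
  rewrite /g (bigD1 (Ordinal k0N))//= big1 ?addr0.
    by rewrite indicE mem_set ?mulr1// /U /V /= key eqxx.
  by move=> k /negPf kk; rewrite indicE memNset ?mulr0// /U /V /= key kk.
have g1 : forall i x, `|g i x| <= 1.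
  by move=> j x; have [k -> _] := gE j x.
have fg : forall i x, `|f i x - g i x| <= N%:R^-1.
  move=> i x; have [k -> /andP[k1 k2]] := gE i x; rewrite ger0_norm; last lra.
  by rewrite lerBlDl ltW.
have bind i k : bmeas (fun w => \1_(U i k) (X i w)).
  split; first exact: (measurableT_comp (measurable_indic (mU i k)) (mX i)).
  by exists 1 => w; rewrite indicE; case: (_ \in _); rewrite ?normr1 ?normr0.
have bg i : bmeas (fun w => g i (X i w)).
  by apply: bmeas_sum => k; apply: bmeasM; [exact: bmeas_cst|exact: bind].
have ExU i k : Ex (fun w => \1_(U i k) (X i w)) = fine (P [set w | U i k (X i w)]).
  have mA : measurable [set w | U i k (X i w)].
    by rewrite -[X in measurable X]setTI; apply: mX.
  rewrite -Ex_indic//; congr Ex; apply/funext => w; rewrite !indicE.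
have gprod : Ex (fun w => \prod_i g i (X i w)) = \prod_i Ex (fun w => g i (X i w)).
  transitivity (\sum_(K : {ffun 'I_n -> 'I_(N + N).+1}) \prod_i a (K i) *
     \prod_i fine (P [set w | U i (K i) (X i w)])).
    have -> : (fun w => \prod_i g i (X i w)) = (fun w => \sum_(K : {ffun 'I_n -> 'I_(N + N).+1})
        \prod_i a (K i) * \prod_i \1_(U i (K i)) (X i w)).
      by apply/funext => w; rewrite /g bigA_distr_bigA; apply: eq_bigr => K _; rewrite -big_split.
    rewrite Ex_sum => [|K]; last first.
      by apply: bmeasM; [exact: bmeas_cst|apply: bmeas_prod => i; exact: bind].
    apply: eq_bigr => K _; rewrite ExZ; last by apply: bmeas_prod => i; exact: bind.
    congr (_ * _).
    pose J : {set 'I_n} := [set: 'I_n]%SET.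
    have inJ i : i \in J by exact: finset.in_setT.
    pose E := [set w | forall i, i \in J -> U i (K i) (X i w)].
    have EE : E = \bigcap_(i in [set: 'I_n]) [set w | U i (K i) (X i w)].
      by apply/seteqP; split => w /= H i ?; apply: H.
    have mE : measurable E.
      rewrite EE; apply: fin_bigcap_measurable => [|i _]; first exact: finite_finset.
      by rewrite -[X in measurable X]setTI; apply: mX.
    have -> : (fun w => \prod_i \1_(U i (K i)) (X i w)) = \1_E :> (T -> R).
      apply/funext => w; rewrite [RHS]indicE; have [wE|wE] := boolP (w \in E).
        rewrite big1// => i _; rewrite indicE mem_set//.
        by move: wE => /set_mem/(_ i); apply.
      have [i Hi] : exists i, ~ U i (K i) (X i w).
        apply/existsNP => H; move: wE; rewrite notin_setE; apply => i _; exact: H.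
      by rewrite (bigD1 i)//= indicE memNset// mul0r.
    rewrite Ex_indic//; have := indX J (fun i => U i (K i)) (fun i => mU i (K i)).
    rewrite -/E => ->; rewrite (@eq_bigl _ _ _ _ _ (fun i => i \in J) xpredT _ inJ).
    rewrite (eq_bigr (fun i => (fine (P [set w | U i (K i) (X i w)]))%:E)); last first.
      move=> i _; rewrite fineK//; apply: fin_num_measure.
      by rewrite -[X in measurable X]setTI; apply: mX.
    by rewrite prodEFin.
  transitivity (\prod_i \sum_k a k * fine (P [set w | U i k (X i w)])).
    by rewrite [RHS]bigA_distr_bigA; apply: eq_bigr => K _; rewrite -big_split.
  apply: eq_bigr => i _; rewrite Ex_sum => [|k]; last first.
    by apply: bmeasM; [exact: bmeas_cst|exact: bind].
  by apply: eq_bigr => k _; rewrite ExZ// ExU.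
have H1 : `|Ex (fun w => \prod_i f i (X i w)) - Ex (fun w => \prod_i g i (X i w))| <= n%:R / N%:R.
  apply: Ex_dist_le; try by apply: bmeas_prod.
  move=> w; apply: le_trans (norm_prod_sub_le _ _ _) _ => //.
  apply: (@le_trans _ _ (\sum_(i < n) N%:R^-1)); first by apply: ler_sum => i _; exact: fg.
  by rewrite sumr_const card_ord mulr_natl.
have H2 : `|\prod_i Ex (fun w => f i (X i w)) - \prod_i Ex (fun w => g i (X i w))| <= n%:R / N%:R.
  apply: le_trans (norm_prod_sub_le _ _ _) _ => [i|i|].
  - by apply: Ex_norm_le => // w; exact: f1.
  - by apply: Ex_norm_le => // w; exact: g1.
  apply: (@le_trans _ _ (\sum_(i < n) N%:R^-1)).
    by apply: ler_sum => i _; apply: Ex_dist_le => // w; exact: fg.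
  by rewrite sumr_const card_ord mulr_natl.
rewrite gprod in H1.
set p := \prod_i Ex (fun w => g i (X i w)) in H1 H2.
rewrite (_ : _ - _ = (Ex (fun w => \prod_i f i (X i w)) - p)
   - (\prod_i Ex (fun w => f i (X i w)) - p)); last by ring.
apply: le_trans (ler_normB _ _) _; apply: le_trans (lerD H1 H2) _.
by apply: le_trans nN; rewrite -mulrDl -mulr2n mulr_natl.
Qed.

End expectation.

(** * Taylor bounds for circular and hyperbolic functions *)

Section taylor_bounds.
Context {R : realType}.
Implicit Types (f g : R -> R) (x y C a : R) (n : nat).

(** One use of the mean value theorem raises the order of vanishing at 0 by one. The case [a = 0]
    serves [sin] and [cos]; the exponential factor admits [expR], [ch] and [sh]. *)
Lemma norm_le_of_derive f g C a n : 0 <= C -> 0 <= a ->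
  (forall x, is_derive x 1 f (g x)) -> f 0 = 0 ->
  (forall x, `|g x| <= C * `|x| ^+ n * expR (a * `|x|)) ->
  forall x, `|f x| <= C * `|x| ^+ n.+1 * expR (a * `|x|).
Proof.
move=> C0 a0 fg f0 gC x.
have cf : continuous f.
  by move=> y; apply/differentiable_continuous/derivable1_diffP; case: (fg y).
have key c : `|c| <= `|x| -> `|g c * x| <= C * `|x| ^+ n.+1 * expR (a * `|x|).
  move=> cx; rewrite normrM exprS (mulrCA C) -mulrA mulrC; apply: ler_wpM2l => //.
  apply: le_trans (gC c) _; apply: ler_pM.
  - by rewrite mulr_ge0// exprn_ge0.
  - exact: expR_ge0.
  - by apply: ler_wpM2l => //; rewrite lerXn2r// nnegrE.
  - by rewrite ler_expR ler_wpM2l.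
have [x0|x0|->] := ltgtP x 0.
- have [c + E] := MVT x0 (fun y _ => fg y) (continuous_subspaceT cf).
  rewrite in_itv/= => /andP[xc c0].
  have -> : f x = g c * x by move: E; rewrite f0 !sub0r mulrN => /oppr_inj.
  by apply: key; rewrite !ltr0_norm// lerN2 ltW.
- have [c + E] := MVT x0 (fun y _ => fg y) (continuous_subspaceT cf).
  rewrite in_itv/= => /andP[c0 cx].
  have -> : f x = g c * x by move: E; rewrite f0 !subr0.
  by apply: key; rewrite !gtr0_norm// ltW.
- by rewrite f0 normr0 expr0n/= mulr0 mul0r.
Qed.

Definition ch x : R := (expR x + expR (- x)) / 2.
Definition sh x : R := (expR x - expR (- x)) / 2.

Lemma is_derive_expRN x : is_derive x 1 (fun x : R => expR (- x)) (- expR (- x)).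
Proof.
have H : is_derive x 1 (-%R : R -> R) (-1) by exact: is_deriveN.
have := is_derive1_comp (is_derive_expR (- x)) H.
by rewrite mulrN1.
Qed.

Lemma is_derive_ch x : is_derive x 1 ch (sh x).
Proof.
have H := is_derive_expRN x; rewrite /ch /sh.
have : is_derive x 1 (fun x : R => 2^-1 *: (expR x + expR (- x))) (2^-1 *: (expR x + - expR (- x))).
  exact: is_deriveZ.
rewrite /GRing.scale/= mulrC; congr is_derive.
by apply/funext => y; rewrite mulrC.
Qed.

Lemma is_derive_sh x : is_derive x 1 sh (ch x).
Proof.
have H := is_derive_expRN x; rewrite /ch /sh.
have : is_derive x 1 (fun x : R => 2^-1 *: (expR x - expR (- x))) (2^-1 *: (expR x - - expR (- x))).
  exact: is_deriveZ.
rewrite /GRing.scale/= mulrC opprK; congr is_derive.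
by apply/funext => y; rewrite mulrC.
Qed.

Lemma ch_le x : ch x <= expR `|x|.
Proof.
have : expR x <= expR `|x| by rewrite ler_expR ler_norm.
have : expR (- x) <= expR `|x| by rewrite ler_expR -normrN ler_norm.
by rewrite /ch; lra.
Qed.

Lemma ch_ge0 x : 0 <= ch x.
Proof. by rewrite /ch divr_ge0// addr_ge0// expR_ge0. Qed.

(** Successive derivatives of [cos + ch - 2] are [sh - sin], [ch - cos], [sh + sin] and [ch + cos],
    all but the last vanishing at 0. Circular functions are thus reduced to hyperbolic ones, whose
    Gaussian means follow from the moment generating function. *)
Lemma sin_sh_cos_ch_bound x :
  `|sin x - sh x| <= 2 * `|x| ^+ 3 * expR `|x| /\
  `|cos x + ch x - 2| <= 2 * `|x| ^+ 4 * expR `|x|.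
Proof.
have B4 y : `|cos y + ch y| <= 2 * `|y| ^+ 0 * expR (1 * `|y|).
  rewrite expr0 mulr1 mul1r; apply: le_trans (ler_normD _ _) _.
  rewrite (ger0_norm (ch_ge0 y)) mulr_natl mulr2n; apply: lerD (ch_le y).
  by apply: le_trans (cos_max y) _; rewrite -[leLHS]expR0 ler_expR.
have B3 := @norm_le_of_derive (fun y => sin y + sh y) _ 2 1 0 _ _ _ _ B4.
have {}B3 y : `|sin y + sh y| <= 2 * `|y| ^+ 1 * expR (1 * `|y|).
  apply: B3 => // [z|]; last by rewrite sin0 /sh oppr0 subrr mul0r addr0.
  by have := is_derive_sh z => H; apply: is_deriveD.
have B2 y : `|ch y - cos y| <= 2 * `|y| ^+ 2 * expR (1 * `|y|).
  apply: (@norm_le_of_derive (fun y => ch y - cos y) (fun y => sin y + sh y)) => // [z|].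
    have H := is_derive_ch z; have : is_derive z 1 (fun y => ch y - cos y) (sh z - - sin z) by exact: is_deriveB.
    by rewrite opprK addrC.
  by rewrite cos0 /ch oppr0 expR0; lra.
have B1 y : `|sin y - sh y| <= 2 * `|y| ^+ 3 * expR (1 * `|y|).
  rewrite distrC; apply: (@norm_le_of_derive (fun y => sh y - sin y) (fun y => ch y - cos y)) => // [z|].
    by have H := is_derive_sh z; exact: is_deriveB.
  by rewrite sin0 /sh !oppr0 subrr mul0r addr0.
have B0 y : `|cos y + ch y - 2| <= 2 * `|y| ^+ 4 * expR (1 * `|y|).
  apply: (@norm_le_of_derive (fun y => cos y + ch y - 2) (fun y => - (sin y - sh y))) => // [z||z].
  - have H := is_derive_ch z.
    have : is_derive z 1 (fun y => cos y + ch y - 2) (- sin z + sh z - 0) by apply: is_deriveB; exact: is_deriveD.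
    by rewrite subr0 opprB addrC.
  - by rewrite cos0 /ch oppr0 expR0; lra.
  - by rewrite normrN.
by have := B1 x; have := B0 x; rewrite mul1r.
Qed.

Lemma sin_cos_bound x : `|sin x - x| <= `|x| ^+ 3 /\ `|cos x - 1 + x ^+ 2 / 2| <= `|x| ^+ 4.
Proof.
pose bd f n := forall y, `|f y| <= 1 * `|y| ^+ n * expR (0 * `|y|).
have B0 : bd (@cos R) 0%N by move=> y; rewrite expr0 mul0r expR0 !mulr1 cos_max.
have B1 : bd (@sin R) 1%N.
  by apply: (norm_le_of_derive ler01 _ _ _ B0) => //; exact: sin0.
have B2 : bd (fun y => 1 - cos y) 2%N.
  apply: (norm_le_of_derive ler01 _ _ _ B1) => // [y|]; last by rewrite cos0 subrr.
  have : is_derive y 1 (fun y : R => 1 - cos y) (0 - - sin y) by exact: is_deriveB.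
  by rewrite sub0r opprK.
have B3 : bd (fun y => y - sin y) 3%N.
  by apply: (norm_le_of_derive ler01 _ _ _ B2) => //; rewrite sin0 subrr.
have B4 : bd (fun y => cos y - 1 + y ^+ 2 / 2) 4%N.
  apply: (norm_le_of_derive ler01 _ _ _ B3) => // [y|]; last by rewrite cos0 subrr expr0n/= mul0r addr0.
  have H : is_derive y 1 (fun y : R => y ^+ 2 / 2) y.
    have Hid : is_derive y 1 (fun y : R => y) 1 by exact: is_derive_id.
    have : is_derive y 1 (fun y : R => 2^-1 *: (y * y)) (2^-1 *: (y *: 1 + y *: 1)).
      by apply: is_deriveZ; exact: (is_deriveM Hid Hid).
    congr is_derive; last by rewrite /GRing.scale/=; lra.
    by apply/funext => z; rewrite /GRing.scale/= mulrC expr2.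
  have : is_derive y 1 (fun y : R => cos y - 1 + y ^+ 2 / 2) (- sin y - 0 + y).
    by apply: is_deriveD; exact: is_deriveB.
  by rewrite subr0 addrC.
have := B3 x; have := B4 x; rewrite !mul1r mul0r expR0 !mulr1 => H1 H2.
by split=> //; rewrite distrC.
Qed.

Lemma expR_bound x : `|expR x - 1 - x| <= x ^+ 2 * expR `|x|.
Proof.
have B0 y : `|expR y| <= 1 * `|y| ^+ 0 * expR (1 * `|y|).
  by rewrite expr0 mulr1 !mul1r (ger0_norm (expR_ge0 _)) ler_expR ler_norm.
have B1 y : `|expR y - 1| <= 1 * `|y| ^+ 1 * expR (1 * `|y|).
  apply: (@norm_le_of_derive (fun y => expR y - 1) expR 1 1 0) => // [z|]; last by rewrite expR0 subrr.
  by rewrite -[X in is_derive _ _ _ X]subr0; exact: is_deriveB.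
have B2 y : `|expR y - 1 - y| <= 1 * `|y| ^+ 2 * expR (1 * `|y|).
  apply: (@norm_le_of_derive (fun y => expR y - 1 - y) (fun y => expR y - 1) 1 1 1) => // [z|].
    apply: is_deriveB; rewrite -[X in is_derive _ _ _ X]subr0; exact: is_deriveB.
  by rewrite expR0 subrr subr0.
by have := B2 x; rewrite !mul1r real_normK// num_real.
Qed.

Lemma expR_norm_le x : expR `|x| <= expR x + expR (- x).
Proof.
have [x0|x0] := ger0P x; first by rewrite lerDl expR_ge0.
by rewrite lerDr expR_ge0.
Qed.

End taylor_bounds.

Lemma measurable_fun_sin {R : realType} d (T : measurableType d) (f : T -> R) :
  measurable_fun setT f -> measurable_fun setT (fun w => sin (f w)).
Proof.
have H : measurable_fun setT (@sin R) by apply: continuous_measurable_fun; exact: continuous_sin.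
by move=> mf; exact: (measurableT_comp H mf).
Qed.

Lemma measurable_fun_cos {R : realType} d (T : measurableType d) (f : T -> R) :
  measurable_fun setT f -> measurable_fun setT (fun w => cos (f w)).
Proof.
have H : measurable_fun setT (@cos R) by apply: continuous_measurable_fun; exact: continuous_cos.
by move=> mf; exact: (measurableT_comp H mf).
Qed.

(** * Gaussian characteristic function from the moment generating function *)

Section gaussian.
Context {R : realType}.
Local Notation leb := (@lebesgue_measure R).

Lemma ge0_integral_normal_prob (m s : R) (f : R -> \bar R) : s != 0 ->
  (forall x, (0 <= f x)%E) -> measurable_fun setT f ->
  (\int[normal_prob m s]_x f x = \int[leb]_x (f x * (normal_pdf m s x)%:E))%E.
Proof.
move=> s0 f0 mf.
have dom := normal_prob_dominates m s.
have fint := Radon_Nikodym_SigmaFinite.f_integrable dom.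
have mpdf : measurable_fun setT (fun x => (normal_pdf m s x)%:E).
  by apply/measurable_EFinP; exact: measurable_normal_pdf.
have fE : ae_eq leb setT (Radon_Nikodym_SigmaFinite.f (normal_prob m s) leb)
    (fun x => (normal_pdf m s x)%:E).
  apply: integral_ae_eq => // E _ mE.
  by rewrite -Radon_Nikodym_SigmaFinite.f_integral.
rewrite -(Radon_Nikodym_SigmaFinite.change_of_variables dom)//.
apply: ge0_ae_eq_integral => //.
- by apply: emeasurable_funM => //; exact: measurable_int fint.
- exact: emeasurable_funM.
- by move=> x _; rewrite mule_ge0// Radon_Nikodym_SigmaFinite.f_ge0.
- by move=> x _; rewrite mule_ge0// lee_fin normal_pdf_ge0.
- exact: ae_eqe_mul2l.
Qed.

(** Completing the square moves the mean of the density from 0 to [u * s ^+ 2]. *)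
Lemma integral_expR_normal_prob (s u : R) : 0 < s ->
  (\int[normal_prob 0 s]_x (expR (u * x))%:E = (expR (u ^+ 2 * s ^+ 2 / 2))%:E)%E.
Proof.
move=> s0; have sn0 : s != 0 by rewrite gt_eqF.
have mexp : measurable_fun setT (fun x : R => expR (u * x)).
  by apply: measurableT_comp => //; exact: measurable_funM.
rewrite ge0_integral_normal_prob//; last exact/measurable_EFinP.
transitivity (\int[leb]_x ((expR (u ^+ 2 * s ^+ 2 / 2))%:E * (normal_pdf (u * s ^+ 2) s x)%:E))%E.
  apply: eq_integral => x _; rewrite !normal_pdfE// -!EFinM; congr EFin.
  rewrite mulrCA [RHS]mulrCA /normal_fun -!expRD; congr (_ * expR _).
  by field.
rewrite ge0_integralZl//=.
- by rewrite integral_normal_pdf mule1.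
- by apply/measurable_EFinP; exact: measurable_normal_pdf.
- by move=> x _; rewrite lee_fin normal_pdf_ge0.
Qed.

Context {d : measure_display} {T : measurableType d} (P : probability T R).
Context (xi : T -> R) (s : R).
Hypotheses (mxi : measurable_fun setT xi) (s0 : 0 < s)
  (law : forall U : set R, measurable U -> P [set w | U (xi w)] = normal_prob 0 s U).
Local Notation I := (fun X : T -> R => Rintegral P setT X).

Lemma gaussian_mgf (u : R) : (\int[P]_w (expR (u * xi w))%:E = (expR (u ^+ 2 * s ^+ 2 / 2))%:E)%E.
Proof.
rewrite -integral_expR_normal_prob//.
(* [normal_prob] lives on [measurableTypeR R], whose display is not that of [R]. *)
have mxi' : measurable_fun setT (xi : T -> measurableTypeR R) by exact: mxi.
pose X : {mfun T >-> measurableTypeR R} := HB.pack (xi : T -> measurableTypeR R)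
  (isMeasurableFun.Build _ _ T (measurableTypeR R) _ mxi').
transitivity (\int[distribution P X]_x (expR (u * x))%:E)%E; last first.
  apply: eq_measure_integral => U mU _.
  by rewrite /distribution /pushforward /= -law.
rewrite ge0_integral_distribution//.
apply/measurable_EFinP; apply: measurableT_comp => //; exact: measurable_funM.
Qed.

Lemma gaussian_exp_integrable (u : R) : P.-integrable setT (EFin \o (fun w => expR (u * xi w))).
Proof.
apply/integrableP; split.
  by apply/measurable_EFinP; apply: measurableT_comp => //; exact: measurable_funM.
under eq_integral do rewrite /= ger0_norm ?expR_ge0//.
by rewrite gaussian_mgf ltry.
Qed.

Lemma gaussian_mgf_Rintegral (u : R) : I (fun w => expR (u * xi w)) = expR (u ^+ 2 * s ^+ 2 / 2).
Proof. by rewrite /Rintegral gaussian_mgf. Qed.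

(** A single integrable envelope for all error terms: it dominates the square of [exp (|xi| / s)],
    one factor of which bounds a power of [xi] and the other an exponential. *)
Definition gaussian_env (w : T) : R := expR (2 / s * xi w) + expR (- (2 / s) * xi w).

Lemma gaussian_env_integrable : P.-integrable setT (EFin \o gaussian_env).
Proof.
exact: (integrableD measurableT (gaussian_exp_integrable (2 / s)) (gaussian_exp_integrable (- (2 / s)))).
Qed.

Lemma gaussian_env_Rintegral : I gaussian_env = 2 * expR 2.
Proof.
rewrite /gaussian_env RintegralD//; try exact: gaussian_exp_integrable.
rewrite !gaussian_mgf_Rintegral sqrrN (_ : (2 / s) ^+ 2 * s ^+ 2 / 2 = 2); last first.
  by field; rewrite gt_eqF.
by rewrite mulr_natl mulr2n.
Qed.

Lemma gaussian_dominated (X : T -> R) (K : R) : measurable_fun setT X -> 0 <= K ->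
  (forall w, `|X w| <= K * gaussian_env w) ->
  P.-integrable setT (EFin \o X) /\ `|I X| <= K * (2 * expR 2).
Proof.
move=> mX K0 XK.
have iK : P.-integrable setT (EFin \o (fun w => K * gaussian_env w)).
  have := integrableZl measurableT K gaussian_env_integrable.
  by congr (_.-integrable); apply/funext => w; rewrite /= EFinM.
have iX : P.-integrable setT (EFin \o X).
  apply: (le_integrable measurableT _ _ iK); first exact/measurable_EFinP.
  move=> w _ /=; rewrite lee_fin; apply: le_trans (XK w) _; exact: ler_norm.
split=> //; apply: le_trans (le_normr_Rintegral measurableT iX) _.
rewrite -gaussian_env_Rintegral -RintegralZl//; last exact: gaussian_env_integrable.
apply: le_Rintegral => //.
by have := integrable_abse iX; congr (_.-integrable).
Qed.

Lemma gaussian_envE (k : nat) (c : R) w : `|c * s| <= 1 ->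
  `|c * xi w| ^+ k * expR `|c * xi w| <= k`!%:R * `|c * s| ^+ k * gaussian_env w.
Proof.
move=> cs; set y := `|xi w| / s; have y0 : 0 <= y by rewrite divr_ge0// ltW.
have cE : `|c * xi w| = `|c * s| * y.
  by rewrite /y !normrM (gtr0_norm s0); field; rewrite gt_eqF.
have H1 : y ^+ k <= k`!%:R * expR y.
  case: k => [|k].
    by rewrite expr0 fact0 mul1r -expR0 ler_expR.
  rewrite [leRHS]mulrC -ler_pdivrMr ?ltr0n ?fact_gt0//.
  by apply: le_trans (expR_ge1Dxn k y0); rewrite lerDr.
have H2 : expR `|c * xi w| <= expR y.
  by rewrite ler_expR cE ler_piMl.
have H3 : expR y * expR y <= gaussian_env w.
  rewrite -expRD; apply: le_trans (_ : expR `|2 / s * xi w| <= _).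
    by rewrite ler_expR !normrM normfV (gtr0_norm s0) ger0_norm// /y; lra.
  by rewrite /gaussian_env mulNr; exact: expR_norm_le.
rewrite {1}cE exprMn [leRHS](_ : _ = `|c * s| ^+ k * (k`!%:R * gaussian_env w)); last by ring.
rewrite -mulrA; apply: ler_wpM2l; first exact: exprn_ge0.
apply: (@le_trans _ _ (k`!%:R * expR y * expR y)).
  by apply: ler_pM => //; rewrite ?exprn_ge0 ?expR_ge0.
by rewrite -mulrA ler_wpM2l.
Qed.

(** The mean of [ch] is [expR (v ^+ 2 / 2)] and that of [sh] is 0, so [cos] and [sin] are replaced
    by [2 - ch] and [sh] at the cost of the Taylor errors. *)
Lemma gaussian_cf (c : R) : `|c * s| <= 1 ->
  `|Ex P (fun w => cos (c * xi w)) - (1 - (c * s) ^+ 2 / 2)| <= 100 * expR 2 * `|c * s| ^+ 3 /\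
  `|Ex P (fun w => sin (c * xi w))| <= 100 * expR 2 * `|c * s| ^+ 3.
Proof.
move=> v1; set v := c * s in v1 *.
have e0 : 0 <= expR 2 :> R by exact: expR_ge0.
have mc : measurable_fun setT (fun w => c * xi w) by exact: measurable_funM.
have ic := gaussian_exp_integrable c; have iN := gaussian_exp_integrable (- c).
have msin : measurable_fun setT (fun w => sin (c * xi w)).
  exact: measurable_fun_sin.
have mcos : measurable_fun setT (fun w => cos (c * xi w)).
  exact: measurable_fun_cos.
have ich : P.-integrable setT (EFin \o (fun w => 2^-1 * (expR (c * xi w) + expR (- c * xi w)))).
  have := integrableZl measurableT 2^-1 (integrableD measurableT ic iN).
  by congr (_.-integrable); apply/funext => w; rewrite /= EFinM EFinD.
have ish : P.-integrable setT (EFin \o (fun w => 2^-1 * (expR (c * xi w) - expR (- c * xi w)))).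
  have := integrableZl measurableT 2^-1 (integrableB measurableT ic iN).
  by congr (_.-integrable); apply/funext => w; rewrite /= EFinM EFinB.
have chE w : ch (c * xi w) = 2^-1 * (expR (c * xi w) + expR (- c * xi w)).
  by rewrite /ch mulrC mulNr.
have shE w : sh (c * xi w) = 2^-1 * (expR (c * xi w) - expR (- c * xi w)).
  by rewrite /sh mulrC mulNr.
have Ech : I (fun w => 2^-1 * (expR (c * xi w) + expR (- c * xi w))) = expR (v ^+ 2 / 2).
  rewrite RintegralZl//; last exact: (integrableD measurableT ic iN).
  by rewrite RintegralD// !gaussian_mgf_Rintegral sqrrN /v exprMn; lra.
have Esh : I (fun w => 2^-1 * (expR (c * xi w) - expR (- c * xi w))) = 0.
  rewrite RintegralZl//; last exact: (integrableB measurableT ic iN).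
  by rewrite RintegralB// !gaussian_mgf_Rintegral sqrrN; lra.
have mch : measurable_fun setT (fun w => 2^-1 * (expR (c * xi w) + expR (- c * xi w))).
  by case/integrableP : ich => /measurable_EFinP.
have msh : measurable_fun setT (fun w => 2^-1 * (expR (c * xi w) - expR (- c * xi w))).
  by case/integrableP : ish => /measurable_EFinP.
have i2 : P.-integrable setT (EFin \o (cst 2 : T -> R)) by exact/bmeas_integrable/bmeas_cst.
have v34 : `|v| ^+ 4 <= `|v| ^+ 3 by rewrite exprS ler_piMl// exprn_ge0.
have v30 : 0 <= `|v| ^+ 3 by exact: exprn_ge0.
have env k w := gaussian_envE k w v1.
split.
- pose err w := cos (c * xi w) + ch (c * xi w) - 2.
  (* Here 48 is 2 times [4!]; with the mean [2 * expR 2] of the envelope it makes 96, and the rest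
     of 100 covers the expansion of [expR (v ^+ 2 / 2)]. *)
  have [ierr Herr] : P.-integrable setT (EFin \o err) /\ `|I err| <= 48 * `|v| ^+ 4 * (2 * expR 2).
    apply: gaussian_dominated.
    - apply: measurable_funB => //; apply: measurable_funD => //.
      by rewrite (_ : (fun w => ch _) = (fun w => 2^-1 * (expR (c * xi w) + expR (- c * xi w)))); [|apply/funext => w].
    - by rewrite mulr_ge0// exprn_ge0.
    move=> w; have [_ H] := sin_sh_cos_ch_bound (c * xi w); apply: le_trans H _.
    by have := env 4%N w; rewrite (_ : 4`! = 24)// -mulrA; lra.
  have -> : Ex P (fun w => cos (c * xi w)) = I err + 2 - expR (v ^+ 2 / 2).
    rewrite -Ech -[X in _ + X - _](Ex_cst P 2) /Ex -RintegralD// -RintegralB//.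
      by apply: eq_Rintegral => w _; rewrite /err chE /=; ring.
    exact: (integrableD measurableT ierr i2).
  have vv : v ^+ 2 = `|v| ^+ 2 by rewrite real_normK// num_real.
  have w1 : `|v ^+ 2 / 2| <= 1.
    rewrite normrM normfV (ger0_norm (_ : 0 <= 2))// ger0_norm ?sqr_ge0// vv.
    have : `|v| ^+ 2 <= 1 by exact: exprn_ile1.
    lra.
  have H2 := expR_bound (v ^+ 2 / 2).
  have H3 : expR `|v ^+ 2 / 2| <= expR 2 by rewrite ler_expR; apply: le_trans w1 _; rewrite ler1n.
  have H4 : (v ^+ 2 / 2) ^+ 2 * expR `|v ^+ 2 / 2| <= `|v| ^+ 4 / 4 * expR 2.
    apply: ler_pM => //; rewrite ?sqr_ge0 ?expR_ge0// expr_div_n vv -exprM; lra.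
  have H5 : `|v| ^+ 4 * expR 2 <= `|v| ^+ 3 * expR 2 by rewrite ler_wpM2r.
  rewrite (_ : _ - _ = I err - (expR (v ^+ 2 / 2) - 1 - v ^+ 2 / 2)); last by ring.
  have H6 : 0 <= `|v| ^+ 3 * expR 2 by rewrite mulr_ge0.
  by apply: le_trans (ler_normB _ _) _; lra.
- pose err w := sin (c * xi w) - sh (c * xi w).
  have [ierr Herr] : P.-integrable setT (EFin \o err) /\ `|I err| <= 12 * `|v| ^+ 3 * (2 * expR 2).
    apply: gaussian_dominated.
    - apply: measurable_funB => //.
      by rewrite (_ : (fun w => sh _) = (fun w => 2^-1 * (expR (c * xi w) - expR (- c * xi w)))); [|apply/funext => w].
    - by rewrite mulr_ge0.
    move=> w; have [H _] := sin_sh_cos_ch_bound (c * xi w); apply: le_trans H _.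
    by have := env 3%N w; rewrite (_ : 3`! = 6)// -mulrA; lra.
  have -> : Ex P (fun w => sin (c * xi w)) = I err.
    rewrite -[RHS]addr0 -Esh /Ex -RintegralD//.
    by apply: eq_Rintegral => w _; rewrite /err shE /=; ring.
  have : 0 <= `|v| ^+ 3 * expR 2 by rewrite mulr_ge0.
  lra.
Qed.

Lemma gaussian_abs_le (X : T -> R) (K : R) : bmeas X -> 0 <= K ->
  (forall w, `|X w| <= K * `|xi w|) -> `|Ex P X| <= 2 * K * s * expR 2.
Proof.
move=> [mX _] K0 XK.
have [|w|_ H] := @gaussian_dominated X (K * s) mX; first by rewrite mulr_ge0// ltW.
  apply: le_trans (XK w) _; rewrite -mulrA ler_wpM2l//.
  have s1 : `|s^-1 * s| <= 1 by rewrite mulVf ?normr1// gt_eqF.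
  have E := gaussian_envE 1 w s1.
  rewrite !expr1 mulVf ?gt_eqF// normr1 (_ : 1`! = 1)%N// !mul1r in E.
  rewrite -ler_pdivrMl//; apply: le_trans E.
  rewrite normrM normfV (gtr0_norm s0) ler_peMr ?mulr_ge0 ?invr_ge0 ?(ltW s0)//.
  by rewrite -expR0 ler_expR mulr_ge0// invr_ge0 ltW.
by apply: le_trans H _; lra.
Qed.

End gaussian.

(** * Products of characteristic functions *)

Section characteristic_product.
Context {R : realType}.
Implicit Types (x y : R * R) (n l : nat).

(* Pairs stand for complex numbers: (E cos X, E sin X) is the characteristic
   function of X. *)
Definition cmul x y : R * R := (x.1 * y.1 - x.2 * y.2, x.1 * y.2 + x.2 * y.1).
Fixpoint cprod (w : nat -> R * R) n := if n is n'.+1 then cmul (cprod w n') (w n') else (1, 0).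
(** Real and imaginary parts are bounded separately, since the products in question are means of
    cosines and sines. *)
Definition unit_box x := `|x.1| <= 1 /\ `|x.2| <= 1.
Definition cdist x y := `|x.1 - y.1| + `|x.2 - y.2|.

Lemma cmulA : associative cmul.
Proof. by move=> [a b] [c d] [e f]; rewrite /cmul /=; congr pair; ring. Qed.

Lemma cmul1 x : cmul x (1, 0) = x.
Proof. by case: x => a b; rewrite /cmul /=; congr pair; ring. Qed.

Lemma cmul1l x : cmul (1, 0) x = x.
Proof. by case: x => a b; rewrite /cmul /=; congr pair; ring. Qed.

Lemma eq_cprod (w w' : nat -> R * R) n : (forall i, (i < n)%N -> w i = w' i) -> cprod w n = cprod w' n.
Proof.
elim: n => //= n IH H; rewrite H// IH// => i ilt; exact/H/ltnW.
Qed.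

(** Represents the product over the indices from [l] on without shifting them. *)
Definition after l (w : nat -> R * R) i := if (i < l)%N then (1, 0) else w i.

Lemma cprod_split (w : nat -> R * R) n l : (l <= n)%N -> cprod w n = cmul (cprod w l) (cprod (after l w) n).
Proof.
elim: n => [|n IH]; first by rewrite leqn0 => /eqP ->; rewrite cmul1.
rewrite leq_eqVlt => /orP[/eqP ->|ln].
  rewrite (@eq_cprod (after _ _) (fun=> (1, 0)) n.+1) => [|i ilt]; last by rewrite /after ilt.
  suff -> m : cprod (fun=> (1, 0)) m = (1, 0) by rewrite cmul1.
  by elim: m => //= m ->; rewrite cmul1.
by rewrite /= IH// (_ : after l w n = w n) -?cmulA// /after ltnNge -ltnS ln.
Qed.

Lemma cprod_after (w : nat -> R * R) n l : (l < n)%N ->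
  cprod (after l w) n = cmul (w l) (cprod (after l.+1 w) n).
Proof.
move=> ln; rewrite (@cprod_split (after l w) n l.+1)//; congr cmul.
  rewrite /= {2}/after ltnn (@eq_cprod _ (fun=> (1, 0))) => [|i ilt]; last by rewrite /after ilt.
  suff -> m : cprod (fun=> (1, 0)) m = (1, 0) by rewrite cmul1l.
  by elim: m => //= m ->; rewrite cmul1.
apply: eq_cprod => i _; rewrite /after ltnS; have [//|li] := leqP i l.
by rewrite ltnNge (ltnW li).
Qed.

(** Lindeberg replacement: [H l] has its first [l] factors from [w] and the others from [w'].
    Multiplying a difference on both sides by elements of the unit box at most multiplies [cdist] by
    4. *)
Lemma cprod_dist (w w' : nat -> R * R) n (e : R) :
  (forall l, (l <= n)%N -> unit_box (cprod w l)) ->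
  (forall l, (l <= n)%N -> unit_box (cprod (after l w') n)) ->
  (forall i, (i < n)%N -> cdist (w i) (w' i) <= e) ->
  cdist (cprod w n) (cprod w' n) <= 4 * e * n%:R.
Proof.
move=> bw bw' ww'; pose H l := cmul (cprod w l) (cprod (after l w') n).
have H0 : H 0%N = cprod w' n by rewrite /H cmul1l; exact: eq_cprod.
have Hn : H n = cprod w n.
  rewrite /H (@eq_cprod (after n w') (fun=> (1, 0))) => [|i ilt]; last by rewrite /after ilt.
  suff -> m : cprod (fun=> (1, 0)) m = (1, 0) by rewrite cmul1.
  by elim: m => //= m ->; rewrite cmul1.
suff main l : (l <= n)%N -> cdist (H l) (H 0%N) <= 4 * e * l%:R by rewrite -Hn -H0; exact: main.
elim: l => [_|l IH ln]; first by rewrite /cdist !subrr normr0 mulr0 addr0.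
have {}IH := IH (ltnW ln).
have : cdist (H l.+1) (H l) <= 4 * e.
  rewrite /H (cprod_after _ ln) /= -cmulA.
  have [] := bw l (ltnW ln); have [] := bw' l.+1 ln; have := ww' l ln.
  move: (cprod w l) (cprod (after l.+1 w') n) (w l) (w' l) => [a b] [c d] [p p'] [r r'].
  rewrite /cdist /cmul /= => E c1 d1 a1 b1.
  set X := p - r in E *; set Y := p' - r' in E *.
  have n2 (x y z : R) : `|x| <= 1 -> `|y| <= 1 -> `|x * y * z| <= `|z|.
    by move=> x1 y1; rewrite !normrM ler_piMl// mulr_ile1.
  have -> : a * (p * c - p' * d) - b * (p * d + p' * c) - (a * (r * c - r' * d) - b * (r * d + r' * c))
    = (a * c * X - b * d * X) - (a * d * Y + b * c * Y) by rewrite /X /Y; ring.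
  have -> : a * (p * d + p' * c) + b * (p * c - p' * d) - (a * (r * d + r' * c) + b * (r * c - r' * d))
    = (a * d * X + b * c * X) + (a * c * Y - b * d * Y) by rewrite /X /Y; ring.
  have h1 := n2 a c X a1 c1; have h2 := n2 b d X b1 d1; have h3 := n2 a d Y a1 d1.
  have h4 := n2 b c Y b1 c1; have h5 := n2 a d X a1 d1; have h6 := n2 b c X b1 c1.
  have h7 := n2 a c Y a1 c1; have h8 := n2 b d Y b1 d1.
  have := ler_normB (a * c * X - b * d * X) (a * d * Y + b * c * Y).
  have := ler_normB (a * c * X) (b * d * X); have := ler_normD (a * d * Y) (b * c * Y).
  have := ler_normD (a * d * X + b * c * X) (a * c * Y - b * d * Y).
  have := ler_normD (a * d * X) (b * c * X); have := ler_normB (a * c * Y) (b * d * Y).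
  lra.
move: IH; rewrite /cdist -natr1 => IH HH.
have := ler_distD (H l).1 (H l.+1).1 (H 0%N).1; have := ler_distD (H l).2 (H l.+1).2 (H 0%N).2.
lra.
Qed.

Definition trig (b : bool) : R -> R := if b then cos else sin.

(* E is abstract so as to cover both the Bernoulli weights and P. *)
Lemma expectation_cos_sum (Om : Type) (E : (Om -> R) -> R) (M : (Om -> R) -> Prop) n
    (th : nat -> Om -> R) :
  (forall X Y, M X -> M Y -> E (fun w => X w + Y w) = E X + E Y) ->
  (forall X Y, M X -> M Y -> E (fun w => X w - Y w) = E X - E Y) ->
  (forall X Y, M X -> M Y -> M (fun w => X w * Y w)) ->
  M (fun=> 1) ->
  (forall b m, M (fun w => trig b (\sum_(i < m) th i w))) ->
  (forall b i, M (fun w => trig b (th i w))) ->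
  (forall b : nat -> bool, E (fun w => \prod_(i < n) trig (b i) (th i w))
     = \prod_(i < n) E (fun w => trig (b i) (th i w))) ->
  let z := cprod (fun i => (E (fun w => cos (th i w)), E (fun w => sin (th i w)))) n in
  E (fun w => cos (\sum_(i < n) th i w)) = z.1 /\
  E (fun w => sin (\sum_(i < n) th i w)) = z.2.
Proof.
move=> ED EB MM M1 Msum Mth prodE z.
pose wt i := (E (fun w => cos (th i w)), E (fun w => sin (th i w))).
have zE : z = cprod wt n by [].
have M0 X : M X -> E (fun w => 0 * X w) = 0.
  move=> MX; rewrite -[RHS](subrr (E X)) -EB//; congr E.
  by apply/funext => w; rewrite mul0r subrr.
have Mprod b m : M (fun w => \prod_(m <= i < n) trig (b i) (th i w)).
  elim: (index_iota m n) => [|i r IH]; first by under eq_fun do rewrite big_nil.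
  by under eq_fun do rewrite big_cons; exact: MM.
(* The remaining factors may be cosines or sines at will, so that after an addition formula both
   terms are instances of the induction hypothesis. *)
have main m : (m <= n)%N -> forall b : nat -> bool,
    E (fun w => cos (\sum_(i < m) th i w) * \prod_(m <= i < n) trig (b i) (th i w))
      = (cprod wt m).1 * \prod_(m <= i < n) E (fun w => trig (b i) (th i w)) /\
    E (fun w => sin (\sum_(i < m) th i w) * \prod_(m <= i < n) trig (b i) (th i w))
      = (cprod wt m).2 * \prod_(m <= i < n) E (fun w => trig (b i) (th i w)).
  elim: m => [_ b|m IH mn b].
    split; under eq_fun do rewrite big_ord0.
      rewrite cos0 /= mul1r big_mkord -prodE; congr E; apply/funext => w.
      by rewrite mul1r big_mkord.
    by rewrite sin0 mul0r M0.
  pose b' c i := if i == m then c else b i.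
  have [C1 S1] := IH (ltnW mn) (b' true); have [C0 S0] := IH (ltnW mn) (b' false).
  have prodS c w : \prod_(m <= i < n) trig (b' c i) (th i w)
     = trig c (th m w) * \prod_(m.+1 <= i < n) trig (b i) (th i w).
    rewrite big_ltn// /b' eqxx; congr (_ * _); apply: eq_big_nat => i /andP[mi _].
    by rewrite gtn_eqF.
  have prodES c : \prod_(m <= i < n) E (fun w => trig (b' c i) (th i w))
     = E (fun w => trig c (th m w)) * \prod_(m.+1 <= i < n) E (fun w => trig (b i) (th i w)).
    rewrite big_ltn// /b' eqxx; congr (_ * _); apply: eq_big_nat => i /andP[mi _].
    by rewrite gtn_eqF.
  rewrite !prodES in C1 S1 C0 S0.
  have MMp c b1 : M (fun w => trig c (\sum_(i < m) th i w) * \prod_(m <= i < n) trig (b' b1 i) (th i w)).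
    exact: MM.
  split.
    transitivity (E (fun w => cos (\sum_(i < m) th i w) * \prod_(m <= i < n) trig (b' true i) (th i w)
       - sin (\sum_(i < m) th i w) * \prod_(m <= i < n) trig (b' false i) (th i w))).
      by congr E; apply/funext => w; rewrite big_ord_recr/= cosD !prodS /trig; ring.
    by rewrite EB ?C1 ?S0; [rewrite /cmul /=; ring|exact: (MMp true)|exact: (MMp false)].
  transitivity (E (fun w => sin (\sum_(i < m) th i w) * \prod_(m <= i < n) trig (b' true i) (th i w)
     + cos (\sum_(i < m) th i w) * \prod_(m <= i < n) trig (b' false i) (th i w))).
    by congr E; apply/funext => w; rewrite big_ord_recr/= sinD !prodS /trig; ring.
  by rewrite ED ?C0 ?S1; [rewrite /cmul /=; ring|exact: (MMp false)|exact: (MMp true)].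
have [Hc Hs] := main n (leqnn n) xpredT.
rewrite big_geq// mulr1 in Hc; rewrite big_geq// mulr1 in Hs.
by rewrite zE -Hc -Hs; split; congr E; apply/funext => w; rewrite big_geq// mulr1.
Qed.

Lemma bernoulli_cos_sum (rho : R) n (th : nat -> bool -> R) :
  let z := cprod (fun i => (rho * cos (th i true) + (1 - rho) * cos (th i false),
                            rho * sin (th i true) + (1 - rho) * sin (th i false))) n in
  \sum_(tau : config n) bernoulli_weight rho tau * cos (\sum_(i < n) th i (tau i)) = z.1 /\
  \sum_(tau : config n) bernoulli_weight rho tau * sin (\sum_(i < n) th i (tau i)) = z.2.
Proof.
pose E (X : config n -> R) := \sum_tau bernoulli_weight rho tau * X tau.
have one i b : (i < n)%N -> E (fun tau => trig b (th i (occ tau i)))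
    = rho * trig b (th i true) + (1 - rho) * trig b (th i false).
  move=> ilt; pose o := Ordinal ilt.
  pose phi (j : 'I_n) c := if j == o then trig b (th i c) else 1.
  transitivity (\sum_tau bernoulli_weight rho tau * \prod_j phi j (tau j)).
    apply: eq_bigr => tau _; congr (_ * _); rewrite (bigD1 o)//= big1 => [|j /negPf jo].
      by rewrite /phi eqxx mulr1 (occ_ord tau o : occ tau i = _).
    by rewrite /phi jo.
  rewrite sum_bernoulli_prod (bigD1 o)//= big1 => [|j /negPf jo].
    by rewrite /phi eqxx mulr1.
  by rewrite /phi jo; ring.
have := @expectation_cos_sum (config n) E (fun=> True) n (fun i tau => th i (occ tau i)).
set z := cprod _ n => H z'.
have zz : z = z'.
  by apply: eq_cprod => i ilt; have := one i true ilt; have := one i false ilt; rewrite /trig => -> ->.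
rewrite -zz; have [] := H.
- by move=> X Y _ _; rewrite /E -big_split; apply: eq_bigr => tau _; rewrite mulrDr.
- by move=> X Y _ _; rewrite /E -sumrB; apply: eq_bigr => tau _; rewrite mulrBr.
- by [].
- by [].
- by [].
- by [].
- move=> b; transitivity (\sum_tau bernoulli_weight rho tau * \prod_(i < n) trig (b i) (th i (tau i))).
    by apply: eq_bigr => tau _; congr (_ * _); apply: eq_bigr => i _; rewrite occ_ord.
  rewrite (sum_bernoulli_prod rho (fun i c => trig (b i) (th i c))).
  by apply: eq_bigr => i _; rewrite one.
move=> Hc Hs.
have thE tau : \sum_(i < n) th i (occ tau i) = \sum_(i < n) th i (tau i).
  by apply: eq_bigr => i _; rewrite occ_ord.
by rewrite -Hc -Hs /E; split; apply: eq_bigr => tau _; rewrite thE.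
Qed.

End characteristic_product.

Lemma measurable_trig {R : realType} d (T : measurableType d) (b : bool) (X : T -> R) :
  measurable_fun setT X -> measurable_fun setT (fun w => trig b (X w)).
Proof. by case: b => mX; [exact: measurable_fun_cos|exact: measurable_fun_sin]. Qed.

Section gaussian_product.
Context {R : realType} {d : measure_display} {T : measurableType d} (P : probability T R).

Lemma trig_max b (x : R) : `|trig b x| <= 1.
Proof. by case: b; [exact: cos_max|exact: sin_max]. Qed.

Lemma bmeas_trig (b : bool) (X : T -> R) :
  measurable_fun setT X -> bmeas (fun w => trig b (X w)).
Proof. by move=> mX; split; [exact: measurable_trig|exists 1 => w; exact: trig_max]. Qed.

Lemma independent_cos_sum n (xi : nat -> T -> R) (c : nat -> R) :
  (forall i, measurable_fun setT (xi i)) ->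
  mutually_independent P (fun i : 'I_n => xi i) ->
  let z := cprod (fun i => (Ex P (fun w => cos (c i * xi i w)), Ex P (fun w => sin (c i * xi i w)))) n in
  Ex P (fun w => cos (\sum_(i < n) c i * xi i w)) = z.1 /\
  Ex P (fun w => sin (\sum_(i < n) c i * xi i w)) = z.2.
Proof.
move=> mxi ind z.
have mc i : measurable_fun setT (fun w => c i * xi i w) by exact: measurable_funM.
apply: (@expectation_cos_sum R T (Ex P) bmeas n (fun i w => c i * xi i w)).
- exact: ExD.
- exact: ExB.
- exact: bmeasM.
- exact: (bmeas_cst (T := T) 1).
- by move=> b m; apply: bmeas_trig; exact: measurable_sum.
- by move=> b i; exact: bmeas_trig.
move=> b; apply: (Ex_prod_independent (f := fun i x => trig (b i) (c i * x)) _ ind) => //.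
- by move=> i; apply: measurable_trig; exact: measurable_funM.
- by move=> i x; exact: trig_max.
Qed.

Lemma Ex_trig_unit b (X : T -> R) : measurable_fun setT X -> `|Ex P (fun w => trig b (X w))| <= 1.
Proof. by move=> mX; apply: Ex_norm_le => [|w]; [exact: bmeas_trig|exact: trig_max]. Qed.

(** The centred Bernoulli variable and the rescaled Gaussian one have the same first two moments, so
    each factor differs by a multiple of [(U / sqrt n) ^ 3], and there are [n] factors. *)
Lemma bernoulli_gaussian_dist (rho : R) n (xi : nat -> T -> R) (c : nat -> R) (U : R) :
  0 <= rho -> rho <= 1 -> (0 < n)%N ->
  (forall i, measurable_fun setT (xi i)) ->
  mutually_independent P (fun i : 'I_n => xi i) ->
  (forall i, (i < n)%N -> forall V : set R, measurable V ->
     P [set w | V (xi i w)] = normal_prob 0 (Num.sqrt n%:R)^-1 V) ->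
  (forall i, `|c i| <= U) -> U <= Num.sqrt n%:R ->
  cdist (\sum_(tau : config n) bernoulli_weight rho tau
           * cos (\sum_(i < n) c i / Num.sqrt n%:R * ((tau i)%:R - rho)),
         \sum_(tau : config n) bernoulli_weight rho tau
           * sin (\sum_(i < n) c i / Num.sqrt n%:R * ((tau i)%:R - rho)))
        (Ex P (fun w => cos (\sum_(i < n) c i * Num.sqrt (rho * (1 - rho)) * xi i w)),
         Ex P (fun w => sin (\sum_(i < n) c i * Num.sqrt (rho * (1 - rho)) * xi i w)))
  <= (8 + 800 * expR 2) * U ^+ 3 / Num.sqrt n%:R.
Proof.
move=> r0 r1 n0 mxi ind law cU Un; set N := Num.sqrt _ in law Un *; set sg := Num.sqrt _.
have N0 : 0 < N by rewrite sqrtr_gt0 ltr0n.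
have U0 : 0 <= U by exact: le_trans (normr_ge0 _) (cU 0%N).
pose th i (b : bool) := c i / N * (b%:R - rho).
pose w i := (rho * cos (th i true) + (1 - rho) * cos (th i false),
             rho * sin (th i true) + (1 - rho) * sin (th i false)).
pose w' i := (Ex P (fun w => cos (c i * sg * xi i w)), Ex P (fun w => sin (c i * sg * xi i w))).
have [Bc Bs] := @bernoulli_cos_sum R rho n th; rewrite /th -/th in Bc Bs.
have [Gc Gs] := @independent_cos_sum n xi (fun i => c i * sg) mxi ind.
rewrite Bc Bs Gc Gs -!surjective_pairing.
have sg0 : 0 <= sg by exact: sqrtr_ge0.
have sg2 : sg ^+ 2 = rho * (1 - rho) by rewrite sqr_sqrtr// mulr_ge0// subr_ge0.
have sg1 : sg <= 1.
  by rewrite -(@expr_le1 _ 2)// sg2 mulr_ile1// ?subr_ge0// gerBl.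
pose h := U / N.
have h0 : 0 <= h by rewrite divr_ge0// ltW.
have h1 : h <= 1 by rewrite ler_pdivrMr// mul1r.
(* Per site, the cosine and sine errors are [h ^+ 3] each for the Bernoulli variable and
   [100 * expR 2 * h ^+ 3] each for the Gaussian one; [cprod_dist] contributes the factor
   [4 * n]. *)
have eE : (8 + 800 * expR 2) * U ^+ 3 / N = 4 * ((2 + 200 * expR 2) * h ^+ 3) * n%:R.
  have -> : n%:R = N ^+ 2 :> R by rewrite sqr_sqrtr.
  by rewrite /h; field; rewrite gt_eqF.
rewrite eE; apply: cprod_dist.
- move=> l _; have [Cl Sl] := @bernoulli_cos_sum R rho l th.
  by rewrite /w; split; rewrite -?Cl -?Sl; apply: norm_sum_bernoulli_le => // tau;
    [exact: cos_max|exact: sin_max].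
(* Dropping the first factors means setting their coefficients to zero, so the truncated product is
   again a characteristic function. *)
- move=> l _; pose c' i := if (i < l)%N then 0 else c i * sg.
  have [Cl Sl] := @independent_cos_sum n xi c' mxi ind.
  rewrite (@eq_cprod _ (after l _) (fun i => (Ex P (fun w => cos (c' i * xi i w)),
    Ex P (fun w => sin (c' i * xi i w)))) n).
    have mS : measurable_fun setT (fun w => \sum_(i < n) c' i * xi i w).
      by apply: measurable_sum => i; exact: measurable_funM.
    by rewrite /unit_box -Cl -Sl; split; [exact: (Ex_trig_unit true)|exact: (Ex_trig_unit false)].
  move=> i _; rewrite /after /c'; case: ifP => // _; congr pair.
    by rewrite -[LHS](Ex_cst P); congr Ex; apply/funext => x; rewrite mul0r cos0.
  by rewrite -[LHS](Ex_cst P); congr Ex; apply/funext => x; rewrite mul0r sin0.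
move=> i ilt.
have ciN : `|c i / N| <= h by rewrite normrM normfV (gtr0_norm N0) ler_pM2r ?invr_gt0.
have thh b : `|th i b| <= h.
  rewrite normrM -[leRHS]mulr1 ler_pM// ler_norml; case: b; rewrite /=; lra.
have th3 b : `|sin (th i b) - th i b| <= h ^+ 3.
  by have [H _] := sin_cos_bound (th i b); apply: le_trans H _; rewrite lerXn2r// nnegrE.
have th4 b : `|cos (th i b) - 1 + th i b ^+ 2 / 2| <= h ^+ 3.
  have [_ H] := sin_cos_bound (th i b); apply: le_trans H _.
  apply: (@le_trans _ _ (h ^+ 4)); first by rewrite lerXn2r// nnegrE.
  by rewrite [leLHS]exprS ler_piMl// exprn_ge0.
set v := c i * sg / N.
have vh : `|v| <= h.
  rewrite /v mulrAC normrM (ger0_norm sg0) -[leRHS]mulr1 ler_pM//.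
have v3 : `|v| ^+ 3 <= h ^+ 3 by rewrite lerXn2r// nnegrE.
have v2 : v ^+ 2 = (c i / N) ^+ 2 * (rho * (1 - rho)) by rewrite -sg2 /v; ring.
have Ni0 : 0 < N^-1 by rewrite invr_gt0.
have [Gcos Gsin] := gaussian_cf (mxi i) Ni0 (law i ilt) (le_trans vh h1).
rewrite -/v in Gcos Gsin.
have e0 : 0 <= expR 2 :> R by exact: expR_ge0.
have G3 : 100 * expR 2 * `|v| ^+ 3 <= 100 * expR 2 * h ^+ 3 by rewrite ler_wpM2l// mulr_ge0.
have Gc' := le_trans Gcos G3; have Gs' := le_trans Gsin G3.
rewrite v2 in Gc'.
have Bc1 : `|rho * cos (th i true) + (1 - rho) * cos (th i false)
    - (1 - (c i / N) ^+ 2 * (rho * (1 - rho)) / 2)| <= h ^+ 3.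
  rewrite [X in `|X|](_ : _ = rho * (cos (th i true) - 1 + th i true ^+ 2 / 2)
    + (1 - rho) * (cos (th i false) - 1 + th i false ^+ 2 / 2)); last first.
    by rewrite /th /=; ring.
  apply: le_trans (ler_normD _ _) _; rewrite !normrM (ger0_norm r0) (@ger0_norm _ (1 - rho)) ?subr_ge0//.
  have q1 := ler_wpM2l r0 (th4 true).
  have q2 : (1 - rho) * `|cos (th i false) - 1 + th i false ^+ 2 / 2| <= (1 - rho) * h ^+ 3.
    by rewrite ler_wpM2l// subr_ge0.
  lra.
have Bs1 : `|rho * sin (th i true) + (1 - rho) * sin (th i false)| <= h ^+ 3.
  rewrite [X in `|X|](_ : _ = rho * (sin (th i true) - th i true)
    + (1 - rho) * (sin (th i false) - th i false)); last first.
    by rewrite /th /=; ring.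
  apply: le_trans (ler_normD _ _) _; rewrite !normrM (ger0_norm r0) (@ger0_norm _ (1 - rho)) ?subr_ge0//.
  have q1 := ler_wpM2l r0 (th3 true).
  have q2 : (1 - rho) * `|sin (th i false) - th i false| <= (1 - rho) * h ^+ 3.
    by rewrite ler_wpM2l// subr_ge0.
  lra.
rewrite /cdist /= -/(th i true) -/(th i false).
move: Gc' Gs' Bc1 Bs1; rewrite distrC.
have := ler_distD (1 - (c i / N) ^+ 2 * (rho * (1 - rho)) / 2)
  (rho * cos (th i true) + (1 - rho) * cos (th i false)) (Ex P (fun w => cos (c i * sg * xi i w))).
have := ler_normB (rho * sin (th i true) + (1 - rho) * sin (th i false)) (Ex P (fun w => sin (c i * sg * xi i w))).
lra.
Qed.

End gaussian_product.

Section cosine.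
Context {R : realType}.
Implicit Types x y : R.

Lemma norm_sin_le x : `|sin x| <= `|x|.
Proof.
have bd y : `|cos y| <= 1 * `|y| ^+ 0 * expR (0 * `|y|) by rewrite expr0 mul0r expR0 !mulr1 cos_max.
have := norm_le_of_derive ler01 (lexx 0) (is_derive_sin (R := R)) (sin0 R) bd x.
by rewrite expr1 mul0r expR0 mulr1 mul1r.
Qed.

(** The cap at 2 keeps the bound a bounded function of the difference, so it can be averaged within
    [bmeas]. *)
Lemma dist_cos_le x y : `|cos x - cos y| <= Num.min 2 `|x - y|.
Proof.
rewrite le_min; apply/andP; split.
  by apply: le_trans (ler_normB _ _) _; have := cos_max x; have := cos_max y; lra.
have -> : cos x - cos y = - 2 * (sin ((x + y) / 2) * sin ((x - y) / 2)).
  have ex : x = (x + y) / 2 + (x - y) / 2 by lra.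
  have ey : y = (x + y) / 2 - (x - y) / 2 by lra.
  by rewrite {1}ex {3}ey cosD cosB; ring.
rewrite !normrM normrN (ger0_norm (_ : 0 <= 2))//.
have := sin_max ((x + y) / 2); have := norm_sin_le ((x - y) / 2).
rewrite normrM [`|2^-1|]ger0_norm// => H1 H2.
have : `|sin ((x + y) / 2)| * `|sin ((x - y) / 2)| <= `|sin ((x - y) / 2)| by exact: ler_piMl.
lra.
Qed.

Lemma min_norm_sum_le (I : Type) (r : seq I) (F : I -> R) :
  Num.min 2 `|\sum_(i <- r) F i| <= \sum_(i <- r) Num.min 2 `|F i|.
Proof.
elim: r => [|i r IH]; first by rewrite !big_nil normr0 ge_min lexx orbT.
rewrite !big_cons; apply: le_trans (lerD (lexx _) IH).
have := ler_normD (F i) (\sum_(j <- r) F j).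
move: (normr_ge0 (F i)) (normr_ge0 (\sum_(j <- r) F j)).
move: `|F i + _| `|F i| `|\sum_(j <- r) _| => a b c.
by rewrite !minEle; case: ifP; case: ifP; case: ifP; lra.
Qed.

Lemma bounded_rate_cvg (u : nat -> R) (l K : R) (n0 : nat) :
  (forall n, (n0 <= n)%N -> `|u n - l| <= K / Num.sqrt n%:R) -> u n @[n --> \oo] --> l.
Proof.
move=> H; apply/cvgrPdist_lt => e e0; near=> n.
rewrite distrC; apply: (@le_lt_trans _ _ (K / Num.sqrt n%:R)).
  by apply: H; near: n; exact: nbhs_infty_ge.
have n1 : (0 < n)%N by near: n; exact: nbhs_infty_gt.
rewrite ltr_pdivrMr ?sqrtr_gt0 ?ltr0n// -ltr_pdivrMl//.
apply: le_lt_trans (ler_norm _) _.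
rewrite -sqrtr_sqr ltr_sqrt ?ltr0n//; near: n; exact: nbhs_infty_gtr.
Unshelve. all: by end_near. Qed.

End cosine.

(** * Comparison with increments of the Brownian motion *)

Section brownian_increments.
Context {R : realType} {d : measure_display} {T : measurableType d} (P : probability T R).
Context (W : R -> {RV P >-> R}) (hW : standard_brownian_motion W).

Let mW t : measurable_fun setT (W t). Proof. exact: measurable_funPT. Qed.

Lemma bmeas_min_norm (X : T -> R) : measurable_fun setT X ->
  bmeas (fun w => Num.min 2 `|X w|).
Proof.
move=> mX; split.
  by apply: (measurable_minr (f := cst 2) (g := fun w => `|X w|)) => //; exact: measurableT_comp.
exists 2 => w; rewrite ger0_norm ?ge_min ?lexx// le_min normr_ge0 andbT; lra.
Qed.

Lemma brownian_increment_le (a s t : R) : 0 <= s -> s <= t -> t <= 1 ->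
  Ex P (fun w => Num.min 2 `|a * (W t w - W s w)|) <= 2 * `|a| * Num.sqrt (t - s) * expR 2.
Proof.
move=> s0 + t1; rewrite le_eqVlt => /predU1P[<-|st].
  rewrite subrr sqrtr0 mulr0 mul0r -[leRHS](Ex_cst P); apply: Ex_le => [||w].
  - by apply: bmeas_min_norm; apply: measurable_funM => //; exact: measurable_funB.
  - exact: bmeas_cst.
  - by rewrite subrr mulr0 normr0 ge_min lexx orbT.
have [_ law _ _] := hW.
have mI : measurable_fun setT (fun w => W t w - W s w) by exact: measurable_funB.
have sts : 0 < Num.sqrt (t - s) by rewrite sqrtr_gt0 subr_gt0.
apply: le_trans (ler_norm _) _.
apply: (gaussian_abs_le mI sts (law s t s0 st t1)) => // [|w].
  by apply: bmeas_min_norm; exact: measurable_funM.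
rewrite ger0_norm; first by rewrite normrM ge_min lexx orbT.
by rewrite le_min normr_ge0 andbT; lra.
Qed.

Lemma Ex_ae_eq (X Y : T -> R) : measurable_fun setT X -> measurable_fun setT Y ->
  {ae P, forall w, X w = Y w} -> Ex P X = Ex P Y.
Proof.
move=> mX mY XY; rewrite /Ex /Rintegral; congr fine.
apply: ae_eq_integral => //; [exact/measurable_EFinP|exact/measurable_EFinP|].
by apply: filterS XY => w XY _ /=; rewrite XY.
Qed.

End brownian_increments.

Section cosine_limit.
Context {R : realType} {d : measure_display} {T : measurableType d} (P : probability T R).
Context (W : R -> {RV P >-> R}) (hW : standard_brownian_motion W) (rho : R).
Hypotheses (rho_ge0 : 0 <= rho) (rho_le1 : rho <= 1).
Context (k : nat) (x u : 'I_k -> R) (c0 : R).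
Hypothesis x01 : forall j, 0 <= x j <= 1.

(** The coefficient of site [i] in the linear combination of heights with coefficients [u]. *)
Definition prefix_coef n i : R := \sum_(j | (i < Num.truncn (n%:R * x j))%N) u j.
Let mW t : measurable_fun setT (W t). Proof. exact: measurable_funPT. Qed.

Lemma truncn_time_le n j : (Num.truncn (n%:R * x j) <= n)%N.
Proof.
have /andP[x0 x1] := x01 j.
rewrite truncn_le_nat; apply: (@le_lt_trans _ _ n%:R); last by rewrite ltr_nat.
by rewrite ler_piMr.
Qed.

Lemma sum_prefix n (a : nat -> R) :
  \sum_j u j * (\sum_(i < n | (i < Num.truncn (n%:R * x j))%N) a i) = \sum_(i < n) prefix_coef n i * a i.
Proof.
under eq_bigr do rewrite big_mkcond mulr_sumr.
rewrite exchange_big; apply: eq_bigr => i _; rewrite /prefix_coef [in RHS]big_mkcond/=.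
under eq_bigr do rewrite fun_if mulr0.
by rewrite mulr_suml; apply: eq_bigr => j _; case: ifP => _; rewrite ?mul0r.
Qed.

Lemma scaled_height_sum n (tau : config n) :
  \sum_j u j * ((Num.sqrt n%:R)^-1 * height rho tau (x j))
  = \sum_(i < n) prefix_coef n i / Num.sqrt n%:R * ((tau i)%:R - rho).
Proof.
transitivity (\sum_j u j * \sum_(i < n | (i < Num.truncn (n%:R * x j))%N)
    (Num.sqrt n%:R)^-1 * ((occ tau i)%:R - rho)).
  by apply: eq_bigr => j _; rewrite mulr_sumr; congr (_ * _); apply: eq_bigr => i _; rewrite occ_ord.
rewrite (sum_prefix n (fun i => (Num.sqrt n%:R)^-1 * ((occ tau i)%:R - rho))).
by apply: eq_bigr => i _; rewrite occ_ord mulrA.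
Qed.

Lemma prefix_coef_le n i : `|prefix_coef n i| <= \sum_j `|u j|.
Proof.
apply: le_trans (ler_norm_sum _ _ _) _; rewrite big_mkcond.
by apply: ler_sum => j _; case: ifP.
Qed.

(** The cap at 1 keeps the whole sequence in [[0, 1]], as independence of increments is stated for
    infinite sequences of times. *)
Definition mesh n i : R := Num.min (i%:R / n%:R) 1.

Lemma mesh_nondecreasing n : nondecreasing_seq (mesh n).
Proof.
move=> i j ij; rewrite /mesh le_min !ge_min lexx orbT andbT; apply/orP; left.
by rewrite ler_wpM2r ?invr_ge0// ler_nat.
Qed.

Lemma mesh_itv n i : 0 <= mesh n i <= 1.
Proof. by rewrite le_min divr_ge0//= ge_min lexx orbT ler01. Qed.

Lemma meshE n i : (0 < n)%N -> (i <= n)%N -> mesh n i = i%:R / n%:R.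
Proof. by move=> n0 ilt; apply: min_l; rewrite ler_pdivrMr ?ltr0n// mul1r ler_nat. Qed.

Lemma brownian_sum n (s : R) w : (0 < n)%N ->
  \sum_(i < n) prefix_coef n i * s * (W (mesh n i.+1) w - W (mesh n i) w)
  = \sum_j u j * (s * (W (mesh n (Num.truncn (n%:R * x j))) w - W 0 w)).
Proof.
move=> n0; under eq_bigr do rewrite -mulrA.
rewrite -(sum_prefix n (fun i => s * (W (mesh n i.+1) w - W (mesh n i) w))).
apply: eq_bigr => j _; rewrite -mulr_sumr; congr (_ * (_ * _)).
have tm0 : mesh n 0%N = 0 by rewrite meshE// mul0r.
rewrite -(big_ord_widen _ (fun i => W (mesh n i.+1) w - W (mesh n i) w) (truncn_time_le n j)).
by rewrite -(big_mkord xpredT (fun i => W (mesh n i.+1) w - W (mesh n i) w))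
  (telescope_sumr (fun i => W (mesh n i) w))// tm0.
Qed.

(** The sum of Gaussian increments is a combination of [W] at the truncated times. Almost surely
    [W 0] is 0, and moving each truncated time to [x j] crosses an interval of length at most
    [1 / n], which costs a multiple of [1 / sqrt n]. *)
Lemma bernoulli_cos_cvg :
  \sum_(tau : config n) bernoulli_weight rho tau
    * cos (\sum_j u j * ((Num.sqrt n%:R)^-1 * height rho tau (x j)) + c0) @[n --> \oo]
  --> Ex P (fun w => cos (\sum_j u j * (Num.sqrt (rho * (1 - rho)) * W (x j) w) + c0)).
Proof.
set sg := Num.sqrt _; pose U : R := \sum_j `|u j|.
have sg0 : 0 <= sg by exact: sqrtr_ge0.
have sg1 : sg <= 1.
  by rewrite -(@expr_le1 _ 2)// sqr_sqrtr ?mulr_ge0 ?subr_ge0// mulr_ile1// ?subr_ge0// gerBl.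
have U0 : 0 <= U by exact: sumr_ge0.
have e0 : 0 <= expR 2 :> R by exact: expR_ge0.
have [W0 law ind _] := hW.
(* From this index on [U <= Num.sqrt n%:R], as the factorwise comparison requires. *)
apply: (@bounded_rate_cvg _ _ _ ((8 + 800 * expR 2) * U ^+ 3 + 2 * U * expR 2)
  (Num.truncn (U ^+ 2)).+1) => n Un.
have n0 : (0 < n)%N by exact: leq_trans Un.
have UN : U <= Num.sqrt n%:R.
  rewrite -[U]ger0_norm// -sqrtr_sqr ler_sqrt ?ler0n//; apply: ltW.
  by apply: lt_le_trans (truncnS_gt _) _; rewrite ler_nat.
set N := Num.sqrt n%:R in UN *.
have N0 : 0 < N by rewrite sqrtr_gt0 ltr0n.
pose xi i w := W (mesh n i.+1) w - W (mesh n i) w.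
have mxi i : measurable_fun setT (xi i) by exact: measurable_funB.
have indn : mutually_independent P (fun i : 'I_n => xi i).
  by have := ind n (mesh n) (@mesh_nondecreasing n) (mesh_itv n).
have lawn i : (i < n)%N -> forall V : set R, measurable V ->
     P [set w | V (xi i w)] = normal_prob 0 N^-1 V.
  move=> ilt V mV; rewrite -sqrtrV ?ler0n//.
  have -> : n%:R^-1 = mesh n i.+1 - mesh n i.
    by rewrite !meshE// 1?ltnW// -mulrBl -natr1 addrAC subrr add0r mul1r.
  have /andP[ti0 _] := mesh_itv n i; have /andP[_ tS1] := mesh_itv n i.+1.
  apply: law => //; rewrite !meshE// 1?ltnW//.
  by rewrite ltr_pM2r ?invr_gt0 ?ltr0n// ltr_nat.
have main := bernoulli_gaussian_dist rho_ge0 rho_le1 n0 mxi indn lawn (prefix_coef_le n) UN.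
rewrite -/sg -/N /cdist /= in main.
pose X w := \sum_j u j * (sg * (W (mesh n (Num.truncn (n%:R * x j))) w - W 0 w)).
have XE w : \sum_(i < n) prefix_coef n i * sg * xi i w = X w by exact: brownian_sum.
have mX : measurable_fun setT X.
  by apply: measurable_sum => j; do 2 apply: measurable_funM => //; exact: measurable_funB.
pose Y w := \sum_j u j * (sg * W (x j) w).
have mY : measurable_fun setT Y.
  by apply: measurable_sum => j; do 2 apply: measurable_funM => //.
pose Z w := \sum_j u j * (sg * W (mesh n (Num.truncn (n%:R * x j))) w).
have mZ : measurable_fun setT Z.
  by apply: measurable_sum => j; do 2 apply: measurable_funM => //.
have bcos (V : T -> R) : measurable_fun setT V -> bmeas (fun w => cos (V w + c0)).
  by move=> mV; apply: (bmeas_trig true); exact: measurable_funD.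
have XZ : Ex P (fun w => cos (X w + c0)) = Ex P (fun w => cos (Z w + c0)).
  apply: Ex_ae_eq; [exact: (bcos X mX).1|exact: (bcos Z mZ).1|].
  apply: filterS W0 => w /= w0; congr (cos (_ + _)).
  by apply: eq_bigr => j _; rewrite w0 subr0.
have ZY : `|Ex P (fun w => cos (Z w + c0)) - Ex P (fun w => cos (Y w + c0))| <= 2 * U * expR 2 / N.
  rewrite -ExB//; try exact: bcos.
  pose D j w := Num.min 2 `|u j * sg * (W (x j) w - W (mesh n (Num.truncn (n%:R * x j))) w)|.
  have bD j : bmeas (D j).
    by apply: bmeas_min_norm; apply: measurable_funM => //; exact: measurable_funB.
  apply: (@le_trans _ _ (Ex P (fun w => \sum_j D j w))).
    apply: le_trans (_ : Ex P (fun w => `|cos (Z w + c0) - cos (Y w + c0)|) <= _).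
      apply: le_normr_Rintegral => //; apply: bmeas_integrable.
      by apply: bmeasB; exact: bcos.
    apply: Ex_le => [||w]; first by apply: bmeas_norm; apply: bmeasB; exact: bcos.
      exact: bmeas_sum.
    rewrite distrC; apply: le_trans (dist_cos_le _ _) _.
    rewrite (_ : Y w + c0 - (Z w + c0) =
      \sum_j u j * sg * (W (x j) w - W (mesh n (Num.truncn (n%:R * x j))) w)).
      exact: min_norm_sum_le.
    rewrite [LHS](_ : _ = Y w - Z w); last by ring.
    by rewrite -sumrB; apply: eq_bigr => j _; ring.
  rewrite Ex_sum// /U mulr_sumr !mulr_suml; apply: ler_sum => j _.
  have /andP[x0 x1] := x01 j.
  have nx0 : 0 <= n%:R * x j by rewrite mulr_ge0.
  have /andP[t1 t2] := truncn_itv nx0.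
  have tE := meshE n0 (truncn_time_le n j).
  have tx : mesh n (Num.truncn (n%:R * x j)) <= x j.
    by rewrite tE ler_pdivrMr ?ltr0n// [leRHS]mulrC.
  have /andP[t0 _] := mesh_itv n (Num.truncn (n%:R * x j)).
  apply: le_trans (brownian_increment_le hW (u j * sg) t0 tx x1) _.
  rewrite -[leRHS](mulrAC _ N^-1); apply: ler_wpM2r => //.
  apply: ler_pM => //; rewrite ?mulr_ge0//.
    by rewrite ler_wpM2l// normrM ler_piMr// ger0_norm.
  rewrite -sqrtrV ?ler0n// ler_sqrt ?invr_ge0// lerBlDr tE.
  by rewrite -[X in X + _]mul1r -mulrDl ler_pdivlMr ?ltr0n// mulrC addrC natr1 ltW.
have cD a : cos (a + c0) = cos c0 * cos a - sin c0 * sin a.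
  by rewrite cosD; ring.
have EX : Ex P (fun w => cos (X w + c0)) = cos c0 * Ex P (fun w => cos (X w)) - sin c0 * Ex P (fun w => sin (X w)).
  rewrite -!ExZ; try exact: (bmeas_trig true mX); try exact: (bmeas_trig false mX).
  rewrite -ExB; first by congr Ex; apply/funext => w; rewrite cD.
    by apply: bmeasM; [exact: bmeas_cst|exact: (bmeas_trig true mX)].
  by apply: bmeasM; [exact: bmeas_cst|exact: (bmeas_trig false mX)].
set B := \sum_tau _.
have BE : B = cos c0 * (\sum_(tau : config n) bernoulli_weight rho tau
           * cos (\sum_(i < n) prefix_coef n i / N * ((tau i)%:R - rho)))
   - sin c0 * (\sum_(tau : config n) bernoulli_weight rho tau
           * sin (\sum_(i < n) prefix_coef n i / N * ((tau i)%:R - rho))).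
  rewrite /B !mulr_sumr -sumrB; apply: eq_bigr => tau _; by rewrite scaled_height_sum -/N cD mulrBr (mulrCA (cos c0)) (mulrCA (sin c0)).
have fXE (f : R -> R) : (fun w => f (\sum_(i < n) prefix_coef n i * sg * xi i w)) = (fun w => f (X w)).
  by apply/funext => w; rewrite XE.
rewrite (fXE cos) (fXE sin) in main.
have BX : `|B - Ex P (fun w => cos (X w + c0))| <= (8 + 800 * expR 2) * U ^+ 3 / N.
  apply: le_trans main; rewrite BE EX.
  move: (\sum_tau _) (\sum_tau _) (Ex _ _) (Ex _ _) => b2 b1 g2 g1.
  rewrite [X in `|X|](_ : _ = cos c0 * (b1 - g1) - sin c0 * (b2 - g2)); last by ring.
  apply: le_trans (ler_normB _ _) _; rewrite !normrM.
  by apply: lerD; rewrite ler_piMl// ?cos_max ?sin_max.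
rewrite mulrDl; apply: le_trans (ler_distD (Ex P (fun w => cos (X w + c0))) _ _) _.
by apply: lerD => //; rewrite XZ.
Qed.

End cosine_limit.

(** * Transfer from the Bernoulli to the stationary measure *)

Definition thin (edge : forall n : nat, nat -> pred 'I_n) := forall n m, (\sum_(i < n) edge n m i <= m)%N.

Lemma thin_left_edge : thin left_edge.
Proof.
move=> n m; rewrite /left_edge.
rewrite /= -(big_mkord xpredT (fun i => nat_of_bool (i < m)%N)).
elim: n m => [|n IH] m; first by rewrite big_geq.
rewrite big_nat_recl//; case: m => [|m]; first by rewrite big1// => i _; rewrite ltn0.
by rewrite add1n ltnS; exact: IH.
Qed.

Lemma thin_right_edge : thin right_edge.
Proof.
move=> n m; apply: leq_trans (thin_left_edge n m); rewrite /right_edge /left_edge.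
rewrite [leqRHS](reindex_inj rev_ord_inj)/=; apply: leq_sum => i _.
by have := ltn_ord i; case: leqP => //; case: leqP => //; lia.
Qed.

Section transfer.
Context {R : realType} (edge : forall n : nat, nat -> pred 'I_n) (rho : R) (mu : forall n, config n -> R).
Hypotheses (tedge : thin edge) (rho_ge0 : 0 <= rho) (rho_le1 : rho <= 1).
Hypothesis mu_prob : forall n, (0 < n)%N -> prob_weight (@mu n).
Hypothesis bulk : bulk_bernoulli edge rho mu.

Lemma norm_prob_sum_le n (F : config n -> R) (M : R) : (0 < n)%N -> (forall tau, `|F tau| <= M) ->
  `|\sum_tau mu tau * F tau| <= M.
Proof.
move=> n0 FM; have [m0 m1] := mu_prob n0; apply: le_trans (ler_norm_sum _ _ _) _.
rewrite -[leRHS]mul1r -m1 mulr_suml; apply: ler_sum => tau _.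
by rewrite normrM ger0_norm// ler_wpM2l.
Qed.

Lemma norm_bernoulli_sum_le n (F : config n -> R) (M : R) : (forall tau, `|F tau| <= M) ->
  `|\sum_tau bernoulli_weight rho tau * F tau| <= M.
Proof.
move=> FM; apply: le_trans (ler_norm_sum _ _ _) _.
rewrite -[leRHS]mul1r -(@sum_bernoulli_weight _ rho n) mulr_suml; apply: ler_sum => tau _.
by rewrite normrM ger0_norm ?bernoulli_weight_ge0// ler_wpM2l ?bernoulli_weight_ge0.
Qed.

Lemma bulk_lipschitz_cvg (phi : R -> R) (a : nat -> nat -> R) (L U : R) :
  (forall y, `|phi y| <= 1) -> (forall y z, `|phi y - phi z| <= L * `|y - z|) ->
  (forall n i, `|a n i| <= U / Num.sqrt n%:R) ->
  \sum_(tau : config n) mu tau * phi (\sum_(i < n) a n i * ((tau i)%:R - rho))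
  - \sum_(tau : config n) bernoulli_weight rho tau * phi (\sum_(i < n) a n i * ((tau i)%:R - rho))
  @[n --> \oo] --> 0.
Proof.
move=> phi1 phiL aU; have [K [th [n0 [th0 th1 H]]]] := bulk.
have L0 : 0 <= L.
  by have := phiL 1 0; rewrite subr0 normr1 mulr1; exact: le_trans.
have U0 : 0 <= U.
  by have := aU 1%N 0%N; rewrite sqrtr1 divr1; exact: le_trans.
apply/cvgr0Pnorm_lt => e e0.
have Kth : K * th ^+ m @[m --> \oo] --> 0.
  by rewrite -[X in _ --> X](mulr0 K); apply: cvgMr; apply: cvg_expr; rewrite ger0_norm// ltW.
(* The width [m] is fixed by the mixing rate before [n] grows, so [m / sqrt n] still tends to 0. *)
have [m Km] : exists m, `|K * th ^+ m| < e / 2.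
  have /cvgr0Pnorm_lt/(_ _ (divr_gt0 e0 (ltr0n R 2))) [m _ Hm] := Kth.
  by exists m; exact: (Hm m (leqnn m)).
pose D := L * U * m%:R.
have D0 : 0 <= D by rewrite !mulr_ge0.
have DN : D / Num.sqrt n%:R @[n --> \oo] --> 0.
  by apply: (@bounded_rate_cvg _ _ _ D 0) => n _; rewrite subr0 ger0_norm// divr_ge0.
near=> n.
have npos : (0 < n)%N by near: n; exact: nbhs_infty_gt.
pose Y (tau : config n) := \sum_(i < n) a n i * ((tau i)%:R - rho).
pose Ym (tau : config n) := \sum_(i < n | ~~ edge m i) a n i * ((tau i)%:R - rho).
have YYm tau : `|phi (Y tau) - phi (Ym tau)| <= D / Num.sqrt n%:R.
  apply: le_trans (phiL _ _) _; rewrite /D -!mulrA ler_wpM2l//.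
  rewrite /Y (bigID (fun i : 'I_n => edge m i))/= addrK.
  apply: le_trans (ler_norm_sum _ _ _) _.
  apply: (@le_trans _ _ (\sum_(i < n | edge m i) U / Num.sqrt n%:R)).
    apply: ler_sum => i _; rewrite normrM -[leRHS]mulr1 ler_pM// ler_norml.
    by have r0 := rho_ge0; have r1 := rho_le1; case: (tau i); rewrite /=; lra.
  have -> : \sum_(i < n | edge m i) U / Num.sqrt n%:R = U / Num.sqrt n%:R * (\sum_(i < n) edge m i)%:R.
    rewrite natr_sum mulr_sumr big_mkcond; apply: eq_bigr => i _.
    by case: ifP; rewrite ?mulr1 ?mulr0.
  by rewrite -mulrA ler_wpM2l// mulrC ler_wpM2r ?invr_ge0// ler_nat.
have hm : `|\sum_tau mu tau * phi (Ym tau) - \sum_tau bernoulli_weight rho tau * phi (Ym tau)| < e / 2.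
  apply: le_lt_trans Km; apply: le_trans (ler_norm _).
  apply: H => //; first by near: n; exact: nbhs_infty_ge.
    by near: n; exact: nbhs_infty_ge.
  move=> i tau ei; congr phi; apply: eq_bigr => j ej; rewrite ffunE; case: eqP => // ji.
  by rewrite ji ei in ej.
have h1 : `|\sum_tau mu tau * (phi (Y tau) - phi (Ym tau))| <= D / Num.sqrt n%:R by exact: norm_prob_sum_le.
have h2 : `|\sum_tau bernoulli_weight rho tau * (phi (Y tau) - phi (Ym tau))| <= D / Num.sqrt n%:R.
  exact: norm_bernoulli_sum_le.
have h3 : D / Num.sqrt n%:R < e / 4.
  apply: le_lt_trans (ler_norm _) _; near: n.
  by move/cvgr0Pnorm_lt : DN => /(_ (e / 4)); apply; lra.
rewrite -/(Y _).
have E (w : config n -> R) : \sum_tau w tau * phi (Y tau)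
   = \sum_tau w tau * (phi (Y tau) - phi (Ym tau)) + \sum_tau w tau * phi (Ym tau).
  by rewrite -big_split; apply: eq_bigr => tau _ /=; rewrite -mulrDr subrK.
rewrite !E.
move: hm h1 h2; rewrite !ltr_norml !ler_norml => /andP[? ?] /andP[? ?] /andP[? ?].
apply/andP; split; lra.
Unshelve. all: by end_near. Qed.

(** Used for the variance of the height and also for that of the Bernstein weights, which are
    Bernoulli weights with a parameter depending on the point. *)
Lemma bernoulli_second_moment n (a : nat -> R) :
  \sum_(tau : config n) bernoulli_weight rho tau * (\sum_(i < n) a i * ((tau i)%:R - rho)) ^+ 2
  = rho * (1 - rho) * \sum_(i < n) a i ^+ 2.
Proof.
pose phi (i j l : 'I_n) (b : bool) : R := (if l == i then b%:R - rho else 1) * (if l == j then b%:R - rho else 1).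
have two i j (tau : config n) : ((tau i)%:R - rho) * ((tau j)%:R - rho) = \prod_l phi i j l (tau l).
  by rewrite big_split/= -!big_mkcond /= !big_pred1_eq.
transitivity (\sum_(i < n) \sum_(j < n) a i * a j * \sum_(tau : config n) bernoulli_weight rho tau * \prod_l phi i j l (tau l)).
  under [RHS]eq_bigr do under eq_bigr do rewrite mulr_sumr.
  under [RHS]eq_bigr do rewrite exchange_big.
  rewrite [RHS]exchange_big; apply: eq_bigr => tau _.
  rewrite expr2 big_distrlr mulr_sumr; apply: eq_bigr => i _; rewrite mulr_sumr.
  by apply: eq_bigr => j _ /=; rewrite -two; ring.
rewrite mulr_sumr; apply: eq_bigr => i _.
rewrite (bigD1 i)//= [X in _ + X]big1 ?addr0 => [|j ji].
  rewrite (sum_bernoulli_prod rho (phi i i)) (bigD1 i)//= big1 => [|l /negPf li].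
    by rewrite /phi eqxx /=; ring.
  by rewrite /phi li /=; ring.
rewrite (sum_bernoulli_prod rho (phi i j)) (bigD1 i)//= /phi eqxx eq_sym (negPf ji).
by move: (\prod_(_ < n | _) _) => p /=; ring.
Qed.

End transfer.

(** * Approximation by trigonometric polynomials *)

(** By compactness of the box there is a uniform radius: closer points are handled by continuity,
    and for farther ones the quadratic term exceeds [2 * M]. A quadratic modulus is chosen because
    averaging it over Bernstein weights gives a variance. *)
Lemma quadratic_modulus {R : realType} k (f : 'rV[R]_k -> R) (M a e : R) :
  continuous f -> (forall y, `|f y| <= M) -> 0 < e ->
  exists N : nat, forall y z : 'rV[R]_k, (forall j, `|y ord0 j| <= a) ->
    `|f y - f z| <= e + N%:R * \sum_j (y ord0 j - z ord0 j) ^+ 2.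
Proof.
move=> fc fM e0.
have M0 : 0 <= M by exact: le_trans (normr_ge0 _) (fM 0).
have Kc : compact [set v : 'rV[R]_k | forall j, `[- a, a]%classic (v ord0 j)].
  by apply: (@rV_compact R k (fun=> `[- a, a]%classic)) => j; exact: segment_compact.
move/compact_near_coveringP : Kc => /(_ nat \oo (fun N y => forall z : 'rV[R]_k,
  `|f y - f z| <= e + N%:R * \sum_j (y ord0 j - z ord0 j) ^+ 2)).
case=> [x _|N _ HN]; last first.
  exists N => y z ya; apply: (HN N (leqnn N)) => j /=.
  by rewrite in_itv/= -ler_norml.
have e2 : 0 < e / 2 by rewrite divr_gt0.
have /cvgrPdist_lt/(_ _ e2)/nbhs_ballP[r /= r0 Hr] := fc x.
have r2 : 0 < r / 2 by rewrite divr_gt0.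
near=> y N => z /=.
have yx : ball x (r / 2) y by near: y; exact: nbhsx_ballx.
have MN : 2 * M / (r / 2) ^+ 2 <= N%:R by near: N; exact: nbhs_infty_ger.
have fyx : `|f x - f y| < e / 2.
  by apply: Hr; apply: le_ball yx; rewrite ler_pdivrMr// ler_peMr ?ler1n// ltW.
have [/forallP zy|] := boolP [forall j, `|y ord0 j - z ord0 j| < r / 2].
  have xz : ball x r z.
    by apply: (ball_split yx); split=> // i j; rewrite ord1; exact: zy.
  have fxz : `|f x - f z| < e / 2 by exact: Hr.
  apply: (@le_trans _ _ e); last by rewrite lerDl mulr_ge0// sumr_ge0// => j _; exact: sqr_ge0.
  by have := ler_distD (f x) (f y) (f z); rewrite (distrC (f y) (f x)); lra.
rewrite negb_forall => /existsP[j]; rewrite -leNgt => rj.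
apply: (@le_trans _ _ (2 * M)).
  by apply: le_trans (ler_normB _ _) _; have := fM y; have := fM z; lra.
apply: (@le_trans _ _ (N%:R * \sum_j (y ord0 j - z ord0 j) ^+ 2)); last by rewrite lerDr ltW.
apply: (@le_trans _ _ (N%:R * (r / 2) ^+ 2)); first by rewrite -ler_pdivrMr// exprn_gt0.
rewrite ler_wpM2l// (bigD1 j)//=.
apply: (@le_trans _ _ ((y ord0 j - z ord0 j) ^+ 2)); last by rewrite lerDl sumr_ge0// => l _; exact: sqr_ge0.
by rewrite -[leRHS]real_normK ?num_real// lerXn2r// nnegrE// ltW.
Unshelve. all: by end_near. Qed.

Section sine_inverse.
Context {R : realType}.
Implicit Types x y t : R.

Lemma sin_sub x y : sin x - sin y = 2 * (cos ((x + y) / 2) * sin ((x - y) / 2)).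
Proof.
have ex : x = (x + y) / 2 + (x - y) / 2 by lra.
have ey : y = (x + y) / 2 - (x - y) / 2 by lra.
by rewrite {1}ex {3}ey sinD sinB; ring.
Qed.

Lemma sin_le x y : - (pi / 2) <= x -> x <= y -> y <= pi / 2 -> sin x <= sin y.
Proof.
move=> x0 xy y0; rewrite -subr_ge0 sin_sub !mulr_ge0//.
  by apply: cos_ge0_pihalf; lra.
by apply: sin_ge0_pi; lra.
Qed.

Lemma sin_expand x y : `|x| <= 2^-1 -> `|y| <= 2^-1 -> `|x - y| <= 4 * `|sin x - sin y|.
Proof.
move=> x1 y1; rewrite sin_sub !normrM [`|2|]ger0_norm//.
move: x1 y1; rewrite 2!ler_norml => /andP[x1 x2] /andP[y1 y2].
set s := (x + y) / 2; set t := (x - y) / 2.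
have s1 : `|s| <= 2^-1 by rewrite ler_norml /s; lra.
have t1 : `|t| <= 2^-1 by rewrite ler_norml /t; lra.
have -> : x - y = 2 * t by rewrite /t; lra.
have [_ cs] := sin_cos_bound s; have [st _] := sin_cos_bound t.
have s2 : `|s| ^+ 2 <= 4^-1.
  have -> : 4^-1 = 2^-1 ^+ 2 :> R by field.
  by rewrite lerXn2r// nnegrE// invr_ge0.
have s4 : `|s| ^+ 4 <= 16^-1.
  have -> : 16^-1 = 2^-1 ^+ 4 :> R by field.
  by rewrite lerXn2r// nnegrE// invr_ge0.
have t3 : `|t| ^+ 3 <= 4^-1 * `|t|.
  rewrite exprSr; apply: ler_wpM2r => //.
  have -> : 4^-1 = 2^-1 ^+ 2 :> R by field.
  by rewrite lerXn2r// nnegrE// invr_ge0.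
have cos1 : 2^-1 <= `|cos s|.
  apply: le_trans (ler_norm _); move: cs; rewrite ler_norml -(real_normK (num_real s)) => /andP[cs _].
  lra.
have sin1 : 2^-1 * `|t| <= `|sin t|.
  have := ler_normB (sin t) (sin t - t); rewrite subKr; have := normr_ge0 t; lra.
rewrite normrM (ger0_norm (_ : 0 <= 2))//.
have : 2^-1 * `|sin t| <= `|cos s| * `|sin t| by exact: ler_wpM2r.
lra.
Qed.

(** Truncation to the interval on which [sin] contracts distances by at most 4; by monotonicity of
    [sin] it does not spoil the inverse estimate. *)
Definition clamp t : R := Num.max (- 2^-1) (Num.min 2^-1 t).

Lemma clamp_asin_dist x t : `|x| <= 2^-1 -> -1 <= t <= 1 ->
  `|x - clamp (asin t)| <= 4 * `|sin x - t|.
Proof.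
move=> x1 t1; have [th1 thE] := asin_def t1; move: th1; set th := asin t in thE *.
move=> /andP[th1 th2]; rewrite -thE.
have p2 : 1 <= pi / 2 :> R by have := pi_ge2 R; lra.
have h0 : (0 : R) <= 2^-1 by rewrite invr_ge0.
have h1 : (2^-1 : R) <= 1 by rewrite invf_le1// ler1n.
have /andP[x2 x3] : - 2^-1 <= x <= 2^-1 by rewrite -ler_norml.
rewrite /clamp; have [tl|tl] := leP 2^-1 th.
  rewrite max_r; last by lra.
  apply: le_trans (sin_expand x1 _) _; first by rewrite ger0_norm.
  rewrite ler_wpM2l// distrC [leRHS]distrC.
  have s1 : sin x <= sin 2^-1 by apply: sin_le; lra.
  have s2 : sin 2^-1 <= sin th by apply: sin_le; lra.
  by rewrite !ger0_norm; lra.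
have [tl'|tl'] := leP th (- 2^-1).
  apply: le_trans (sin_expand x1 _) _; first by rewrite normrN ger0_norm.
  rewrite ler_wpM2l//.
  have s1 : sin (- 2^-1) <= sin x by apply: sin_le; lra.
  have s2 : sin th <= sin (- 2^-1) by apply: sin_le; lra.
  by rewrite !ger0_norm; lra.
by apply: sin_expand => //; rewrite ler_norml; lra.
Qed.

End sine_inverse.

Section trig_poly.
Context {R : realType} (k : nat).
Implicit Types p q : 'rV[R]_k -> R.

Definition trig_poly p := exists r : seq (R * ('I_k -> R) * R),
  forall y, p y = \sum_(t <- r) t.1.1 * cos (\sum_j t.1.2 j * y ord0 j + t.2).

Lemma trig_poly_cst (c : R) : trig_poly (fun=> c).
Proof.
exists [:: (c, fun=> 0, 0)] => y; rewrite big_seq1/= big1 ?addr0 ?cos0 ?mulr1// => j _.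
by rewrite mul0r.
Qed.

Lemma trig_polyD p q : trig_poly p -> trig_poly q -> trig_poly (fun y => p y + q y).
Proof. by move=> [r pr] [s qs]; exists (r ++ s) => y; rewrite big_cat pr qs. Qed.

Lemma trig_polyM p q : trig_poly p -> trig_poly q -> trig_poly (fun y => p y * q y).
Proof.
move=> [r pr] [s qs]; under eq_fun do rewrite pr qs; clear p q pr qs; move: r s.
elim=> [|t r IH] s.
  by under eq_fun do rewrite big_nil mul0r; exact: trig_poly_cst.
under eq_fun do rewrite big_cons mulrDl; apply: trig_polyD => //.
elim: s => [|u s IHs].
  by under eq_fun do rewrite big_nil mulr0; exact: trig_poly_cst.
under eq_fun do rewrite big_cons mulrDr; apply: trig_polyD => //.
exists [:: (t.1.1 * u.1.1 / 2, fun j => t.1.2 j + u.1.2 j, t.2 + u.2);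
           (t.1.1 * u.1.1 / 2, fun j => t.1.2 j - u.1.2 j, t.2 - u.2)] => y.
rewrite big_cons big_seq1/=.
under [X in cos (X + (_ + _))]eq_bigr do rewrite mulrDl.
under [X in cos (X + (_ - _))]eq_bigr do rewrite mulrBl.
rewrite big_split sumrB /=.
set a := \sum_j _; set b := \sum_j _.
set x := a + t.2; set z := b + u.2.
rewrite (_ : a + b + (t.2 + u.2) = x + z); last by rewrite /x /z; ring.
rewrite (_ : a - b + (t.2 - u.2) = x - z); last by rewrite /x /z; ring.
by clearbody x z; rewrite cosD cosB; field.
Qed.

Lemma trig_poly_sum (I : Type) (r : seq I) (F : I -> 'rV[R]_k -> R) :
  (forall i, trig_poly (F i)) -> trig_poly (fun y => \sum_(i <- r) F i y).
Proof.
move=> tF; elim: r => [|i r IH].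
  by under eq_fun do rewrite big_nil; exact: trig_poly_cst.
by under eq_fun do rewrite big_cons; exact: trig_polyD.
Qed.

Lemma trig_poly_prod (I : Type) (r : seq I) (F : I -> 'rV[R]_k -> R) :
  (forall i, trig_poly (F i)) -> trig_poly (fun y => \prod_(i <- r) F i y).
Proof.
move=> tF; elim: r => [|i r IH].
  by under eq_fun do rewrite big_nil; exact: trig_poly_cst.
by under eq_fun do rewrite big_cons; exact: trig_polyM.
Qed.

Lemma trig_poly_sin (c : R) j : trig_poly (fun y => sin (c * y ord0 j)).
Proof.
exists [:: (1, fun l => if l == j then c else 0, - (pi / 2))] => y.
rewrite big_seq1/= mul1r (bigD1 j)//= eqxx big1 ?addr0 => [|l /negPf ->]; last by rewrite mul0r.
by rewrite cosB cos_pihalf sin_pihalf mulr0 mulr1 add0r.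
Qed.

(** [p y] is the mean of [f] at a random node whose coordinate [j] is read off from the frequency of
    ones in [m] Bernoulli trials of parameter [v y j]. Averaging gives the global bound [2 * M], and
    the variance, at most [1 / m] per coordinate, gives the precision on the box. *)
Lemma trig_approx (f : 'rV[R]_k -> R) (M a e : R) : continuous f -> (forall y, `|f y| <= M) ->
  0 < a -> 0 < e -> exists2 p, trig_poly p &
    (forall y, `|f y - p y| <= 2 * M) /\
    (forall y : 'rV[R]_k, (forall j, `|y ord0 j| <= a) -> `|f y - p y| <= e).
Proof.
move=> fc fM a0 e0.
have e2 : 0 < e / 2 by rewrite divr_gt0.
have [N HN] := quadratic_modulus a fc fM e2.
(* The factor [16 * a] is the scale [2 * a], times the constant 4 of [clamp_asin_dist], times 2 from
   [sin = 2 * v - 1]. *)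
pose B := N%:R * k%:R * (16 * a) ^+ 2.
have B0 : 0 <= B by apply: mulr_ge0; [exact: mulr_ge0|exact: sqr_ge0].
pose m := (Num.truncn (B / (e / 2))).+1.
have m0 : (0 < m%:R :> R) by rewrite ltr0n.
have Bm : B / m%:R <= e / 2.
  by rewrite ler_pdivrMr// mulrC -ler_pdivrMr// ltW// truncnS_gt.
(* Division by [2 * a] brings the box into [[-1/2, 1/2]], where [sin] has a Lipschitz inverse. *)
pose v (y : 'rV[R]_k) j := (1 + sin ((2 * a)^-1 * y ord0 j)) / 2.
have v0 y j : 0 <= v y j.
  by have := sin_max ((2 * a)^-1 * y ord0 j); rewrite /v ler_norml; lra.
have v1 y j : v y j <= 1.
  by have := sin_max ((2 * a)^-1 * y ord0 j); rewrite /v ler_norml; lra.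
pose freq (t : config m) : R := \sum_(i < m) m%:R^-1 * (t i)%:R.
pose z (b : {ffun 'I_k -> config m}) : 'rV[R]_k :=
  \row_j (2 * a * clamp (asin (2 * freq (b j) - 1))).
pose wt y (b : {ffun 'I_k -> config m}) := \prod_j bernoulli_weight (v y j) (b j).
have wt0 y b : 0 <= wt y b by apply: prodr_ge0 => j _; exact: bernoulli_weight_ge0.
have wt1 y : \sum_b wt y b = 1.
  rewrite /wt -(bigA_distr_bigA (fun j b => bernoulli_weight (v y j) b)) big1// => j _.
  exact: sum_bernoulli_weight.
have marginal y j (F : config m -> R) :
    \sum_b wt y b * F (b j) = \sum_t bernoulli_weight (v y j) t * F t.
  pose G l t := bernoulli_weight (v y l) t * (if l == j then F t else 1).
  transitivity (\prod_l \sum_t G l t).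
    by rewrite bigA_distr_bigA; apply: eq_bigr => b _; rewrite big_split/= -big_mkcond/= big_pred1_eq.
  have G1 : \prod_(l | l != j) \sum_t G l t = 1.
    apply: big1 => l /negPf lj; rewrite -[RHS](@sum_bernoulli_weight _ (v y l) m).
    by apply: eq_bigr => t _; rewrite /G lj mulr1.
  by rewrite (bigD1 j)//= G1 mulr1; apply: eq_bigr => t _; rewrite /G eqxx.
exists (fun y => \sum_b wt y b * f (z b)).
  apply: trig_poly_sum => b; apply: trig_polyM; last exact: trig_poly_cst.
  apply: trig_poly_prod => j; apply: trig_poly_prod => i.
  have tv : trig_poly (fun y => v y j).
    apply: trig_polyM; last exact: trig_poly_cst.
    by apply: trig_polyD; [exact: trig_poly_cst|exact: trig_poly_sin].
  case: (b j i) => //.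
  under eq_fun do rewrite -mulN1r.
  by apply: trig_polyD; [exact: trig_poly_cst|apply: trig_polyM => //; exact: trig_poly_cst].
have dE y : f y - \sum_b wt y b * f (z b) = \sum_b wt y b * (f y - f (z b)).
  by rewrite -[f y in LHS]mul1r -(wt1 y) mulr_suml -sumrB; apply: eq_bigr => b _; rewrite mulrBr.
have dle y : `|f y - \sum_b wt y b * f (z b)| <= \sum_b wt y b * `|f y - f (z b)|.
  rewrite dE; apply: le_trans (ler_norm_sum _ _ _) _.
  by apply: ler_sum => b _; rewrite normrM ger0_norm.
split=> y; first apply: le_trans (dle y) _.
  rewrite -[leRHS]mul1r -[X in _ <= X * _](wt1 y) mulr_suml; apply: ler_sum => b _; apply: ler_wpM2l => //.
  by apply: le_trans (ler_normB _ _) _; have := fM y; have := fM (z b); lra.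
move=> ya; apply: le_trans (dle y) _.
apply: (@le_trans _ _ (\sum_b wt y b * (e / 2 + N%:R * \sum_j (y ord0 j - z b ord0 j) ^+ 2))).
  by apply: ler_sum => b _; apply: ler_wpM2l => //; exact: HN.
under eq_bigr do rewrite mulrDr.
rewrite big_split/= -mulr_suml wt1 mul1r.
suff H : \sum_b wt y b * (N%:R * \sum_j (y ord0 j - z b ord0 j) ^+ 2) <= B / m%:R.
  by move: H Bm; lra.
have -> : \sum_b wt y b * (N%:R * \sum_j (y ord0 j - z b ord0 j) ^+ 2)
   = N%:R * \sum_j \sum_b wt y b * (y ord0 j - z b ord0 j) ^+ 2.
  rewrite exchange_big mulr_sumr; apply: eq_bigr => b _ /=.
  by rewrite mulrCA mulr_sumr.
have -> : B / m%:R = N%:R * (k%:R * ((16 * a) ^+ 2 / m%:R)) by rewrite /B !mulrA.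
rewrite ler_wpM2l//.
apply: (@le_trans _ _ (\sum_(j < k) (16 * a) ^+ 2 / m%:R)); last first.
  by rewrite sumr_const card_ord (mulr_natl _ k).
apply: ler_sum => j _.
have pt (b : {ffun 'I_k -> config m}) : (y ord0 j - z b ord0 j) ^+ 2
    <= (16 * a) ^+ 2 * (\sum_(i < m) m%:R^-1 * ((b j i)%:R - v y j)) ^+ 2.
  have fr0 : 0 <= freq (b j) by apply: sumr_ge0 => i _; rewrite mulr_ge0// invr_ge0.
  have fr1 : freq (b j) <= 1.
    rewrite -(@mulVf _ (m%:R : R)) ?gt_eqF// -[X in _ * X%:R]card_ord -sumr_const mulr_sumr.
    apply: ler_sum => i _; rewrite ler_wpM2l ?invr_ge0//; by case: (b j i).
  have frE : \sum_(i < m) m%:R^-1 * ((b j i)%:R - v y j) = freq (b j) - v y j.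
    under eq_bigr do rewrite mulrBr.
    by rewrite sumrB sumr_const card_ord -[X in _ - X]mulr_natl mulrA mulfV ?mul1r// gt_eqF.
  have t1 : -1 <= 2 * freq (b j) - 1 <= 1 by lra.
  have x1 : `|(2 * a)^-1 * y ord0 j| <= 2^-1.
    have a20 : 0 < 2 * a by rewrite mulr_gt0.
    by rewrite normrM normfV (gtr0_norm a20) ler_pdivrMl//; have := ya j; lra.
  have := clamp_asin_dist x1 t1; rewrite mxE frE.
  set c := clamp _ => H.
  have -> : y ord0 j - 2 * a * c = 2 * a * ((2 * a)^-1 * y ord0 j - c).
    by field; rewrite gt_eqF.
  rewrite -exprMn -[leLHS]real_normK ?num_real// -[leRHS]real_normK ?num_real//.
  rewrite lerXn2r ?nnegrE//.
  have sE : sin ((2 * a)^-1 * y ord0 j) = 2 * v y j - 1 by rewrite /v; lra.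
  rewrite sE (_ : 2 * v y j - 1 - (2 * freq (b j) - 1) = 2 * (v y j - freq (b j))) in H; last by ring.
  rewrite !normrM (gtr0_norm a0) !(ger0_norm (_ : 0 <= _%:R))// in H *.
  rewrite (distrC (freq _)).
  have := ler_wpM2l (ltW a0) H; lra.
apply: (@le_trans _ _ (\sum_b wt y b * ((16 * a) ^+ 2 * (\sum_(i < m) m%:R^-1 * ((b j i)%:R - v y j)) ^+ 2))).
  by apply: ler_sum => b _; rewrite ler_wpM2l.
rewrite (marginal y j (fun t => (16 * a) ^+ 2 * (\sum_(i < m) m%:R^-1 * ((t i)%:R - v y j)) ^+ 2)).
under eq_bigr do rewrite mulrCA.
rewrite -mulr_sumr (bernoulli_second_moment (v y j) m (fun=> m%:R^-1)).
rewrite sumr_const card_ord.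
have -> : m%:R^-1 ^+ 2 *+ m = m%:R^-1 :> R.
  by rewrite -mulr_natr expr2 mulfVK// gt_eqF.
have H : v y j * (1 - v y j) * m%:R^-1 <= m%:R^-1.
  by rewrite ler_piMl ?invr_ge0// mulr_ile1 ?subr_ge0// gerBl.
by rewrite ler_wpM2l// sqr_ge0.
Qed.

End trig_poly.

(** * Convergence of finite-dimensional distributions *)

Section truncated_square.
Context {R : realType}.
Implicit Types a y z : R.

(** The square of the minimum: it is 1 off the box and at most [(y / a) ^+ 2], but unlike a square
    it is bounded and Lipschitz, so that its mean passes from the Bernoulli to the stationary
    measure. *)
Definition cap a y : R := Num.min 1 `|y / a| ^+ 2.

Let m y : R := Num.min 1 `|y|.
Let m0 y : 0 <= m y. Proof. by rewrite le_min ler01 normr_ge0. Qed.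
Let m1 y : m y <= 1. Proof. by rewrite ge_min lexx. Qed.

Lemma cap_itv a y : 0 <= cap a y <= 1.
Proof. by rewrite exprn_ge0 ?m0// exprn_ile1 ?m0 ?m1. Qed.

Lemma norm_cap_le1 a y : `|cap a y| <= 1.
Proof. by have /andP[c0 c1] := cap_itv a y; rewrite ger0_norm. Qed.

Lemma cap_dist a y z : 0 < a -> `|cap a y - cap a z| <= 2 / a * `|y - z|.
Proof.
move=> a0; rewrite /cap -/(m (y / a)) -/(m (z / a)) subr_sqr normrM.
have H : `|m (y / a) - m (z / a)| <= a^-1 * `|y - z|.
  have -> : a^-1 * `|y - z| = `|y / a - z / a|.
    by rewrite -mulrBl normrM normfV (gtr0_norm a0) mulrC.
  have := ler_dist_dist (y / a) (z / a); rewrite /m.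
  move: `|y / a - z / a| `|y / a| `|z / a| => b p q H; apply: le_trans _ H.
  have [h1|h1] := leP 1 p; have [h2|h2] := leP 1 q; rewrite ?subrr ?normr0//.
    have q0 : 0 <= 1 - q by rewrite subr_ge0 ltW.
    by rewrite (ger0_norm q0); apply: le_trans _ (ler_norm _); rewrite lerB.
  have p0 : 0 <= 1 - p by rewrite subr_ge0 ltW.
  by rewrite distrC (distrC p) (ger0_norm p0); apply: le_trans _ (ler_norm _); rewrite lerB.
have H2 : `|m (y / a) + m (z / a)| <= 2.
  by rewrite ger0_norm ?addr_ge0//; have := m1 (y / a); have := m1 (z / a); lra.
have := ler_pM (normr_ge0 _) (normr_ge0 _) H H2; lra.
Qed.

Lemma cap_le_sqr a y : cap a y <= (y / a) ^+ 2.
Proof.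
rewrite -[leRHS]real_normK ?num_real// lerXn2r ?nnegrE ?m0//.
by rewrite ge_min lexx orbT.
Qed.

Lemma cap_le_min a y : cap a y <= Num.min 2 `|y / a|.
Proof.
apply: (@le_trans _ _ (m (y / a))); first by rewrite /cap expr2 ler_piMl ?m0 ?m1.
by rewrite /m le_min !ge_min lexx orbT andbT ler1n.
Qed.

Lemma cap_eq1 a y : 0 < a -> a < `|y| -> cap a y = 1.
Proof.
move=> a0 ay; rewrite /cap min_l ?expr1n// normrM normfV (gtr0_norm a0).
by rewrite ler_pdivlMr// mul1r ltW.
Qed.

Lemma approx_cap k (f p : 'rV[R]_k -> R) (M a e : R) (y : 'rV[R]_k) : 0 < a -> 0 <= e -> 0 <= M ->
  (forall y : 'rV[R]_k, `|f y - p y| <= 2 * M) ->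
  (forall y : 'rV[R]_k, (forall j, `|y ord0 j| <= a) -> `|f y - p y| <= e) ->
  `|f y - p y| <= e + 2 * M * \sum_j cap a (y ord0 j).
Proof.
move=> a0 e0 M0 H1 H2.
have S0 : 0 <= \sum_j cap a (y ord0 j).
  by apply: sumr_ge0 => j _; case/andP: (cap_itv a (y ord0 j)).
have [/forallP ya|] := boolP [forall j, `|y ord0 j| <= a].
  by apply: le_trans (H2 y ya) _; rewrite lerDl !mulr_ge0.
rewrite negb_forall => /existsP[j]; rewrite -ltNge => ay.
apply: le_trans (H1 y) _; apply: (@le_trans _ _ (2 * M * \sum_j cap a (y ord0 j))); last by rewrite lerDr.
rewrite ler_peMr ?mulr_ge0// (bigD1 j)//= cap_eq1// lerDl sumr_ge0// => l _.
by case/andP: (cap_itv a (y ord0 l)).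
Qed.

End truncated_square.

Section central_limit.
Context {R : realType} {d : measure_display} {T : measurableType d} (P : probability T R).
Context (W : R -> {RV P >-> R}) (hW : standard_brownian_motion W) (rho : R).
Hypotheses (rho_ge0 : 0 <= rho) (rho_le1 : rho <= 1).
Context (edge : forall n : nat, nat -> pred 'I_n) (mu : forall n, config n -> R).
Hypotheses (tedge : thin edge) (mu_prob : forall n, (0 < n)%N -> prob_weight (@mu n)).
Hypothesis bulk : bulk_bernoulli edge rho mu.

Let sg : R := Num.sqrt (rho * (1 - rho)).
Let scaled n (tau : config n) x := (Num.sqrt n%:R)^-1 * height rho tau x.
Let mW t : measurable_fun setT (W t). Proof. exact: measurable_funPT. Qed.

Lemma scaled_height_cos_cvg k (x u : 'I_k -> R) (c0 : R) : (forall j, 0 <= x j <= 1) ->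
  \sum_(tau : config n) mu tau * cos (\sum_j u j * scaled tau (x j) + c0) @[n --> \oo]
  --> Ex P (fun w => cos (\sum_j u j * (sg * W (x j) w) + c0)).
Proof.
move=> x01; have H1 := @bernoulli_cos_cvg _ _ _ _ _ hW _ rho_ge0 rho_le1 k x u c0 x01.
have H2 := @bulk_lipschitz_cvg R edge rho mu tedge rho_ge0 rho_le1 mu_prob bulk
  (fun y => cos (y + c0)) (fun n i => prefix_coef x u n i / Num.sqrt n%:R) 1 (\sum_j `|u j|).
have {}H2 := H2 (fun y => cos_max _).
have E n (tau : config n) : \sum_j u j * scaled tau (x j)
    = \sum_(i < n) prefix_coef x u n i / Num.sqrt n%:R * ((tau i)%:R - rho).
  exact: scaled_height_sum.
have {}E n : \sum_(tau : config n) mu tau * cos (\sum_j u j * scaled tau (x j) + c0)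
  = (\sum_(tau : config n) mu tau
       * cos (\sum_(i < n) prefix_coef x u n i / Num.sqrt n%:R * ((tau i)%:R - rho) + c0)
     - \sum_(tau : config n) bernoulli_weight rho tau
       * cos (\sum_(i < n) prefix_coef x u n i / Num.sqrt n%:R * ((tau i)%:R - rho) + c0))
    + \sum_(tau : config n) bernoulli_weight rho tau * cos (\sum_j u j * scaled tau (x j) + c0).
  by under [X in _ = X - _ + _]eq_bigr do rewrite -E; under [X in _ = _ - X + _]eq_bigr do rewrite -E; rewrite subrK.
rewrite (funext E) -[X in _ --> X]add0r; apply: cvgD H1; apply: H2 => [y z|n i].
  rewrite mul1r; apply: le_trans (dist_cos_le _ _) _.
  by rewrite opprD addrACA subrr addr0 ge_min lexx orbT.
by rewrite normrM normfV (ger0_norm (sqrtr_ge0 _)) ler_wpM2r ?invr_ge0// prefix_coef_le.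
Qed.

(** One [1 / a ^+ 2] is the Bernoulli second moment, the other the allowance for the comparison of
    measures. *)
Lemma scaled_height_cap (a y : R) : 0 < a -> 0 <= y <= 1 ->
  \forall n \near \oo, \sum_(tau : config n) mu tau * cap a (scaled tau y) <= 2 / a ^+ 2.
Proof.
move=> a0 y01; pose b n i : R := if (i < Num.truncn (n%:R * y))%N then (Num.sqrt n%:R)^-1 else 0.
have sE n (tau : config n) : scaled tau y = \sum_(i < n) b n i * ((tau i)%:R - rho).
  rewrite /scaled /height mulr_sumr big_mkcond; apply: eq_bigr => i _; rewrite /b.
  by case: ifP => // _; rewrite mul0r.
have b1 n i : `|b n i| <= 1 / Num.sqrt n%:R.
  by rewrite /b; case: ifP => _; rewrite ?normr0 ?div1r ?ger0_norm ?invr_ge0.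
have a2 : 0 < a ^+ 2 by rewrite exprn_gt0.
have ai : 0 < (a ^+ 2)^-1 by rewrite invr_gt0.
have H := @bulk_lipschitz_cvg R edge rho mu tedge rho_ge0 rho_le1 mu_prob bulk
  (cap a) b (2 / a) 1 (norm_cap_le1 a) (fun y z => cap_dist y z a0) b1.
move/cvgr0Pnorm_lt : H => /(_ _ ai) H; near=> n.
have n0 : (0 < n)%N by near: n; exact: nbhs_infty_gt.
under eq_bigr do rewrite sE.
have h1 : \sum_(tau : config n) bernoulli_weight rho tau * cap a (\sum_(i < n) b n i * ((tau i)%:R - rho))
   <= (a ^+ 2)^-1.
  apply: (@le_trans _ _ (\sum_(tau : config n) (a ^+ 2)^-1 *
      (bernoulli_weight rho tau * (\sum_(i < n) b n i * ((tau i)%:R - rho)) ^+ 2))).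
    apply: ler_sum => tau _; rewrite [leRHS]mulrCA ler_wpM2l ?bernoulli_weight_ge0//.
    by rewrite [leRHS]mulrC -exprVn -exprMn; exact: cap_le_sqr.
  rewrite -mulr_sumr (bernoulli_second_moment rho n (b n)); apply: ler_piMr; first exact: ltW.
  apply: mulr_ile1.
  - by rewrite mulr_ge0 ?subr_ge0.
  - by apply: sumr_ge0 => i _; exact: sqr_ge0.
  - by rewrite mulr_ile1 ?subr_ge0// gerBl.
  apply: (@le_trans _ _ (\sum_(i < n) n%:R^-1)).
    apply: ler_sum => i _; rewrite /b; case: ifP => _; last by rewrite expr0n invr_ge0.
    by rewrite exprVn sqr_sqrtr.
  by rewrite sumr_const card_ord -[leLHS]mulr_natr mulVf// pnatr_eq0 -lt0n.
have : `|\sum_(tau : config n) mu tau * cap a (\sum_(i < n) b n i * ((tau i)%:R - rho))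
  - \sum_(tau : config n) bernoulli_weight rho tau * cap a (\sum_(i < n) b n i * ((tau i)%:R - rho))|
  < (a ^+ 2)^-1 by near: n; exact: H.
by rewrite ltr_norml => /andP[_ h2]; move: h1 h2; lra.
Unshelve. all: by end_near. Qed.

Lemma measurable_cap (a : R) (X : T -> R) : measurable_fun setT X ->
  measurable_fun setT (fun w => cap a (X w)).
Proof.
move=> mX; apply: measurable_funX.
apply: (measurable_minr (f := cst 1) (g := fun w => `|X w / a|)) => //.
by apply: measurableT_comp => //; exact: measurable_funM.
Qed.

Lemma bmeas_cap (a : R) (X : T -> R) : measurable_fun setT X -> bmeas (fun w => cap a (X w)).
Proof. by move=> mX; split; [exact: measurable_cap|exists 1 => w; exact: norm_cap_le1]. Qed.

Lemma brownian_cap (a x : R) : 0 < a -> 0 <= x <= 1 ->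
  Ex P (fun w => cap a (sg * W x w)) <= 2 * expR 2 / a.
Proof.
move=> a0 /andP[x0 x1]; have [W0 _ _ _] := hW.
have sg0 : 0 <= sg by exact: sqrtr_ge0.
have sg1 : sg <= 1.
  rewrite -(@expr_le1 _ 2)// sqr_sqrtr ?mulr_ge0 ?subr_ge0//.
  by rewrite mulr_ile1// ?subr_ge0// gerBl.
have mI : measurable_fun setT (fun w => W x w - W 0 w) by exact: measurable_funB.
have -> : Ex P (fun w => cap a (sg * W x w)) = Ex P (fun w => cap a (sg * (W x w - W 0 w))).
  apply: Ex_ae_eq.
  - by apply: measurable_cap; exact: measurable_funM.
  - by apply: measurable_cap; exact: measurable_funM.
  - by apply: filterS W0 => w w0; rewrite w0 subr0.
apply: (@le_trans _ _ (Ex P (fun w => Num.min 2 `|sg / a * (W x w - W 0 w)|))).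
  apply: Ex_le => [||w].
  - by apply: bmeas_cap; exact: measurable_funM.
  - by apply: bmeas_min_norm; exact: measurable_funM.
  - by rewrite mulrAC; exact: cap_le_min.
apply: le_trans (brownian_increment_le hW (sg / a) (lexx 0) x0 x1) _.
rewrite subr0 normrM normfV (gtr0_norm a0) (ger0_norm sg0).
have sx : Num.sqrt x <= 1 by rewrite -sqrtr1 ler_sqrt.
have e0 : 0 <= expR 2 :> R by exact: expR_ge0.
rewrite [leLHS](_ : _ = (2 * expR 2 / a) * (sg * Num.sqrt x)); last by ring.
by rewrite ler_piMr ?mulr_ile1 ?sqrtr_ge0// !mulr_ge0// invr_ge0 ltW.
Qed.

End central_limit.

Section fdd_limit.
Context {R : realType} {d : measure_display} {T : measurableType d} (P : probability T R).
Context (W : R -> {RV P >-> R}) (hW : standard_brownian_motion W) (rho : R).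
Hypotheses (rho_ge0 : 0 <= rho) (rho_le1 : rho <= 1).
Context (edge : forall n : nat, nat -> pred 'I_n) (mu : forall n, config n -> R).
Hypotheses (tedge : thin edge) (mu_prob : forall n, (0 < n)%N -> prob_weight (@mu n)).
Hypothesis bulk : bulk_bernoulli edge rho mu.

Let mW t : measurable_fun setT (W t). Proof. exact: measurable_funPT. Qed.

Lemma trig_poly_measurable k (p : 'rV[R]_k -> R) (Z : 'I_k -> T -> R) : trig_poly p ->
  (forall j, measurable_fun setT (Z j)) -> measurable_fun setT (fun w => p (\row_j Z j w)).
Proof.
move=> [r pE] mZ; under eq_fun do rewrite pE.
apply: measurable_sum => t; apply: measurable_funM => //; apply: measurable_fun_cos.
apply: measurable_funD => //; apply: measurable_sum => j; apply: measurable_funM => //.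
by under eq_fun do rewrite mxE; exact: mZ.
Qed.

(** Measurability comes from a pointwise limit of trigonometric polynomials, accurate to
    [1 / (N + 1)] on boxes of half-width [N + 1]. *)
Lemma continuous_row_bmeas k (f : 'rV[R]_k -> R) (M : R) (Z : 'I_k -> T -> R) : continuous f ->
  (forall y, `|f y| <= M) -> (forall j, measurable_fun setT (Z j)) ->
  bmeas (fun w => f (\row_j Z j w)).
Proof.
move=> fc fM mZ; split; last by exists M.
have /choice[p pP] (N : nat) : exists p : 'rV[R]_k -> R, trig_poly p /\
    forall y : 'rV[R]_k, (forall j, `|y ord0 j| <= N.+1%:R) -> `|f y - p y| <= N.+1%:R^-1.
  have N0 : 0 < N.+1%:R^-1 :> R by rewrite invr_gt0.
  by have [p tp [_ Hp]] := trig_approx fc fM (ltr0Sn R N) N0; exists p.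
apply: (measurable_fun_cvg (h := fun N w => p N (\row_j Z j w))).
  by move=> N; apply: trig_poly_measurable => //; have [] := pP N.
move=> w _; apply/cvgrPdist_lt => e e0; near=> N; set y := \row_j _.
have [_ H] := pP N; apply: le_lt_trans (H y _) _.
  move=> j; apply: (@le_trans _ _ (\sum_l `|y ord0 l|)).
    by rewrite (bigD1 j)//= lerDl sumr_ge0.
  by apply: (@le_trans _ _ N%:R); [near: N; exact: nbhs_infty_ger|rewrite ler_nat].
rewrite invf_plt ?posrE//; apply: (@lt_le_trans _ _ N%:R); last by rewrite ler_nat.
by near: N; exact: nbhs_infty_gtr.
Unshelve. all: by end_near. Qed.

Lemma bulk_bernoulli_fdd_cvg : fdd_cvg P mu
  (fun n x tau => (Num.sqrt n%:R)^-1 * height rho tau x)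
  (fun x w => Num.sqrt (rho * (1 - rho)) * W x w).
Proof.
move=> k x x01 f fc [M fM]; set sg : R := Num.sqrt _.
pose Z j w : R := sg * W (x j) w.
have mZ j : measurable_fun setT (Z j) by exact: measurable_funM.
have M0 : 0 <= M by exact: le_trans (normr_ge0 _) (fM 0).
rewrite (expectation_Ex P (continuous_row_bmeas fc fM mZ)).
pose Y n (tau : config n) := \row_j ((Num.sqrt n%:R)^-1 * height rho tau (x j)).
suff : \sum_(tau : config n) mu tau * f (Y n tau) @[n --> \oo] --> Ex P (fun w => f (\row_j Z j w)).
  by move=> H; apply: cvg_comp H _; exact: cvg_id.
apply/cvgrPdist_lt => eta eta0.
have e8 : 0 < eta / 8 by rewrite divr_gt0.
have E0 : 0 <= 2 * expR 2 :> R by rewrite mulr_ge0// expR_ge0.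
(* Makes [2 * M] times the sum of the [k] tail bounds at most [eta / 8]. The added 1 gives
   [2 / a ^+ 2 <= 2 * expR 2 / a], so the same bound serves both measures. *)
pose a := 2 * M * (k%:R * (2 * expR 2)) / (eta / 8) + 1.
have a1 : 1 <= a by rewrite lerDr divr_ge0 ?(ltW e8)// !mulr_ge0.
have a0 : 0 < a by exact: lt_le_trans a1.
have aB : 2 * M * (k%:R * (2 * expR 2 / a)) <= eta / 8.
  rewrite (_ : 2 * M * (k%:R * (2 * expR 2 / a)) = 2 * M * (k%:R * (2 * expR 2)) / a); last by ring.
  by rewrite ler_pdivrMr// [leRHS]mulrC -ler_pdivrMr// /a lerDl.
have [p [r pE] [p1 p2]] := trig_approx fc fM a0 e8.
have tp : trig_poly p by exists r.
have acap y : `|f y - p y| <= eta / 8 + 2 * M * \sum_j cap a (y ord0 j).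
  exact: approx_cap (ltW e8) M0 p1 p2.
have bp : bmeas (fun w => p (\row_j Z j w)).
  split; first exact: trig_poly_measurable.
  exists (3 * M) => w; have := fM (\row_j Z j w); have := p1 (\row_j Z j w).
  rewrite distrC; have := ler_distD 0 (p (\row_j Z j w)) 0.
  have := ler_normD (p (\row_j Z j w) - f (\row_j Z j w)) (f (\row_j Z j w)); rewrite subrK.
  lra.
have bcap j : bmeas (fun w => cap a (Z j w)) by exact: bmeas_cap.
have gauss : `|Ex P (fun w => f (\row_j Z j w)) - Ex P (fun w => p (\row_j Z j w))| <= eta / 4.
  have bf := continuous_row_bmeas fc fM mZ.
  rewrite -ExB//; apply: (@le_trans _ _ (Ex P (fun w => eta / 8 + 2 * M * \sum_j cap a (Z j w)))).
    apply: le_trans (_ : Ex P (fun w => `|f (\row_j Z j w) - p (\row_j Z j w)|) <= _).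
      by apply: le_normr_Rintegral => //; apply: bmeas_integrable; exact: bmeasB.
    apply: Ex_le => [||w].
    - by apply: bmeas_norm; exact: bmeasB.
    - by apply: bmeasD; [exact: bmeas_cst|apply: bmeasM; [exact: bmeas_cst|exact: bmeas_sum]].
    - by apply: le_trans (acap _) _; under eq_bigr do rewrite mxE.
  rewrite ExD; [|exact: bmeas_cst|by apply: bmeasM; [exact: bmeas_cst|exact: bmeas_sum]].
  rewrite Ex_cst ExZ; last exact: bmeas_sum.
  rewrite Ex_sum//.
  have : 2 * M * (\sum_j Ex P (fun w => cap a (Z j w))) <= 2 * M * (k%:R * (2 * expR 2 / a)).
    apply: ler_wpM2l; first by rewrite mulr_ge0.
    apply: (@le_trans _ _ (\sum_(j < k) (2 * expR 2 / a))).
      by apply: ler_sum => j _; exact: brownian_cap.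
    by rewrite sumr_const card_ord (mulr_natl _ k).
  by move: aB; lra.
have trig_cvg : \sum_(tau : config n) mu tau * p (Y n tau) @[n --> \oo] --> Ex P (fun w => p (\row_j Z j w)).
  have -> : Ex P (fun w => p (\row_j Z j w)) =
     \sum_(t <- r) t.1.1 * Ex P (fun w => cos (\sum_j t.1.2 j * (sg * W (x j) w) + t.2)).
    have bc (t : R * ('I_k -> R) * R) :
        bmeas (fun w => cos (\sum_j t.1.2 j * (sg * W (x j) w) + t.2)).
      apply: (bmeas_trig true); apply: measurable_funD => //.
      by apply: measurable_sum => j; do 2 apply: measurable_funM => //.
    transitivity (Ex P (fun w => \sum_(t <- r) t.1.1 * cos (\sum_j t.1.2 j * (sg * W (x j) w) + t.2))).
      congr Ex; apply/funext => w; rewrite pE; apply: eq_bigr => t _.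
      by under eq_bigr do rewrite mxE.
    rewrite Ex_sum => [|t]; last by apply: bmeasM; [exact: bmeas_cst|exact: bc].
    by apply: eq_bigr => t _; rewrite ExZ.
  have E n : \sum_(tau : config n) mu tau * p (Y n tau) = \sum_(t <- r) t.1.1 *
      \sum_(tau : config n) mu tau *
        cos (\sum_j t.1.2 j * ((Num.sqrt n%:R)^-1 * height rho tau (x j)) + t.2).
    under eq_bigr do rewrite pE mulr_sumr.
    rewrite exchange_big; apply: eq_bigr => t _; rewrite mulr_sumr; apply: eq_bigr => tau _ /=.
    by under eq_bigr do rewrite mxE; rewrite mulrCA.
  rewrite (funext E).
  clear pE E; elim: r => [|t s IH].
    by rewrite big_nil; under eq_fun do rewrite big_nil; exact: cvg_cst.
  rewrite big_cons; under eq_fun do rewrite big_cons; apply: cvgD => //.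
  apply: cvgMr; exact: (scaled_height_cos_cvg hW rho_ge0 rho_le1 tedge mu_prob bulk).
have a2 : 2 / a ^+ 2 <= 2 * expR 2 / a.
  rewrite expr2 invfM mulrA ler_wpM2r ?invr_ge0 ?(ltW a0)//.
  rewrite ler_wpM2l//; apply: (@le_trans _ _ 1); first by rewrite invf_le1.
  by have := expR_ge1Dx (2 : R); lra.
have e4 : 0 < eta / 4 by rewrite divr_gt0.
move/cvgrPdist_lt : trig_cvg => /(_ _ e4) trig_cvg.
have caps : \forall n \near \oo, forall j,
    \sum_(tau : config n) mu tau * cap a ((Num.sqrt n%:R)^-1 * height rho tau (x j)) <= 2 / a ^+ 2.
  apply: filter_forall => j.
  exact: (scaled_height_cap rho_ge0 rho_le1 tedge mu_prob bulk a0 (x01 j)).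
near=> n.
have n0 : (0 < n)%N by near: n; exact: nbhs_infty_gt.
have [mu0 mu1] := mu_prob n0.
have h1 : `|Ex P (fun w => p (\row_j Z j w)) - \sum_(tau : config n) mu tau * p (Y n tau)| < eta / 4.
  by near: n; exact: trig_cvg.
have h2 : forall j, \sum_(tau : config n) mu tau * cap a ((Num.sqrt n%:R)^-1 * height rho tau (x j)) <= 2 / a ^+ 2.
  by near: n; exact: caps.
have h3 : `|\sum_(tau : config n) mu tau * f (Y n tau) - \sum_(tau : config n) mu tau * p (Y n tau)| <= eta / 4.
  rewrite -sumrB; apply: le_trans (ler_norm_sum _ _ _) _.
  apply: (@le_trans _ _ (\sum_(tau : config n) mu tau * (eta / 8 + 2 * M * \sum_j cap a (Y n tau ord0 j)))).
    apply: ler_sum => tau _; rewrite -mulrBr normrM ger0_norm// ler_wpM2l//; exact: acap.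
  under eq_bigr do rewrite mulrDr (mulrCA _ (2 * M)) mulr_sumr.
  rewrite big_split/= -mulr_suml mu1 mul1r -mulr_sumr exchange_big/=.
  have : 2 * M * (\sum_j \sum_(tau : config n) mu tau * cap a (Y n tau ord0 j))
     <= 2 * M * (k%:R * (2 * expR 2 / a)).
    apply: ler_wpM2l; first by rewrite mulr_ge0.
    apply: (@le_trans _ _ (\sum_(j < k) (2 * expR 2 / a))).
      apply: ler_sum => j _; apply: le_trans a2; apply: le_trans (h2 j).
      by apply: ler_sum => tau _; rewrite mxE.
    by rewrite sumr_const card_ord (mulr_natl _ k).
  by move: aB; lra.
rewrite distrC in h3.
have := ler_distD (Ex P (fun w => p (\row_j Z j w))) (Ex P (fun w => f (\row_j Z j w)))
  (\sum_(tau : config n) mu tau * f (Y n tau)).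
have := ler_distD (\sum_(tau : config n) mu tau * p (Y n tau)) (Ex P (fun w => p (\row_j Z j w)))
  (\sum_(tau : config n) mu tau * f (Y n tau)).
move: h3 h1 gauss eta0; lra.
Unshelve. all: by end_near. Qed.

End fdd_limit.

Lemma sqrt_bernoulli_variance {R : realType} (A : R) : 0 < A ->
  Num.sqrt (A / (1 + A) * (1 - A / (1 + A))) = Num.sqrt A / (1 + A) /\
  Num.sqrt (1 / (1 + A) * (1 - 1 / (1 + A))) = Num.sqrt A / (1 + A).
Proof.
move=> A0; have A1 : 0 < 1 + A by rewrite addr_gt0.
suff H : Num.sqrt (A / (1 + A) ^+ 2) = Num.sqrt A / (1 + A).
  by rewrite -H; split; congr Num.sqrt; field; rewrite gt_eqF.
by rewrite sqrtrM ?ltW// sqrtrV ?sqr_ge0// sqrtr_sqr gtr0_norm.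
Qed.

Theorem theorem1p4 (R : realType) (q alpha beta gamma delta : R)
    (hq0 : 0 <= q) (hq1 : q < 1) (halpha : 0 < alpha) (hbeta : 0 < beta)
    (hgamma : 0 <= gamma) (hdelta : 0 <= delta)
    (mu : forall n : nat, config n -> R)
    (hmu : forall n : nat, (0 < n)%N ->
       stationary_measure
         (asep_generator q alpha beta gamma delta (n := n)) (mu n))
    (d : measure_display) (T : measurableType d) (P : probability T R)
    (W : R -> {RV P >-> R}) (hW : standard_brownian_motion W) :
  let A := kappa_plus q beta delta in
  let C := kappa_plus q alpha gamma in
  (C < A -> 1 < A ->
     fdd_cvg P mu
       (fun n x tau => (Num.sqrt n%:R)^-1 * height (A / (1 + A)) tau x)
       (fun x w => Num.sqrt A / (1 + A) * W x w)) /\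
  (A < C -> 1 < C ->
     fdd_cvg P mu
       (fun n x tau => (Num.sqrt n%:R)^-1 * height (1 / (1 + C)) tau x)
       (fun x w => Num.sqrt C / (1 + C) * W x w)).
Proof.
move=> A C.
have mu_prob n : (0 < n)%N -> prob_weight (mu n) by move/hmu => [].
have inv : asep_invariant q alpha beta gamma delta mu.
  move=> n n0; split; first by have [_] := mu_prob n n0.
  apply: stationary_generator (hmu n n0).
  exact: jumpE.
split=> [CA A1|AC C1].
- have A0 : 0 < A by exact: lt_trans ltr01 A1.
  have A10 : 0 < 1 + A by rewrite addr_gt0.
  have [<- _] := sqrt_bernoulli_variance A0.
  apply: (bulk_bernoulli_fdd_cvg hW _ _ thin_left_edge mu_prob (high_density_bulk _ _ _ _ _ _ inv CA A1)) => //.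
    by rewrite divr_ge0 ?ltW.
  by rewrite ler_pdivrMr// mul1r lerDr.
- have C0 : 0 < C by exact: lt_trans ltr01 C1.
  have C10 : 0 < 1 + C by rewrite addr_gt0.
  have [_ <-] := sqrt_bernoulli_variance C0.
  apply: (bulk_bernoulli_fdd_cvg hW _ _ thin_right_edge mu_prob (low_density_bulk _ _ _ _ _ _ inv AC C1)) => //.
    by rewrite divr_ge0 ?ltW.
  by rewrite ler_pdivrMr// mul1r lerDl ltW.
Qed.
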